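(* Consider the EC-SDCA algorithm described in the context, where $Q$ is a contraction compressor with parameter $\delta$ that satisfies in addition $\mathbb{E}[Q(x)]=\delta x$, each $\phi_{i\tau}$ is $\frac1\gamma$-smooth, $g$ is $1$-strongly convex, and $\frac{R^2}\gamma\ge\lambda>0$. Assume $\delta<1$. Define $$\Psi_4^k:=\epsilon_D^k+\frac{2(\rho+\theta\lambda)}{\delta}\|e^k\|^2+\frac{16(1-\delta)(\rho+\theta\lambda)}{\delta n^2}\sum_{\tau=1}^n\|e_\tau^k\|^2 ,\qquad \epsilon_D^k:=D(\alpha^* )-D(\alpha^k),$$ where $e^k=\frac1n\sum_{\tau=1}^ne_\tau^k$, $\rho=\frac{\delta\lambda R}{2\sqrt{a_2}}$ and $a_2=(1-\delta)\big(2R^2+\frac{16\bar R^2}n+\frac{9\delta R_m^2}n\big)$. Choose $$\theta=\min\left\{\frac{2\delta\lambda\gamma}{\delta\lambda\gamma m+\sqrt{\delta^2\lambda^2\gamma^2m^2+48\lambda\gamma a_2}},\ \frac{N\lambda\gamma p_{i\tau}}{3v_{i\tau}+N\lambda\gamma},\ \frac{\delta\lambda\gamma}{\delta\lambda\gamma m+12R\sqrt{a_2}}\right\},$$ where $p_{i\tau}=\frac1m$ and $v_{i\tau}=R_m^2+nR^2$ for all $i,\tau$. Then $\mathbb{E}[\Psi_4^k]\le\left(1-\min\{\theta,\frac\delta4\}\right)^k\Psi_4^0$, and $\mathbb{E}[\Psi_4^k]\le\epsilon$ as long as $$k\ge O\left(\left(\frac1\delta+m+\frac{R_m^2}{n\lambda\gamma}+\frac{R^2}{\lambda\gamma}+\frac{\sqrt{1-\delta}}{\delta}\frac{R^2}{\lambda\gamma}\right)\ln\frac1\epsilon\right).\qquad(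 * )$$ Let $w_k=\left(1-\min\{\theta,\frac\delta4\}\right)^{-k}$, $W_k=\sum_{i=1}^kw_i$, and $\bar x^k=\frac1{W_k}\sum_{i=1}^kw_ix^i$. Then $$\mathbb{E}[P(\bar x^k)-P(x^* )]\le\frac{\left(1-\min\{\theta,\frac\delta4\}\right)^k\epsilon_D^0}{1-\left(1-\min\{\theta,\frac\delta4\}\right)^k},$$ and for $\epsilon\le\epsilon_D^0$, $\mathbb{E}[P(\bar x^k)-P(x^* )]\le\epsilon$ as long as $k$ satisfies $( * )$.
   Context: Problem: $N=mn$, $A_{i\tau}\in\mathbb{R}^{d\times t}$ for $1\le i\le m$, $1\le\tau\le n$; $\phi_{i\tau}:\mathbb{R}^t\to\mathbb{R}$ convex; $g:\mathbb{R}^d\to\mathbb{R}\cup\{+\infty\}$ proper closed convex; $\gamma>0$. Primal: $\min_{x\in\mathbb{R}^d}P(x)=\frac1N\sum_{\tau=1}^n\sum_{i=1}^m\phi_{i\tau}(A_{i\tau}^\top x)+\lambda g(x)$. Dual: $\max_{\alpha\in\mathbb{R}^{tN}}D(\alpha)=-\lambda g^*\big(\frac1{\lambda N}\sum_{\tau}\sum_iA_{i\tau}\alpha_{i\tau}\big)-\frac1N\sum_\tau\sum_i\phi_{i\tau}^*(-\alpha_{i\tau})$, where $\alpha$ consists of blocks $\alpha_{i\tau}\in\mathbb{R}^t$ and $\phi_{i\tau}^*,g^*$ are convex conjugates. $x^*$ and $\alpha^*$ are optimal solutions of the primal and dual problems. ''$\frac1\gamma$-smooth'' means differentiable with $\frac1\gamma$-Lipschitz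 gradient; ''$1$-strongly convex'' means $g-\frac12\|\cdot\|^2$ is convex. $\|\cdot\|$ is the Euclidean norm for vectors and the spectral norm for matrices. $R_m=\max_{i,\tau}\|A_{i\tau}\|$; $\bar R^2=\max_\tau\frac1m\lambda_{\max}(\sum_iA_{i\tau}A_{i\tau}^\top)$; $R^2=\frac1N\lambda_{\max}(\sum_\tau\sum_iA_{i\tau}A_{i\tau}^\top)$, with $R,\bar R\ge0$. A possibly randomized map $Q:\mathbb{R}^d\to\mathbb{R}^d$ is a contraction compressor with parameter $\delta\in(0,1]$ if $\mathbb{E}\|x-Q(x)\|^2\le(1-\delta)\|x\|^2$ for all $x\in\mathbb{R}^d$. EC-SDCA algorithm. Parameter $\theta>0$; $p_{i\tau}=\frac1m$. Initialization: $\alpha^0\in\mathbb{R}^{tN}$, $x^0\in\mathbb{R}^d$, $u^0=\frac1{\lambda N}\sum_\tau\sum_iA_{i\tau}\alpha_{i\tau}^0$, $e_\tau^0=0$. For $k=0,1,2,\dots$: $x^{k+1}=\nabla g^*(u^k)$; for each $\tau$ sample $i_k^\tau$ uniformly and independently from $\{1,\dots,m\}$, set $\Delta\alpha^{k+1}_{i_k^\tau\tau}=-\theta p_{i_k^\tau\tau}^{-1}\alpha^k_{i_k^\tau\tau}-\theta p_{i_k^\tau\tau}^{-1}\nabla\phi_{i_k^\tau\tau}(A_{i_k^\tau\tau}^\top x^{k+1})$, $\alpha^{k+1}_{i_k^\tau\tau}=\alpha^k_{i_k^\tau\tau}+\Delta\alpha^{k+1}_{i_k^\tau\tau}$ and $\alpha^{k+1}_{i\tau}=\alpha^k_{i\tau}$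 for $i\ne i_k^\tau$; $y_\tau^k=Q\big(\frac1{\lambda m}A_{i_k^\tau\tau}\Delta\alpha^{k+1}_{i_k^\tau\tau}+e_\tau^k\big)$; $e_\tau^{k+1}=e_\tau^k+\frac1{\lambda m}A_{i_k^\tau\tau}\Delta\alpha^{k+1}_{i_k^\tau\tau}-y_\tau^k$; finally $u^{k+1}=u^k+\frac1n\sum_\tau y_\tau^k$. Here $\alpha^k\in\mathbb{R}^{tN}$ is the vector with blocks $\alpha^k_{i\tau}$. *)

(* Defs.v *)
From HB Require Import structures.
From mathcomp Require Import all_boot all_order all_algebra.
From mathcomp Require Import finmap.
From mathcomp Require Import all_classical all_reals all_analysis.
Import Order.TTheory GRing.Theory Num.Theory.
Import numFieldNormedType.Exports.

Set Implicit Arguments.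
Unset Strict Implicit.
Unset Printing Implicit Defensive.

Local Open Scope classical_set_scope.
Local Open Scope ring_scope.

Section Euclidean.
Context {R : realType}.

Definition dot d (x y : 'cV[R]_d) : R := \sum_(j < d) x j 0 * y j 0.

(* The norm `|x| that the library puts on matrices is the sup norm, hence a
   separate Euclidean norm. *)
Definition enorm d (x : 'cV[R]_d) : R := Num.sqrt (dot x x).

Definition spectral_norm d t (M : 'M[R]_(d, t)) : R :=
  sup [set enorm (M *m x) | x in [set x : 'cV[R]_t | enorm x <= 1]].

(* Only meant for symmetric matrices of positive size, whose set of eigenvalues
   is finite and nonempty. *)
Definition lambda_max d (M : 'M[R]_d) : R := sup [set a | eigenvalue M a].

Definition grad d (f : 'cV[R]_d -> R) (x : 'cV[R]_d) : 'cV[R]_d :=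
  \col_(j < d) 'D_(delta_mx j 0) f x.

Definition smooth d (L : R) (f : 'cV[R]_d -> R) : Prop :=
  (forall x, differentiable f x) /\
  (forall x y, enorm (grad f x - grad f y) <= L * enorm (x - y)).

(* 0 * +oo = 0 in \bar R, so the endpoints s = 0 and s = 1 are harmless. *)
Definition econvex d (f : 'cV[R]_d -> \bar R) : Prop :=
  forall (x y : 'cV[R]_d) (s : R), 0 <= s <= 1 ->
    (f (s *: x + (1 - s) *: y)%R <= s%:E * f x + (1 - s)%:E * f y)%E.

Definition proper_closed_convex d (f : 'cV[R]_d -> \bar R) : Prop :=
  [/\ forall x, (f x != -oo)%E,
      exists x, (f x < +oo)%E,
      lower_semicontinuous f
    & econvex f].

Definition strongly_convex d (mu : R) (f : 'cV[R]_d -> \bar R) : Prop :=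
  econvex (fun x => (f x - (mu / 2 * enorm x ^+ 2)%:E)%E).

Definition conjugate d (f : 'cV[R]_d -> \bar R) (u : 'cV[R]_d) : \bar R :=
  ereal_sup [set ((dot x u)%:E - f x)%E | x in [set: 'cV[R]_d]].

End Euclidean.

Section Problem.
Context {R : realType} {m n d t : nat}.
Variables (A : 'I_m -> 'I_n -> 'M[R]_(d, t)) (phi : 'I_m -> 'I_n -> 'cV[R]_t -> R)
  (g : 'cV[R]_d -> \bar R) (lam : R).

Let N : R := (m * n)%:R.

Definition primal (x : 'cV[R]_d) : \bar R :=
  ((N^-1 * \sum_(tau < n) \sum_(i < m) phi i tau ((A i tau)^T *m x))%:E
   + lam%:E * g x)%E.

(* (lambda N)^-1 sum A_{i tau} alpha_{i tau} *)
Definition dual_point (alpha : 'I_m -> 'I_n -> 'cV[R]_t) : 'cV[R]_d :=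
  (lam * N)^-1 *: \sum_(tau < n) \sum_(i < m) A i tau *m alpha i tau.

Definition dual (alpha : 'I_m -> 'I_n -> 'cV[R]_t) : \bar R :=
  (- (lam%:E * conjugate g (dual_point alpha))
   - (N^-1)%:E * \sum_(tau < n) \sum_(i < m)
       conjugate (EFin \o phi i tau) (- alpha i tau)%R)%E.

(* The quantities maximized below are nonnegative, so that the default value 0
   of the iterated maxima plays no role when m, n > 0. *)
Definition Rm : R :=
  \big[Num.max/0]_(tau < n) \big[Num.max/0]_(i < m) spectral_norm (A i tau).

Definition Rbar2 : R :=
  \big[Num.max/0]_(tau < n)
    (m%:R^-1 * lambda_max (\sum_(i < m) A i tau *m (A i tau)^T)).

Definition R2 : R :=
  N^-1 * lambda_max (\sum_(tau < n) \sum_(i < m) A i tau *m (A i tau)^T).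

Record ec_state := EcState {
  ec_x : 'cV[R]_d;
  ec_alpha : 'I_m -> 'I_n -> 'cV[R]_t;
  ec_u : 'cV[R]_d;
  ec_e : 'I_n -> 'cV[R]_d }.

(* One iteration, given the sampled indices i tau and the maps q tau realized
   by the randomized compressor at this iteration. The conjugate of a proper
   closed strongly convex g is finite, so fine loses nothing. *)
Definition ec_step (theta : R) (i : 'I_n -> 'I_m)
    (q : 'I_n -> 'cV[R]_d -> 'cV[R]_d) (s : ec_state) : ec_state :=
  let p : R := m%:R^-1 in
  let x := grad (fine \o conjugate g) (ec_u s) in
  let Dalpha tau :=
    - (theta * p^-1) *: ec_alpha s (i tau) tau
    - (theta * p^-1) *: grad (phi (i tau) tau) ((A (i tau) tau)^T *m x) in
  let v tau := (lam * m%:R)^-1 *: (A (i tau) tau *m Dalpha tau) in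
  let y tau := q tau (v tau + ec_e s tau) in
  EcState x
    (fun j tau => if j == i tau then ec_alpha s j tau + Dalpha tau
                  else ec_alpha s j tau)
    (ec_u s + n%:R^-1 *: \sum_(tau < n) y tau)
    (fun tau => ec_e s tau + v tau - y tau).

Definition ec_init (x0 : 'cV[R]_d) (alpha0 : 'I_m -> 'I_n -> 'cV[R]_t) : ec_state :=
  EcState x0 alpha0 (dual_point alpha0) (fun=> 0).

Fixpoint ec_sdca (theta : R) (x0 : 'cV[R]_d) (alpha0 : 'I_m -> 'I_n -> 'cV[R]_t)
    (i : nat -> 'I_n -> 'I_m) (q : nat -> 'I_n -> 'cV[R]_d -> 'cV[R]_d)
    (k : nat) : ec_state :=
  if k is k'.+1 then ec_step theta (i k') (q k') (ec_sdca theta x0 alpha0 i q k')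
  else ec_init x0 alpha0.

End Problem.

Section Randomness.
Context {R : realType}.

Definition mutually_independent dT (T : measurableType dT) (Pr : probability T R)
    (I : choiceType) (F : I -> set (set T)) : Prop :=
  forall (J : {fset I}) (E : I -> set T), (forall i, i \in J -> F i (E i)) ->
    Pr (\bigcap_(i in [set` J]) E i) = (\prod_(i <- J) Pr (E i))%E.

Definition borel_cV d := g_sigma_algebraType (@open 'cV[R]_d).

(* A randomized map on R^d: Q s x is its value at x when the internal random
   seed, which has law nu, is s. *)
Definition randomized_map dS (S : measurableType dS) d
    (Q : S -> 'cV[R]_d -> 'cV[R]_d) : Prop :=
  forall j, measurable_fun [set: S * borel_cV d]
              (fun z : S * borel_cV d => Q z.1 z.2 j 0).

Definition contraction_compressor dS (S : measurableType dS)
    (nu : probability S R) d (Q : S -> 'cV[R]_d -> 'cV[R]_d) (delta : R) : Prop :=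
  [/\ 0 < delta <= 1, randomized_map Q
    & forall x, ('E_nu[(fun s => enorm (x - Q s x) ^+ 2)%R]
                 <= ((1 - delta) * enorm x ^+ 2)%:E)%E].

(* All the sampled indices idx k tau and all the seeds used by the calls to the
   compressor (one call per iteration k and node tau) are mutually independent,
   with the prescribed laws. *)
Definition ec_sampling dS (S : measurableType dS) (nu : probability S R)
    dT (T : measurableType dT) (Pr : probability T R) m n
    (idx : nat -> 'I_n -> T -> 'I_m) (seed : nat -> 'I_n -> T -> S) : Prop :=
  [/\ forall k tau i, measurable (idx k tau @^-1` [set i]) /\
        Pr (idx k tau @^-1` [set i]) = (m%:R^-1)%:E,
      forall k tau, measurable_fun [set: T] (seed k tau),
      forall k tau B, measurable B -> Pr (seed k tau @^-1` B) = nu B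
    & mutually_independent Pr
        (fun c : (nat * 'I_n) + (nat * 'I_n) =>
           match c with
           | inl (k, tau) => preimage_set_system [set: T] (idx k tau) setT
           | inr (k, tau) => preimage_set_system [set: T] (seed k tau) measurable
           end)].

End Randomness.

(* Main.v *)
(* One iteration started from a state (alpha, u, e) is
   analysed conditionally on the past, along the invariant that the dual point of
   alpha equals u + mean e. The conjugate of g is 1-smooth and the conjugates of
   the phi are gam-strongly convex, so moving the sampled blocks towards minus the
   gradients increases the dual by theta times the duality gap at x = grad g^*(u),
   up to a term controlled by |mean e|^2. Since E Q(x) = delta x, each call to the
   compressor on z leaves an error of mean (1 - delta) z and of mean square at most
   (1 - delta) |z|^2, and the errors of different nodes are independent: their
   mean has mean square (1 - delta)^2 |mean z|^2 plus a variance of order 1 / n.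
   Averaging over the sampled blocks, the weights of Psi_4 are such that all the
   terms in |grad phi + alpha|^2 are absorbed by the strong convexity of the phi^*
   as soon as theta satisfies three inequalities, one for each member of the
   minimum defining it; hence
     E [Psi_{k+1} + theta (P(x_{k+1}) - min P)] <= (1 - eta) E Psi_k
   with eta = min (theta, delta / 4). Iterating gives the linear rate; weighting by
   (1 - eta)^(-k), telescoping and convexity of P give the rate of the average. *)
Require Import Defs.
From HB Require Import structures.
From mathcomp Require Import all_boot all_order all_algebra.
From mathcomp Require Import finmap.
From mathcomp Require Import all_classical all_reals all_analysis.
From mathcomp Require Import measurable_realfun.
From mathcomp Require Import ring lra.
Import Order.TTheory GRing.Theory Num.Theory.
Import numFieldNormedType.Exports.

Set Implicit Arguments.
Unset Strict Implicit.
Unset Printing Implicit Defensive.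

Local Open Scope classical_set_scope.
Local Open Scope ring_scope.

(** * Euclidean space *)

(** Both problems can take infinite values: the conjugate of a [phi] may be [+oo], which makes the
    dual [-oo], and [g] may be [+oo]. The analysis runs on the real functions [dualR] and [primalR],
    exact on feasible blocks ([finite_dual]) and at gradients of the conjugate of [g]. A step
    preserves feasibility, and an infeasible start has an infinite initial gap. Conditioning on the
    past is done by Tonelli over the sigma-algebra generated by the sources already used; within an
    iteration the seeds are integrated out before the indices. As for the constants, Young's
    inequality weakens the factor [1 - delta] to [1 - delta / 2]. One [delta / 4] of this margin
    pays for the loss in the dual (which fixes the weight of the mean error) or for the leak of
    local errors into the mean error (which fixes their weight); the other [delta / 4] is the rate.
    [rho] is the Young parameter that equalizes the two terms where it enters, proportional to
    [R2 / (2 rho)] and to [2 rho a2 / (delta lam)^2]. *)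

Section Euclid.
Context {R : realType}.

Section Dot.
Context {d : nat}.
Implicit Types x y z : 'cV[R]_d.

Lemma dotC x y : dot x y = dot y x.
Proof. by apply: eq_bigr => j _; rewrite mulrC. Qed.

Lemma dotDl x y z : dot (x + y) z = dot x z + dot y z.
Proof. by rewrite -big_split; apply: eq_bigr => j _; rewrite !mxE mulrDl. Qed.

Lemma dotDr x y z : dot z (x + y) = dot z x + dot z y.
Proof. by rewrite !(dotC z) dotDl. Qed.

Lemma dotZl a x y : dot (a *: x) y = a * dot x y.
Proof. by rewrite mulr_sumr; apply: eq_bigr => j _; rewrite !mxE mulrA. Qed.

Lemma dotZr a x y : dot x (a *: y) = a * dot x y.
Proof. by rewrite dotC dotZl dotC. Qed.

Lemma dotNl x y : dot (- x) y = - dot x y.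
Proof. by rewrite -scaleN1r dotZl mulN1r. Qed.

Lemma dotNr x y : dot x (- y) = - dot x y.
Proof. by rewrite dotC dotNl dotC. Qed.

Lemma dot0l x : dot 0 x = 0.
Proof. by rewrite -(scale0r x) dotZl mul0r. Qed.

Lemma dot0r x : dot x 0 = 0.
Proof. by rewrite dotC dot0l. Qed.

Lemma sum_dot_ge0 d' (I : Type) (r : seq I) (P : pred I) (F : I -> 'cV[R]_d') :
  0 <= \sum_(i <- r | P i) dot (F i) (F i).
Proof.
by apply: sumr_ge0 => i _; apply: sumr_ge0 => j _; rewrite -expr2 sqr_ge0.
Qed.

Definition dotE := (dotDl, dotDr, dotZl, dotZr, dotNl, dotNr, dot0l, dot0r).

Lemma dot_suml (I : Type) (r : seq I) (P : pred I) (F : I -> 'cV[R]_d) y :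
  dot (\sum_(i <- r | P i) F i) y = \sum_(i <- r | P i) dot (F i) y.
Proof. exact: (big_morph (fun u => dot u y) (fun u v => dotDl u v y) (dot0l y)). Qed.

Lemma dot_sumr (I : Type) (r : seq I) (P : pred I) (F : I -> 'cV[R]_d) y :
  dot y (\sum_(i <- r | P i) F i) = \sum_(i <- r | P i) dot y (F i).
Proof. by rewrite dotC dot_suml; under eq_bigr do rewrite dotC. Qed.

Lemma dot_ge0 x : 0 <= dot x x.
Proof. by apply: sumr_ge0 => j _; rewrite -expr2 sqr_ge0. Qed.
Hint Resolve dot_ge0 : core.

Lemma dot_coord_le x j : x j 0 ^+ 2 <= dot x x.
Proof.
rewrite /dot (bigD1 j) //= -expr2 lerDl.
by apply: sumr_ge0 => i _; rewrite -expr2 sqr_ge0.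
Qed.

Lemma dot_eq0 x : (dot x x == 0) = (x == 0).
Proof.
apply/eqP/eqP => [x0|->]; last by rewrite dot0l.
apply/matrixP => j k; rewrite ord1 mxE; apply/eqP; rewrite -sqrf_eq0.
by rewrite eq_le sqr_ge0 andbT -x0 dot_coord_le.
Qed.

Lemma sqr_enorm x : enorm x ^+ 2 = dot x x.
Proof. by rewrite sqr_sqrtr. Qed.

Lemma enorm_ge0 x : 0 <= enorm x.
Proof. exact: sqrtr_ge0. Qed.

Lemma cauchy_schwarz x y : dot x y ^+ 2 <= dot x x * dot y y.
Proof.
have [->|x0] := eqVneq x 0; first by rewrite !dot0l mul0r expr0n.
have xx : 0 < dot x x by rewrite lt_def dot_eq0 x0 dot_ge0.
have := dot_ge0 (y - (dot x y / dot x x) *: x).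
rewrite !dotE (dotC y x) -(ler_pM2l xx) mulr0 => h.
rewrite -subr_ge0; apply: le_trans h _; rewrite le_eqVlt; apply/orP; left.
by apply/eqP; field; rewrite gt_eqF.
Qed.

Lemma dot_le_enorm x y : dot x y <= enorm x * enorm y.
Proof.
rewrite (le_trans (ler_norm _))// -(@ler_pXn2r _ 2) ?nnegrE ?mulr_ge0 ?enorm_ge0//.
by rewrite exprMn !sqr_enorm real_normK ?num_real// cauchy_schwarz.
Qed.

Lemma dot_young (c : R) x y : 0 < c -> dot x y <= c / 2 * dot x x + (2 * c)^-1 * dot y y.
Proof.
move=> c0; have := dot_ge0 (c *: x - y); rewrite !dotE (dotC y x) => h.
have : 0 <= (2 * c)^-1 * (c * (c * dot x x) + - dot x y * c - (c * dot x y - dot y y)).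
  by apply: mulr_ge0; [rewrite invr_ge0 mulr_ge0// ltW|lra].
move=> {}h; rewrite -subr_ge0; apply: le_trans h _.
by rewrite le_eqVlt; apply/orP; left; apply/eqP; field; rewrite gt_eqF.
Qed.

Lemma nsqD_young (c : R) x y : 0 < c ->
  dot (x + y) (x + y) <= (1 + c) * dot x x + (1 + c^-1) * dot y y.
Proof.
move=> c0; have := dot_young x y c0; rewrite !dotE (dotC y x) invfM => h.
nra.
Qed.

End Dot.

Lemma dot_mulmx d t (A : 'M[R]_(d, t)) x y : dot (A *m x) y = dot x (A^T *m y).
Proof.
rewrite /dot (eq_bigr (fun j => \sum_k A j k * x k 0 * y j 0)); last first.
  by move=> j _; rewrite mxE mulr_suml.
rewrite exchange_big /=; apply: eq_bigr => k _; rewrite mxE mulr_sumr.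
by apply: eq_bigr => j _; rewrite mxE; ring.
Qed.

Lemma continuous_mx (X : topologicalType) m n (f : X -> 'M[R]_(m, n)) :
  (forall i j, continuous (fun x => f x i j)) -> continuous f.
Proof.
move=> cf x A /= [B nB BA]; rewrite /= nbhs_simpl /=.
have : \forall y \near x, forall ij : 'I_m * 'I_n, B ij.1 ij.2 (f y ij.1 ij.2).
  by apply: filter_forall => -[i j] /=; exact: (cf i j x).
by apply: filterS => y fy; apply: BA => i j; exact: (fy (i, j)).
Qed.

Lemma continuous_sumR (X : topologicalType) (I : Type) (r : seq I) (f : I -> X -> R) :
  (forall i, continuous (f i)) -> continuous (fun x => \sum_(i <- r) f i x).
Proof.
move=> cf x; elim: r => [|i r ih].
  by under eq_fun do rewrite big_nil; exact: cvg_cst.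
rewrite /continuous_at; under eq_fun do rewrite big_cons; rewrite big_cons.
by apply: cvgD => //; exact: cf.
Qed.

Lemma continuous_dot (X : topologicalType) d (f h : X -> 'cV[R]_d) :
  continuous f -> continuous h -> continuous (fun x => dot (f x) (h x)).
Proof.
move=> cf ch; apply: continuous_sumR => j x.
apply: cvgM.
  by apply: (@continuous_comp _ _ _ f (fun M : 'cV[R]_d => M j 0));
    [exact: cf|exact: coord_continuous].
by apply: (@continuous_comp _ _ _ h (fun M : 'cV[R]_d => M j 0));
    [exact: ch|exact: coord_continuous].
Qed.

Lemma continuous_mulmx d t (A : 'M[R]_(d, t)) : continuous (fun x : 'cV[R]_t => A *m x).
Proof.
apply: continuous_mx => i j; under eq_fun do rewrite mxE.
apply: continuous_sumR => k x.
apply: (@continuousM R _ (cst (A i k)) (fun x : 'cV[R]_t => x k j)).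
  exact: cst_continuous.
exact: coord_continuous.
Qed.

(** Heine-Borel is carried over from row vectors by the continuous transpose; a bound on the
    Euclidean square bounds every coordinate, hence the sup norm. *)
Lemma compact_cV d (A : set 'cV[R]_d) (B : R) :
  closed A -> (forall x, A x -> dot x x <= B) -> compact A.
Proof.
move=> clA AB.
have ctr m n : continuous (@trmx R m n).
  by apply: continuous_mx => i j; under eq_fun do rewrite mxE; exact: coord_continuous.
have -> : A = trmx @` [set v : 'rV[R]_d | A v^T].
  apply/seteqP; split => [x Ax|_ [v Av <-]] //.
  by exists x^T; rewrite /= ?trmxK.
apply: continuous_compact; first exact/continuous_subspaceT/ctr.
apply: bounded_closed_compact; last by apply: closed_comp => // v _; exact: ctr.
exists (`|B| + 1); split; first exact: num_real.
move=> M BM v /= /AB vB; rewrite [leLHS]mx_normrE.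
apply/bigmax_leP; split => [|[i j] _ /=].
  by rewrite (le_trans _ (ltW BM))// addr_ge0.
apply: le_trans (ltW BM); rewrite ord1.
have := dot_coord_le v^T j; rewrite mxE => /le_trans/(_ vB) h.
rewrite -(@ler_pXn2r _ 2) ?nnegrE ?addr_ge0// real_normK ?num_real//.
by have := ler_norm B; have := normr_ge0 B; nra.
Qed.

Lemma closed_sublevel (X : topologicalType) (q : X -> R) r :
  continuous q -> closed [set x | q x <= r].
Proof.
move=> cq; apply: (@closed_comp _ _ q [set s | s <= r]); first by move=> x _; exact: cq.
exact: closed_le.
Qed.

(** Were the infimum [mi] not attained, every [x] in [K] would have a real [a x] strictly between
    [mi] and [f x]. The open sets where [f] exceeds [a x] cover [K], and the least [a z] of a finite
    subcover is a lower bound of [f] on [K] greater than [mi]. *)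
Lemma lsc_min (X : ptopologicalType) (f : X -> \bar R) (K : set X) :
  compact K -> K !=set0 -> lower_semicontinuous f -> (forall x, f x != -oo%E) ->
  exists2 x, K x & forall y, K y -> (f x <= f y)%E.
Proof.
move=> cK [x0 Kx0] /lower_semicontinuousP lf fNy.
have [mi miE] : exists mi, mi = ereal_inf [set f x | x in K] by eexists.
have mile y : K y -> (mi <= f y)%E by move=> Ky; rewrite miE; apply: ereal_inf_lbound; exists y.
have [[x Kx fx]|nomin] := pselect (exists2 x, K x & (f x <= mi)%E).
  by exists x => // y Ky; exact: le_trans fx (mile y Ky).
have ex x : exists a : R, K x -> (mi < a%:E < f x)%E.
  have [Kx|nKx] := pselect (K x); last by exists 0.
  have lt : (mi < f x)%E by rewrite ltNge; apply/negP => h; apply: nomin; exists x.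
  move: lt (fNy x); clear mile nomin miE; case: (f x) => [r| |] // + _.
    case: mi => [s| |] // lt.
      by exists ((s + r) / 2) => _; move: lt; rewrite !lte_fin => lt; lra.
    by exists (r - 1) => _; rewrite ltNyr lte_fin; lra.
  case: mi => [s| |] // _.
    by exists (s + 1) => _; rewrite ltry lte_fin; lra.
  by exists 0 => _; rewrite ltNyr ltry.
pose a x := projT1 (cid (ex x)).
have aP x : K x -> (mi < (a x)%:E < f x)%E := projT2 (cid (ex x)).
move: cK; rewrite compact_cover => /(_ _ K (fun x => [set y | (a x)%:E < f y]%E)).
case=> [x _|x Kx|D DK cov]; first exact: lf.
  by exists x => //=; have /andP[] := aP x Kx.
have [z zD zmin] : exists2 z, z \in D & forall y, y \in D -> a z <= a y.
  have [z0 [z0D _]] := cov x0 Kx0.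
  have z0D' : z0 \in D by [].
  case: (@arg_minP _ _ D [` z0D']%fset predT (fun x => a (val x)) isT) => z _ zm.
  by exists (val z) => [|y yD]; [exact: valP|exact: (zm [` yD]%fset)].
have : (mi < (a z)%:E)%E by have /set_mem/aP/andP[] := DK _ zD.
rewrite ltNge => /negP; case.
rewrite miE; apply: le_ereal_inf_tmp => _ [y Ky <-]; have [w [wD /= aw]] := cov y Ky.
by apply: ltW; apply: le_lt_trans aw; rewrite lee_fin zmin.
Qed.

End Euclid.

(** * Spectral bounds *)

Section Spectrum.
Context {R : realType}.

(** [eigenvalue] speaks of row vectors; symmetry turns their transposes into column eigenvectors. *)
Lemma eigenvalue_sym d (M : 'M[R]_d) a : M^T = M -> eigenvalue M a ->
  exists2 x : 'cV[R]_d, x != 0 & M *m x = a *: x.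
Proof.
move=> Ms /eigenvalueP[v vM v0]; exists v^T.
  by apply: contraNneq v0 => h; rewrite -(trmxK v) h trmx0.
by rewrite -{1}Ms -trmx_mul vM linearZ.
Qed.

Lemma lambda_max_le d (M : 'M[R]_d) (B : R) : M^T = M -> 0 <= B ->
  (forall x, dot x (M *m x) <= B * dot x x) -> lambda_max M <= B.
Proof.
move=> Ms B0 MB; rewrite /lambda_max.
(* Without eigenvalues, as in dimension 0, [sup] is 0 and the sign of [B] concludes. *)
have [->|/set0P ne] := eqVneq [set a | eigenvalue M a] set0; first by rewrite sup0.
apply: ge_sup => // a /= /(eigenvalue_sym Ms)[x x0 Mx].
have xx : 0 < dot x x by rewrite lt_def dot_eq0 x0 dot_ge0.
by have := MB x; rewrite Mx dotZr ler_pM2r.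
Qed.

(* A maximizer c of the Rayleigh quotient is an eigenvector: with value mu at c,
   the form mu |x|^2 - x.Mx is nonnegative and vanishes at c. *)
Lemma rayleigh_le d (M : 'M[R]_d) x : M^T = M ->
  dot x (M *m x) <= lambda_max M * dot x x.
Proof.
move=> Ms; have [->|x0] := eqVneq x 0; first by rewrite mulmx0 !dotE mulr0.
have xx : 0 < dot x x by rewrite lt_def dot_eq0 x0 dot_ge0.
pose S : set 'cV[R]_d := [set y | dot y y = 1].
have normalize y : 0 < dot y y -> S ((enorm y)^-1 *: y).
  move=> yy; have e0 : enorm y != 0 by rewrite gt_eqF// sqrtr_gt0.
  by rewrite /S /= !dotE -sqr_enorm; field.
have cdot (f h : 'cV[R]_d -> 'cV[R]_d) : continuous f -> continuous h ->
    {within S, continuous (fun y => dot (f y) (h y))}.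
  by move=> cf ch; apply/continuous_subspaceT/continuous_dot.
have clS : closed S.
  have := @closed_comp _ _ (fun y : 'cV[R]_d => dot y y) [set r : R | r = 1].
  by apply; [move=> y _; apply: continuous_dot => z; exact: cvg_id|exact: closed_eq].
have [|||c /set_mem cS cmax] := @compact_EVT_max _ R (fun y => dot y (M *m y)) S.
- by exists ((enorm x)^-1 *: x); exact: normalize.
- by apply: (@compact_cV _ _ _ 1) => // y ->.
- by apply: cdot => [z|]; [exact: cvg_id|exact: continuous_mulmx].
set mu := dot c (M *m c) in cmax.
have le_mu y : dot y (M *m y) <= mu * dot y y.
  have [->|y0] := eqVneq y 0; first by rewrite mulmx0 !dotE mulr0.
  have yy : 0 < dot y y by rewrite lt_def dot_eq0 y0 dot_ge0.
  have := cmax _ (mem_set (normalize _ yy)).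
  rewrite -scalemxAr !dotE mulrA -invfM -expr2 sqr_enorm.
  by rewrite mulrC ler_pdivrMr.
have Mc : M *m c = mu *: c.
  have [r rE] : exists r, r = mu *: c - M *m c by eexists.
  pose q := mu * dot r r - dot r (M *m r).
  have q0 : 0 <= q by rewrite subr_ge0 le_mu.
  (* [r] is half the gradient at [c] of the form [mu |x|^2 - x.Mx], and [q] the value of the form at
     [r]. Moving from [c] by [s *: r] changes the form by [2 s |r|^2 + s^2 q], which this [s] makes
     negative unless [r = 0]; [q + 1] avoids a division by zero. *)
  pose s := - dot r r / (q + 1).
  have := le_mu (c + s *: r); rewrite mulmxDr -scalemxAr !dotE cS.
  have -> : dot c (M *m r) = dot r (M *m c) by rewrite dotC dot_mulmx Ms.
  have -> : dot c r = dot r c by exact: dotC.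
  rewrite -/mu => h.
  have rr : dot r r = mu * dot r c - dot r (M *m c).
    by rewrite {2}rE !dotE.
  have {}h : 0 <= 2 * s * dot r r + s ^+ 2 * q by rewrite /q rr in h *; nra.
  have h2 : (q + 1) ^+ 2 * (2 * s * dot r r + s ^+ 2 * q) = - (dot r r) ^+ 2 * (q + 2).
    by rewrite /s; field; rewrite gt_eqF// ltr_wpDl.
  have : 0 <= - (dot r r) ^+ 2 * (q + 2) by rewrite -h2 mulr_ge0// sqr_ge0.
  rewrite mulNr oppr_ge0 pmulr_lle0 ?ltr_wpDl// => rr0.
  have : dot r r == 0 by rewrite -sqrf_eq0 eq_le rr0 sqr_ge0.
  by rewrite dot_eq0 rE subr_eq0 => /eqP ->.
have c0 : c != 0 by apply/eqP => c0; move: cS; rewrite /S /= c0 dot0l; lra.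
apply: le_trans (le_mu x) _; rewrite ler_pM2r//.
apply: ub_le_sup; last first.
  apply/eigenvalueP; exists c^T; last first.
    by apply: contraNneq c0 => h; rewrite -(trmxK c) h trmx0.
  by rewrite -{1}Ms -trmx_mul Mc linearZ.
(* Boundedness of the set of eigenvalues, without which its [sup] would be a default value. *)
exists mu => a /= /(eigenvalue_sym Ms)[y y0 My].
have yy : 0 < dot y y by rewrite lt_def dot_eq0 y0 dot_ge0.
by have := le_mu y; rewrite My dotZr ler_pM2r.
Qed.

Section Gram.
Context {I : finType} {d t : nat} (A : I -> 'M[R]_(d, t)).
Let M := \sum_i A i *m (A i)^T.

Lemma gram_sym : M^T = M.
Proof. by rewrite /M linear_sum /=; apply: eq_bigr => i _; rewrite /= trmx_mul trmxK. Qed.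

Lemma dot_gram x : dot x (M *m x) = \sum_i dot ((A i)^T *m x) ((A i)^T *m x).
Proof.
rewrite /M mulmx_suml dot_sumr; apply: eq_bigr => i _.
by rewrite -mulmxA dotC dot_mulmx.
Qed.

Lemma dot_gram_ge0 x : 0 <= dot x (M *m x).
Proof. by rewrite dot_gram sum_dot_ge0. Qed.

Lemma lambda_max_gram_ge0 : 0 <= lambda_max M.
Proof.
have [ne|e0] := pselect (exists x : 'cV[R]_d, x != 0); last first.
  rewrite /lambda_max (_ : [set a | _] = set0) ?sup0//.
  rewrite -subset0 => a /= /(eigenvalue_sym gram_sym)[x x0 _].
  by apply: e0; exists x.
case: ne => x x0; have xx : 0 < dot x x by rewrite lt_def dot_eq0 x0 dot_ge0.
rewrite -(pmulr_lge0 _ xx); apply: le_trans (rayleigh_le x gram_sym).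
exact: dot_gram_ge0.
Qed.

(** A matrix and its adjoint have the same norm. With [y] the sum and [L] the top eigenvalue, expand
    the squares of [L a_i - A_i^T y] and bound the sum of the |A_i^T y|^2 by [L |y|^2]: this leaves
    [L |y|^2 <= L^2 G]. If [L = 0], every [A_i^T y] vanishes, hence so does [y]. *)
Lemma sum_mulmx_le (a : I -> 'cV[R]_t) :
  dot (\sum_i A i *m a i) (\sum_i A i *m a i) <=
  lambda_max M * \sum_i dot (a i) (a i).
Proof.
set y := \sum_i _; set L := lambda_max M; set G := \sum_i dot _ _.
have yyE : dot y y = \sum_i dot (a i) ((A i)^T *m y).
  by rewrite {1}/y dot_suml; apply: eq_bigr => i _; rewrite dot_mulmx.
have Ay : \sum_i dot ((A i)^T *m y) ((A i)^T *m y) <= L * dot y y.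
  by rewrite -dot_gram; exact: rayleigh_le gram_sym.
have G0 : 0 <= G by exact: sum_dot_ge0.
have [L0|L0] := ltP 0 L.
  have : 0 <= \sum_i dot (L *: a i - (A i)^T *m y) (L *: a i - (A i)^T *m y).
    exact: sum_dot_ge0.
  rewrite (eq_bigr (fun i => L ^+ 2 * dot (a i) (a i) - 2 * L * dot (a i) ((A i)^T *m y)
      + dot ((A i)^T *m y) ((A i)^T *m y))); last first.
    by move=> i _; rewrite !dotE (dotC ((A i)^T *m y)); ring.
  rewrite !big_split /= sumrN -!mulr_sumr -yyE -/G => h.
  by rewrite -(ler_pM2l L0); nra.
have {L0} L0 : L = 0 by apply/eqP; rewrite eq_le L0 lambda_max_gram_ge0.
have z i : (A i)^T *m y = 0.
  apply/eqP; rewrite -dot_eq0 eq_le dot_ge0 andbT.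
  move: Ay; rewrite L0 mul0r (bigD1 i)//=; apply: le_trans; rewrite lerDl.
  exact: sum_dot_ge0.
by rewrite yyE L0 mul0r big1// => i _; rewrite z dot0r.
Qed.

End Gram.

Lemma spectral_norm_ge d t (M : 'M[R]_(d, t)) x : enorm (M *m x) <= spectral_norm M * enorm x.
Proof.
have bnd z : dot (M *m z) (M *m z) <= (\sum_j dot (row j M)^T (row j M)^T) * dot z z.
  rewrite mulr_suml; apply: ler_sum => j _; rewrite -expr2.
  have -> : (M *m z) j 0 = dot (row j M)^T z.
    by rewrite mxE; apply: eq_bigr => k _; rewrite !mxE.
  exact: cauchy_schwarz.
(* The Frobenius norm bounds the image of the unit ball, so the [sup] is a genuine upper bound. *)
have Mub : has_ubound [set enorm (M *m x) | x in [set x : 'cV[R]_t | enorm x <= 1]].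
  exists (Num.sqrt (\sum_j dot (row j M)^T (row j M)^T)) => _ [z /= z1 <-].
  rewrite ler_wsqrtr// (le_trans (bnd z))// ler_piMr ?sum_dot_ge0//.
  by rewrite -sqr_enorm expr_le1// enorm_ge0.
have [->|x0] := eqVneq x 0; first by rewrite mulmx0 /enorm !dot0l sqrtr0 mulr0.
have e0 : 0 < enorm x by rewrite sqrtr_gt0 lt_def dot_eq0 x0 dot_ge0.
rewrite -ler_pdivrMr//; apply: ub_le_sup => //; exists ((enorm x)^-1 *: x) => /=.
  rewrite {1}/enorm !dotE -sqr_enorm (_ : _ * _ = 1) ?sqrtr1//.
  by field; rewrite gt_eqF.
rewrite -scalemxAr /enorm !dotE mulrA sqrtrM ?mulr_ge0 ?invr_ge0 ?sqrtr_ge0//.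
by rewrite -expr2 sqrtr_sqr ger0_norm ?invr_ge0 ?sqrtr_ge0// mulrC.
Qed.

End Spectrum.

Section Radii.
Context {R : realType} {m n d t : nat} (A : 'I_m -> 'I_n -> 'M[R]_(d, t)).
Hypotheses (m0 : (0 < m)%N) (n0 : (0 < n)%N).

Let mR : 0 < m%:R :> R. Proof. by rewrite ltr0n. Qed.
Let nR : 0 < n%:R :> R. Proof. by rewrite ltr0n. Qed.

Lemma Rm_ge0 : 0 <= Rm A.
Proof. exact: bigmax_ge_id. Qed.

Lemma Rbar2_ge0 : 0 <= Rbar2 A.
Proof. exact: bigmax_ge_id. Qed.

Let Ap (p : 'I_n * 'I_m) := A p.2 p.1.

Let gramE : \sum_(tau < n) \sum_(i < m) A i tau *m (A i tau)^T =
  \sum_p Ap p *m (Ap p)^T.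
Proof. by rewrite pair_bigA. Qed.

Lemma R2_ge0 : 0 <= R2 A.
Proof. by rewrite /R2 gramE mulr_ge0 ?invr_ge0// lambda_max_gram_ge0. Qed.

Lemma Rm_le i tau x : dot (A i tau *m x) (A i tau *m x) <= Rm A ^+ 2 * dot x x.
Proof.
rewrite -!sqr_enorm -exprMn ler_pXn2r ?nnegrE ?mulr_ge0 ?enorm_ge0 ?Rm_ge0//.
apply: le_trans (spectral_norm_ge _ _) _; rewrite ler_wpM2r ?enorm_ge0//.
apply: le_trans (le_bigmax _ _ tau).
exact: (le_bigmax _ (fun i => spectral_norm (A i tau))).
Qed.

Lemma R2_le (a : 'I_m -> 'I_n -> 'cV[R]_t) :
  dot (\sum_(tau < n) \sum_(i < m) A i tau *m a i tau)
      (\sum_(tau < n) \sum_(i < m) A i tau *m a i tau) <=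
  (m * n)%:R * R2 A * \sum_(tau < n) \sum_(i < m) dot (a i tau) (a i tau).
Proof.
rewrite /R2 gramE mulrA divff ?mul1r; last by rewrite natrM mulf_neq0 ?gt_eqF.
have := sum_mulmx_le Ap (fun p => a p.2 p.1).
by rewrite -(pair_bigA _ (fun tau i => A i tau *m a i tau))
  -(pair_bigA _ (fun tau i => dot (a i tau) (a i tau))).
Qed.

Lemma Rbar2_le tau (a : 'I_m -> 'cV[R]_t) :
  dot (\sum_(i < m) A i tau *m a i) (\sum_(i < m) A i tau *m a i) <=
  m%:R * Rbar2 A * \sum_(i < m) dot (a i) (a i).
Proof.
apply: le_trans (sum_mulmx_le (A ^~ tau) a) _.
rewrite ler_wpM2r ?sum_dot_ge0// -ler_pdivrMl//.
exact: (le_bigmax _ (fun tau =>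
  m%:R^-1 * lambda_max (\sum_(i < m) A i tau *m (A i tau)^T)) tau).
Qed.

(** As quadratic forms, the Gram matrix of one node is dominated by that of all nodes. This removes
    [Rbar2] from the final complexity. *)
Lemma Rbar2_le_R2 : Rbar2 A <= n%:R * R2 A.
Proof.
apply/bigmax_leP; split=> [|tau _]; first by rewrite mulr_ge0 ?R2_ge0.
rewrite ler_pdivrMl// mulrA -natrM.
apply: lambda_max_le; first exact: (gram_sym (A ^~ tau)).
  by rewrite mulr_ge0 ?R2_ge0.
move=> x; rewrite /R2 gramE mulrA divff ?mul1r; last by rewrite natrM mulf_neq0 ?gt_eqF.
apply: le_trans (rayleigh_le x (gram_sym Ap)).
rewrite (dot_gram (A ^~ tau)) (dot_gram Ap).
rewrite -(pair_bigA _ (fun tau i => dot ((A i tau)^T *m x) ((A i tau)^T *m x))) /=.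
rewrite [leRHS](bigD1 tau)//= lerDl sumr_ge0// => j _; exact: sum_dot_ge0.
Qed.

End Radii.

(** * Smooth functions and convex conjugates *)

Section ConvexAnalysis.
Context {R : realType}.

Lemma grad_diff d (f : 'cV[R]_d -> R) x h : differentiable f x ->
  'D_h f x = dot (grad f x) h.
Proof.
move=> df; rewrite deriveE// {1}(matrix_sum_delta h).
rewrite linear_sum; apply: eq_bigr => j _.
by rewrite big_ord1 linearZ/= !mxE deriveE// mulrC.
Qed.

Lemma is_derive_line d (f : 'cV[R]_d -> R) x h (r : R) :
  (forall x, differentiable f x) ->
  is_derive r 1 (fun s : R => f (x + s *: h)) (dot (grad f (x + r *: h)) h).
Proof.
move=> df; set F := fun s : R => _.
have E : (fun s : R => s^-1 *: (F (s *: (1 : R^o) + r) - F r)) =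
    (fun s : R => s^-1 *: (f (s *: h + (x + r *: h)) - f (x + r *: h))).
  apply/funext => s; congr (_ *: (f _ - _)).
  by rewrite [s *: 1]mulr1 scalerDl addrCA addrA.
apply: DeriveDef.
  by rewrite /derivable E; exact: diff_derivable.
by rewrite -grad_diff// /derive E.
Qed.

Lemma sqr_dist_continuous (X : topologicalType) (f q : X -> R) x :
  {for x, continuous q} -> q x = 0 -> (forall y, (f x - f y) ^+ 2 <= q y) ->
  {for x, continuous f}.
Proof.
move=> cq qx fq; apply/cvgrPdist_lt => e e0.
have /cvgrPdist_lt/(_ (e ^+ 2) (exprn_gt0 _ e0)) := cq.
apply: filterS => y; rewrite qx sub0r normrN => h.
rewrite -(@ltr_pXn2r _ 2) ?nnegrE ?(ltW e0)// real_normK ?num_real//.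
by apply: le_lt_trans (fq y) _; apply: le_lt_trans (ler_norm _) h.
Qed.

Lemma lipschitz_continuous d t (f : 'cV[R]_d -> 'cV[R]_t) (L : R) :
  (forall x y, dot (f x - f y) (f x - f y) <= L * dot (x - y) (x - y)) -> continuous f.
Proof.
move=> lf; apply: continuous_mx => i j x; rewrite ord1.
apply: (@sqr_dist_continuous _ (fun y => f y i 0) (fun y => L * dot (x - y) (x - y))).
- apply: (@continuousM R 'cV[R]_d (cst L) (fun y => dot (x - y) (x - y)) x).
    exact: cst_continuous.
  by apply: continuous_dot => y; apply: continuousB;
    by [exact: cst_continuous|exact: cvg_id].
- by rewrite subrr dot0l mulr0.
- by move=> y; apply: le_trans (lf x y); have := dot_coord_le (f x - f y) i; rewrite !mxE.
Qed.

Section Smooth.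
Context {d : nat} (f : 'cV[R]_d -> R) (L : R).
Hypotheses (L0 : 0 <= L) (fs : smooth L f).

Lemma smooth_lipschitz x y :
  dot (grad f x - grad f y) (grad f x - grad f y) <= L ^+ 2 * dot (x - y) (x - y).
Proof.
by rewrite -!sqr_enorm -exprMn ler_pXn2r ?nnegrE ?mulr_ge0 ?enorm_ge0//; exact: fs.2.
Qed.

Lemma smooth_continuous : continuous f.
Proof. by move=> x; apply: differentiable_continuous; exact: fs.1. Qed.

Lemma grad_continuous : continuous (grad f).
Proof. apply: (@lipschitz_continuous _ _ _ (L ^+ 2)) => x y; exact: smooth_lipschitz. Qed.

(** The signs [s = 1] and [s = -1] give the upper and the lower quadratic bound at once. Along the
    segment from [x] to [y], the increment of [psi] over [0, 1] is the difference of the two sides,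
    and the Lipschitz gradient makes its derivative nonpositive; the mean value theorem
    concludes. *)
Lemma smooth_signed_le (s : R) x y : s ^+ 2 = 1 ->
  s * (f y - f x - dot (grad f x) (y - x)) <= L / 2 * dot (y - x) (y - x).
Proof.
move=> s1; set h := y - x; set b := dot (grad f x) h; set q := dot h h.
pose F (r : R) := f (x + r *: h).
pose dF (r : R) := dot (grad f (x + r *: h)) h.
pose psi (r : R) := s * (F r - b * r) - (L / 2 * q) * r ^+ 2.
pose dpsi (r : R) := s * (dF r - b) - L * q * r.
have dpsiP (r : R) : is_derive r 1 psi (dpsi r).
  have F' := is_derive_line x h r fs.1.
  have -> : psi = s \*: (F - b \*: id) - (L / 2 * q) \*: (id ^+ 2).
    by apply/funext => z; rewrite /psi.
  apply: is_derive_eq.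
  by rewrite /dpsi /dF /GRing.scale /= !mulr1 expr1; field.
have [|c] := @MVT R psi dpsi 0 1 ltr01 (fun (r : R) _ => dpsiP r).
  apply: derivable_within_continuous => r _.
  by have [] := dpsiP r.
rewrite in_itv /= => /andP[c0 c1].
rewrite subr0 mulr1 /psi /F scale1r scale0r addr0 expr1n expr0n /= !mulr1 !mulr0 !subr0.
rewrite subrKC => E.
have : dpsi c <= 0.
  rewrite /dpsi subr_le0 /dF /b -dotNl -dotDl -dotZl.
  apply: le_trans (dot_le_enorm _ _) _.
  rewrite {1}/enorm dotZl dotZr mulrA -expr2 s1 mul1r -/(enorm _).
  apply: le_trans (_ : L * enorm (c *: h) * enorm h <= _).
    rewrite ler_wpM2r ?enorm_ge0//; apply: le_trans (fs.2 _ _) _.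
    by rewrite addrAC subrr add0r.
  rewrite {1}/enorm dotZl dotZr mulrA -expr2 sqrtrM ?sqr_ge0// sqrtr_sqr ger0_norm ?(ltW c0)//.
  by rewrite -/(enorm h) /q -sqr_enorm -subr_ge0 le_eqVlt eq_sym; apply/orP; left; apply/eqP; ring.
by rewrite -E; lra.
Qed.

Lemma smooth_le x y :
  f y <= f x + dot (grad f x) (y - x) + L / 2 * dot (y - x) (y - x).
Proof. by have := @smooth_signed_le 1 x y (expr1n _ _); lra. Qed.

Lemma smooth_ge x y :
  f x + dot (grad f x) (y - x) - L / 2 * dot (y - x) (y - x) <= f y.
Proof. have sq1 : (-1 : R) ^+ 2 = 1 by rewrite sqrrN expr1n.
by have := smooth_signed_le x y sq1; lra. Qed.

End Smooth.

Lemma convex_functionP d (f : 'cV[R]_d -> R) x y (s : R) :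
  convex_function [set: convex_lmodType 'cV[R]_d] f -> 0 <= s <= 1 ->
  f (s *: x + (1 - s) *: y) <= s * f x + (1 - s) * f y.
Proof.
move=> cf /andP[s0 s1].
by have := cf (Itv01 s0 s1) x y (in_setT _) (in_setT _).
Qed.

(** Convexity at [x + s h] compared with the quadratic lower bound gives the tangent inequality up
    to an error proportional to [s], which is sent to 0. *)
Lemma convex_grad_le d (f : 'cV[R]_d -> R) (L : R) x y : 0 <= L -> smooth L f ->
  convex_function [set: convex_lmodType 'cV[R]_d] f ->
  f x + dot (grad f x) (y - x) <= f y.
Proof.
move=> L0 fs cf; have [h hE] : exists h, h = y - x by eexists.
rewrite -hE; have [q qE] : exists q, q = dot h h by eexists.
have q0 : 0 <= q by rewrite qE dot_ge0.
have key (s : R) : 0 < s <= 1 -> f x + dot (grad f x) h - L / 2 * s * q <= f y.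
  move=> /andP[s0 s1]; rewrite -(ler_pM2l s0).
  have := @convex_functionP _ f y x s cf; rewrite (ltW s0) s1 => /(_ isT).
  have -> : s *: y + (1 - s) *: x = x + s *: h.
    by rewrite hE scalerBl scale1r scalerBr addrCA.
  have := smooth_ge fs x (x + s *: h).
  rewrite [x + _ - x]addrAC subrr add0r !dotE -qE; nra.
apply/ler_addgt0Pr => e e0.
(* Makes the error [L / 2 * s * q] at most [e]; the [+ 1] covers the case where [L / 2 * q] is 0. *)
pose s := Num.min 1 (e / (L / 2 * q + 1)).
have B0 : 0 < L / 2 * q + 1 by rewrite ltr_wpDl// mulr_ge0// divr_ge0.
have s0 : 0 < s by rewrite lt_min ltr01 divr_gt0.
have := key s; rewrite s0 ge_min lexx => /(_ isT).
have : s * (L / 2 * q + 1) <= e by rewrite -ler_pdivlMr// ge_min lexx orbT.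
lra.
Qed.

Lemma conjugate_ge d (f : 'cV[R]_d -> \bar R) x u :
  ((dot x u)%:E - f x <= conjugate f u)%E.
Proof. by apply: ereal_sup_ubound; exists x. Qed.

Lemma conjugate_le d (f : 'cV[R]_d -> \bar R) u M :
  (forall x, ((dot x u)%:E - f x <= M)%E) -> (conjugate f u <= M)%E.
Proof. by move=> fM; apply: ge_ereal_sup => _ [x _ <-]. Qed.

(** The sublevel set is an intersection of closed half-spaces, one per point [x]. This is what makes
    extended-valued conjugates Borel. *)
Lemma conjugate_lsc d (f : 'cV[R]_d -> \bar R) a :
  (forall x, f x != -oo%E) -> (forall x, f x != +oo%E) ->
  closed [set u | (conjugate f u <= a%:E)%E].
Proof.
move=> fNy fy.
have -> : [set u | (conjugate f u <= a%:E)%E] =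
    \bigcap_(x in setT) [set u | dot x u <= a + fine (f x)].
  apply/seteqP; split => [u /= fu x _ /=|u fu /=].
    have := le_trans (conjugate_ge f x u) fu.
    by move: (fNy x) (fy x); case: (f x) => //= r _ _; rewrite -EFinB lee_fin lerBlDr.
  apply: conjugate_le => x; have := fu x I => /=.
  by move: (fNy x) (fy x); case: (f x) => //= r _ _; rewrite -EFinB lee_fin lerBlDr.
apply: closed_bigI => x _.
apply: closed_sublevel; apply: continuous_dot; first exact: cst_continuous.
by move=> z; exact: cvg_id.
Qed.

Section ConjugateOfSmooth.
Context {d : nat} (f : 'cV[R]_d -> R) (gam : R).
Hypotheses (gam0 : 0 < gam) (fs : smooth gam^-1 f).

Let Vgam0 : 0 <= gam^-1. Proof. by rewrite invr_ge0 ltW. Qed.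

Lemma conjugate_gt_ninfty u : conjugate (EFin \o f) u != -oo%E.
Proof.
rewrite -ltNye; apply: lt_le_trans (conjugate_ge (EFin \o f) 0 u).
by rewrite /= -EFinB ltNyr.
Qed.

(* For every y, the point y + gam (w - grad f y) tested in the definition of the
   conjugate at w gives y.w - f y + gam/2 |w - grad f y|^2 by the descent lemma;
   combining this at u and v yields the quadratic term. *)
Lemma conjugate_smooth_strongly_convex u v a b (s : R) : 0 <= s <= 1 ->
  conjugate (EFin \o f) u = a%:E -> conjugate (EFin \o f) v = b%:E ->
  (conjugate (EFin \o f) (u + s *: (v - u)) <=
   ((1 - s) * a + s * b - gam / 2 * s * (1 - s) * dot (v - u) (v - u))%:E)%E.
Proof.
move=> /andP[s0 s1] ua vb; apply: conjugate_le => y; rewrite /= -EFinB lee_fin.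
have key w c : conjugate (EFin \o f) w = c%:E ->
    dot y w - f y + gam / 2 * dot (w - grad f y) (w - grad f y) <= c.
  move=> wc; have [r rE] : exists r, r = w - grad f y by eexists.
  rewrite -rE.
  have := conjugate_ge (EFin \o f) (y + gam *: r) w.
  rewrite wc /= -EFinB lee_fin; apply: le_trans.
  have := smooth_le fs y (y + gam *: r).
  rewrite [y + _ - y]addrAC subrr add0r !dotE.
  have E : dot r r = dot r w - dot (grad f y) r.
    by rewrite {2}rE dotDr dotNr (dotC (grad f y)).
  have -> : gam^-1 / 2 * (gam * (gam * dot r r)) = gam / 2 * dot r r by field; rewrite gt_eqF.
  rewrite E; lra.
have := key _ _ ua; have := key _ _ vb.
set z := grad f y.
have -> : v - z = (v - u) + (u - z) by rewrite addrA subrK.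
have [h hE] : exists h, h = v - u by eexists.
have [k kE] : exists k, k = u - z by eexists.
rewrite -hE -kE.
rewrite !dotE (dotC k h).
(* The quadratic term comes from [(1 - s) |k|^2 + s |k + h|^2 = |k + s h|^2 + s (1 - s) |h|^2]. *)
have := dot_ge0 (k + s *: h); rewrite !dotE (dotC k h) => sq hb ha.
have {}ha := ler_wpM2l (_ : 0 <= 1 - s) ha; have {}hb := ler_wpM2l s0 hb.
have {}ha := ha (_ : 0 <= 1 - s); rewrite subr_ge0 in ha.
have {}ha := ha s1.
have {}sq := mulr_ge0 (ltW gam0) sq.
have yv : dot y v = dot y u + dot y h by rewrite hE !dotE; ring.
rewrite yv in hb; lra.
Qed.

Lemma conjugate_grad (z : 'cV[R]_d) :
  convex_function [set: convex_lmodType 'cV[R]_d] f ->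
  conjugate (EFin \o f) (grad f z) = (dot z (grad f z) - f z)%:E.
Proof.
move=> cf; apply/eqP; rewrite eq_le (conjugate_ge (EFin \o f) z) andbT.
apply: conjugate_le => y; rewrite /= -EFinB lee_fin.
have := convex_grad_le z y Vgam0 fs cf; rewrite dotDr dotNr !(dotC (grad f z)); lra.
Qed.

End ConjugateOfSmooth.

End ConvexAnalysis.

(** * Smoothness of the conjugate of a 1-strongly convex function *)

Section ConjugateOfStronglyConvex.
Context {R : realType} {d : nat} (g : 'cV[R]_d -> \bar R).
Hypotheses (gp : proper_closed_convex g) (gs : strongly_convex 1 g).

Lemma proper_gt_ninfty x : g x != -oo%E.
Proof. by case: gp. Qed.

Lemma strongly_convex_le x y a b (s : R) : g x = a%:E -> g y = b%:E -> 0 <= s <= 1 ->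
  (g (s *: x + (1 - s) *: y) <=
   (s * a + (1 - s) * b - s * (1 - s) / 2 * dot (x - y) (x - y))%:E)%E.
Proof.
move=> gx gy s01; have := gs x y s01; rewrite /= gx gy !sqr_enorm.
move: (proper_gt_ninfty (s *: x + (1 - s) *: y)).
case: (g _) => [c| |] //= _.
rewrite -!EFinB -!EFinM -EFinD !lee_fin !dotE (dotC y x); nra.
Qed.

Lemma shifted_lsc u : lower_semicontinuous (fun x => g x - (dot x u)%:E)%E.
Proof.
move=> x a; case: gp => gN _ gl _; move: (gl x) (gN x).
have cd : continuous (fun y : 'cV[R]_d => dot y u).
  by apply: continuous_dot; [move=> y; exact: cvg_id|exact: cst_continuous].
move=> gx gNx ax.
have [e e0 {}ax] : exists2 e : R, 0 < e & ((a + dot x u + e)%:E < g x)%E.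
  move: ax gNx; case: (g x) => [r| |] // ax _; last by exists 1; rewrite ?ltry.
  move: ax; rewrite -EFinB lte_fin => ax.
  exists ((r - dot x u - a) / 2); first lra.
  by rewrite lte_fin; lra.
have [V nV VP] := gx _ ax.
have /cvgrPdist_lt/(_ _ e0) nW := cd x.
exists (V `&` [set y | `|dot x u - dot y u| < e]); first exact: filterI.
move=> y [/VP + /= h]; have h2 : dot y u < dot x u + e.
  by have := ler_norm (- (dot x u - dot y u)); rewrite normrN; lra.
case: (g y) => [r| |] /=; [|by rewrite addye// !ltry|by []].
by rewrite -EFinB !lte_fin; lra.
Qed.

(** The domain is not compact, so strong convexity must confine the search. Let [m1] be the minimum
    on the unit ball around a point [x0] of the domain and [f0] the value at [x0]. If [y] is at
    distance [w > 1] from [x0], the point [z] of the segment at distance 1 has value at least [m1],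
    and strong convexity makes the value at [y] at least [f0 + w ((w - 1) / 2 - (f0 - m1))]. Beyond
    radius [1 + 2 (f0 - m1)] this is at least [f0], so minimizing on that ball suffices. *)
Lemma shifted_min u : exists x r, g x = r%:E /\
  forall y b, g y = b%:E -> r - dot x u <= b - dot y u.
Proof.
have [x0 gx0] : exists x, (g x < +oo)%E by case: gp.
have [a0 ga0] : exists a, g x0 = a%:E.
  by move: gx0 (proper_gt_ninfty x0); case: (g x0) => // r _ _; exists r.
pose f x := (g x - (dot x u)%:E)%E.
have fNy x : f x != -oo%E by move: (proper_gt_ninfty x); rewrite /f; case: (g x).
pose B (rho : R) : set 'cV[R]_d := [set x | dot (x - x0) (x - x0) <= rho ^+ 2].
have cB rho : compact (B rho).
  apply: (@compact_cV _ _ _ (2 * rho ^+ 2 + 2 * dot x0 x0)).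
    apply: closed_sublevel; apply: continuous_dot => y; apply: continuousB;
      by [exact: cst_continuous|exact: cvg_id].
  move=> x; rewrite /B /= => Bx; have := @nsqD_young _ _ 1 (x - x0) x0 ltr01.
  by rewrite subrK invr1; lra.
have Bx0 rho : B rho x0 by rewrite /B /= subrr dot0l sqr_ge0.
have minB rho : exists x r, [/\ B rho x, g x = r%:E &
    forall y b, B rho y -> g y = b%:E -> r - dot x u <= b - dot y u].
  have [x Bx xmin] := lsc_min (cB rho) (ex_intro _ x0 (Bx0 rho)) (@shifted_lsc u) fNy.
  have := xmin _ (Bx0 rho); rewrite ga0; move: (proper_gt_ninfty x).
  case gxE : (g x) => [r| |] //= _ _; exists x, r; split => // y b By gy.
  by have := xmin _ By; rewrite gxE gy -!EFinB lee_fin.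
have [x1 [r1 [Bx1 gx1 min1]]] := minB 1.
pose m1 := r1 - dot x1 u; pose f0 := a0 - dot x0 u.
have m1f0 : m1 <= f0 by exact: min1 (Bx0 1) ga0.
have [x [r [Bx gx minx]]] := minB (1 + 2 * (f0 - m1)).
exists x, r; split => // y b gy.
have [By|nBy] := pselect (B (1 + 2 * (f0 - m1)) y); first exact: minx.
apply: le_trans (minx _ _ (Bx0 _) ga0) _; rewrite -/f0.
set w := enorm (y - x0).
have w2 : w ^+ 2 = dot (y - x0) (y - x0) by rewrite sqr_enorm.
have wbig : 1 + 2 * (f0 - m1) < w.
  rewrite -(@ltr_pXn2r _ 2) ?nnegrE ?enorm_ge0//; last by lra.
  by rewrite w2 ltNge; apply/negP.
have w1 : 1 <= w by lra.
have w0 : 0 < w by lra.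
have Vw : 0 <= w^-1 <= 1 by rewrite invr_ge0 (ltW w0) invf_le1.
have := strongly_convex_le gy ga0 Vw; rewrite -w2.
set z := (X in g X).
have zx0 : z - x0 = w^-1 *: (y - x0).
  by rewrite /z scalerBl scale1r scalerBr addrA addrAC addrK.
have Bz : B 1 z by rewrite /B /= zx0 dotZl dotZr -w2 expr1n mulrA -invfM -expr2 mulVf// sqrf_eq0 gt_eqF.
have zu : dot z u = w^-1 * dot y u + (1 - w^-1) * dot x0 u by rewrite /z !dotE.
move: (proper_gt_ninfty z); case gz : (g z) => [c| |] //= _; rewrite lee_fin.
have := min1 _ _ Bz gz; rewrite -/m1 zu => h1 h2.
have h3 : w * m1 <= b - dot y u + (w - 1) * f0 - (w - 1) / 2 * w.
  have : m1 <= w^-1 * b + (1 - w^-1) * a0 - w^-1 * (1 - w^-1) / 2 * w ^+ 2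
             - (w^-1 * dot y u + (1 - w^-1) * dot x0 u) by lra.
  rewrite -(ler_pM2l w0) => /le_trans; apply.
  by rewrite -subr_ge0 le_eqVlt /f0 eq_sym; apply/orP; left; apply/eqP; field; rewrite gt_eqF.
have : 0 <= w * ((w - 1) / 2 - (f0 - m1)) by apply: mulr_ge0; lra.
lra.
Qed.

(** The maximizer in the definition of the conjugate, shown below to be its gradient. *)
Definition conj_argmax u : 'cV[R]_d := projT1 (cid (shifted_min u)).

(** Quadratic growth: strong convexity on the segment from the minimizer to [y], divided by the step
    [s], gives the bound with factor [(1 - s) / 2], and [s] tends to 0. *)
Lemma conj_argmaxP u : exists r, g (conj_argmax u) = r%:E /\
  forall y b, g y = b%:E -> r - dot (conj_argmax u) u +
    dot (y - conj_argmax u) (y - conj_argmax u) / 2 <= b - dot y u.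
Proof.
rewrite /conj_argmax; case: cid => /= x [r [gx xmin]]; exists r; split=> // y b gy.
have [q qE] : exists q, q = dot (y - x) (y - x) by eexists.
rewrite -qE; have q0 : 0 <= q by rewrite qE dot_ge0.
have key (s : R) : 0 < s <= 1 -> r - dot x u + (1 - s) / 2 * q <= b - dot y u.
  move=> /andP[s0 s1].
  have := strongly_convex_le gy gx (_ : 0 <= s <= 1); rewrite (ltW s0) s1 => /(_ isT).
  rewrite -qE; set z := (X in g X).
  have zu : dot z u = s * dot y u + (1 - s) * dot x u by rewrite /z !dotE.
  move: (proper_gt_ninfty z); case gz : (g z) => [c| |] //= _; rewrite lee_fin.
  have := xmin _ _ gz; rewrite zu => h1 h2; rewrite -(ler_pM2l s0); nra.
apply/ler_addgt0Pr => e e0.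
pose s := Num.min 1 (e / (q + 1)).
have s0 : 0 < s by rewrite lt_min ltr01 divr_gt0// ltr_wpDl.
have := key s; rewrite s0 ge_min lexx => /(_ isT).
have : s * (q + 1) <= e by rewrite -ler_pdivlMr ?ltr_wpDl// ge_min lexx orbT.
nra.
Qed.

Local Notation h := (fine \o conjugate g).

Let conj_val u : conjugate g u = (dot (conj_argmax u) u - fine (g (conj_argmax u)))%:E.
Proof.
have [r [gx xmin]] := conj_argmaxP u.
apply/eqP; rewrite eq_le; apply/andP; split; last first.
  by apply: le_trans (conjugate_ge g (conj_argmax u) u); rewrite gx.
apply: conjugate_le => y; move: (proper_gt_ninfty y); case gy : (g y) => [b| |] //= _; last by rewrite addeNy leNye.
rewrite gx /= -EFinB lee_fin; have := xmin _ _ gy; have := dot_ge0 (y - conj_argmax u); lra.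
Qed.

Lemma conjugate_fin u : conjugate g u = (h u)%:E.
Proof. by rewrite /= conj_val. Qed.

Let g_argmax u : g (conj_argmax u) = (dot (conj_argmax u) u - h u)%:E.
Proof.
have [r [gx _]] := conj_argmaxP u.
by rewrite /= conj_val /= gx /=; congr (_%:E); lra.
Qed.

Lemma fenchel_young x u : ((dot x u - h u)%:E <= g x)%E.
Proof.
have := conjugate_ge g x u; rewrite conjugate_fin.
move: (proper_gt_ninfty x); case: (g x) => [r| |] //= _; last by rewrite leey.
by rewrite -?EFinB !lee_fin; lra.
Qed.

Let argmax_growth u x b : g x = b%:E ->
  dot (x - conj_argmax u) (x - conj_argmax u) / 2 <= b - dot x u + h u.
Proof.
have [r [gx xmin]] := conj_argmaxP u => /xmin.
by rewrite /= conj_val gx /=; lra.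
Qed.

(** For the lower bound, the maximizer for [u] competes at [v]. For the upper one, growth at [u]
    tested at the maximizer for [v] gives [k.l - |k|^2 / 2], with [k] the difference of the
    maximizers and [l = v - u]; completing the square leaves [|l|^2 / 2]. *)
Let conj_diff u v :
  0 <= h v - h u - dot (conj_argmax u) (v - u) <= dot (v - u) (v - u) / 2.
Proof.
apply/andP; split.
  have := fenchel_young (conj_argmax u) v; rewrite g_argmax lee_fin dotDr dotNr; lra.
have := argmax_growth u (g_argmax v).
have := dot_ge0 (conj_argmax v - conj_argmax u - (v - u)).
set x := conj_argmax v; set y := conj_argmax u.
have [k kE] : exists k, k = x - y by eexists.
have [l lE] : exists l, l = v - u by eexists.
have -> : v = u + l by rewrite lE subrKC.
have -> : x = y + k by rewrite kE subrKC.
rewrite (addrC y) addrK (addrC u) addrK !dotE !(dotC _ l); lra.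
Qed.

(** [grad] collects partial derivatives, so difference quotients along basis vectors are enough;
    [conj_diff] puts them within [|s| / 2] of the coordinates of the maximizer. *)
Lemma grad_conjugate u : grad h u = conj_argmax u.
Proof.
apply/matrixP => j k; rewrite ord1 mxE; apply: cvg_lim => //.
apply/cvgrPdist_le => e e0.
exists e => //= s; rewrite /ball_ /= sub0r normrN => se s0.
have := conj_diff u (s *: delta_mx j 0 + u).
rewrite addrK !dotE -/(h _).
have -> : dot (conj_argmax u) (delta_mx j 0) = conj_argmax u j 0.
  rewrite /dot (bigD1 j)//= big1 ?addr0 ?mxE ?eqxx ?mulr1// => i ij.
  by rewrite !mxE (negbTE ij) mulr0.
have -> : dot (delta_mx j 0) (delta_mx j 0) = 1 :> R.
  rewrite /dot (bigD1 j)//= big1 ?addr0 ?mxE ?eqxx ?mulr1// => i ij.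
  by rewrite !mxE (negbTE ij) mulr0.
set D := h _ - h u; set c := conj_argmax u j 0; rewrite mulr1 => /andP[h1 h2].
rewrite /GRing.scale /=.
have -> : c - s^-1 * D = - (s^-1 * (D - s * c)) by field.
rewrite normrN normrM normfV (ger0_norm h1).
rewrite ler_pdivrMl ?normr_gt0//; apply: le_trans h2 _.
rewrite -expr2 -real_normK ?num_real// expr2.
by have := normr_ge0 s; nra.
Qed.

Lemma g_grad_conjugate u : g (grad h u) = (dot (grad h u) u - h u)%:E.
Proof. by rewrite grad_conjugate g_argmax. Qed.

Lemma conjugate_smooth u v :
  0 <= h v - h u - dot (grad h u) (v - u) <= dot (v - u) (v - u) / 2.
Proof. by rewrite grad_conjugate conj_diff. Qed.

(** Adding the growth inequalities at [u] and at [v], each tested at the other maximizer, gives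
    [|k|^2 <= k.l]; the square of [k - l] turns this into [|k|^2 <= |l|^2]. *)
Lemma grad_conjugate_lipschitz u v :
  dot (grad h u - grad h v) (grad h u - grad h v) <= dot (u - v) (u - v).
Proof.
rewrite !grad_conjugate.
have := argmax_growth u (g_argmax v); have := argmax_growth v (g_argmax u).
set x := conj_argmax u; set y := conj_argmax v.
have := dot_ge0 (x - y - (u - v)).
have [k kE] : exists k, k = x - y by eexists.
have [l lE] : exists l, l = u - v by eexists.
have -> : u = v + l by rewrite lE subrKC.
have -> : x = y + k by rewrite kE subrKC.
have -> : y - (y + k) = - k by rewrite opprD addrA subrr add0r.
rewrite !(addrC _ k) !(addrC _ l) !addrK !dotE !(dotC _ l); lra.
Qed.

Lemma grad_conjugate_continuous : continuous (grad h).
Proof.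
apply: (@lipschitz_continuous _ _ _ _ 1) => u v.
by rewrite mul1r grad_conjugate_lipschitz.
Qed.

Lemma conjugate_continuous : continuous h.
Proof.
move=> u; pose D v := dot (grad h u) (v - u); pose q v := dot (v - u) (v - u).
have cB : continuous (fun v : 'cV[R]_d => v - u).
  by move=> v; apply: continuousB; [exact: cvg_id|exact: cst_continuous].
apply: (@sqr_dist_continuous _ _ _ (fun v => 2 * D v ^+ 2 + q v ^+ 2)).
- have cq : continuous q by apply: continuous_dot; exact: cB.
  have cD : continuous D by apply: continuous_dot; [exact: cst_continuous|exact: cB].
  apply: continuousD; last by apply: continuousM; exact: cq.
  by apply: continuousM; [exact: cst_continuous|apply: continuousM; exact: cD].
- by rewrite /D /q subrr dot0r dot0l !expr0n /= mulr0 addr0.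
move=> v; have := conjugate_smooth u v; rewrite -/(D v) -/(q v) => /andP[h1 h2].
have := sqr_ge0 (D v - (h v - h u - D v)).
have : (h v - h u - D v) ^+ 2 <= (q v / 2) ^+ 2.
  by rewrite ler_pXn2r// nnegrE //; apply: divr_ge0 => //; exact: dot_ge0.
have := sqr_ge0 (q v); nra.
Qed.

End ConjugateOfStronglyConvex.

(** * Borel vectors and independence *)

Section BorelVectors.
Context {R : realType}.

Lemma measurable_open_cV d (U : set 'cV[R]_d) : open U ->
  measurable (U : set (borel_cV d)).
Proof. by move=> oU; apply: sub_sigma_algebra. Qed.

Lemma continuous_borel d (f : 'cV[R]_d -> R) : continuous f ->
  measurable_fun [set: borel_cV d] (f : borel_cV d -> R).
Proof.
move=> cf; apply: (measurability _ (RGenOpens.measurableE R)).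
move=> _ [_ [a [b ->]] <-]; rewrite setTI; apply: measurable_open_cV.
by apply: open_comp => [x _|]; [exact: cf|exact: interval_open].
Qed.

Lemma closed_sublevel_borel d (f : 'cV[R]_d -> \bar R) :
  (forall a : R, closed [set x | (f x <= a%:E)%E]) ->
  measurable_fun [set: borel_cV d] (f : borel_cV d -> \bar R).
Proof.
move=> cf; apply: (measurability _ (ErealGenOInfty.measurableE R)).
move=> _ [_ [a ->] <-]; rewrite setTI preimage_itvoy.
rewrite (_ : [set t | _] = ~` [set x | (f x <= a%:E)%E]); last first.
  by apply/seteqP; split => x /=; rewrite ltNge => /negP.
by apply: measurable_open_cV; exact: closed_openC.
Qed.

Section IntoVectors.
Context dX (X : measurableType dX).

Lemma measurable_coord d (f : X -> borel_cV d) j :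
  measurable_fun [set: X] f -> measurable_fun [set: X] (fun w => (f w : 'cV[R]_d) j 0).
Proof.
move=> mf; apply: (@measurableT_comp _ _ _ _ _ _ (fun v : borel_cV d => (v : 'cV[R]_d) j 0) _ f) => //.
by apply: continuous_borel; exact: coord_continuous.
Qed.

(* Every open set of R^d is the union of the rational boxes it contains. *)
Lemma measurable_cV d (f : X -> 'cV[R]_d) :
  (forall j, measurable_fun [set: X] (fun w => f w j 0)) ->
  measurable_fun [set: X] (f : X -> borel_cV d).
Proof.
move=> mf; apply: (@measurability _ _ X (borel_cV d) setT f open) => //.
move=> _ [U oU <-]; rewrite setTI.
pose box (q : 'cV[rat]_d * rat) : set 'cV[R]_d :=
  [set y | forall j, `|y j 0 - ratr (q.1 j 0)| < ratr q.2].
have -> : f @^-1` U = \bigcup_(q in [set q | box q `<=` U]) (f @^-1` box q).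
  apply/seteqP; split => [w /= Ufw|w [q qU]]; last exact: qU.
  have /nbhs_ballP[e /= e0 eU] : nbhs (f w) U by exact: open_nbhs_nbhs.
  have [r] : exists r : rat, ratr r \in `]e / 4, e / 2[%R by apply: rat_in_itvoo; lra.
  rewrite in_itv /= => /andP[r1 r2].
  have qex j : exists q : rat, `|f w j 0 - ratr q| < e / 4.
    have [q] : exists q : rat, ratr q \in `](f w j 0 - e / 4), (f w j 0)[%R.
      by apply: rat_in_itvoo; lra.
    by rewrite in_itv /= => /andP[q1 q2]; exists q; rewrite ltr_norml; apply/andP; split; lra.
  exists (\col_j projT1 (cid (qex j)), r) => [y By|j] /=; last first.
    by rewrite mxE; case: cid => q /= /lt_trans; apply.
  apply: eU; split => // j k; rewrite ord1 /ball /=.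
  have := By j; rewrite /= mxE; case: cid => q /= h1 h2.
  have := ler_normB (f w j 0 - ratr q) (y j 0 - ratr q).
  have -> : f w j 0 - ratr q - (y j 0 - ratr q) = f w j 0 - y j 0 by ring.
  lra.
rewrite bigcup_mkcond; apply: countable_bigcupT_measurable; first exact: countableP.
move=> q; case: ifP => // _.
have -> : f @^-1` box q = \bigcap_(j in [set: 'I_d])
    ((fun w => f w j 0 - ratr (q.1 j 0)) @^-1` `]- ratr q.2, ratr q.2[).
  apply/seteqP; split => [w /= h j _ /=|w h j]; first by rewrite in_itv /= -ltr_norml.
  by have := h j I; rewrite /= in_itv /= -ltr_norml.
apply: fin_bigcap_measurable => // j _; rewrite -[X in measurable X]setTI.
apply: measurable_funB => //; exact: mf.
Qed.

Lemma measurable_continuous_cV d t (h : 'cV[R]_d -> 'cV[R]_t) (f : X -> borel_cV d) :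
  continuous h -> measurable_fun [set: X] f ->
  measurable_fun [set: X] (h \o f : X -> borel_cV t).
Proof.
move=> ch mf; apply: measurable_cV => j.
apply: (@measurableT_comp _ _ _ _ _ _ (fun v : borel_cV d => h v j 0) _ f) => //.
apply: continuous_borel => x.
by apply: (@continuous_comp _ _ _ h (fun M : 'cV[R]_t => M j 0));
  [exact: ch|exact: coord_continuous].
Qed.

Lemma measurable_dot d (f h : X -> borel_cV d) :
  measurable_fun [set: X] f -> measurable_fun [set: X] h ->
  measurable_fun [set: X] (fun w => dot (f w) (h w) : R).
Proof.
move=> mf mh; apply: measurable_sum => j.
by apply: measurable_funM; exact: measurable_coord.
Qed.

End IntoVectors.

End BorelVectors.

Section Independence.
Context {R : realType} dT {T : measurableType dT} (Pr : probability T R).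

(** Plays the role of conditioning on [<<s G>>]. The first coordinate of [w |-> (w, Z w)] is [T]
    with the smaller sigma-algebra; the law of this map agrees with the product law on rectangles,
    hence everywhere, and Tonelli integrates [Z] out. *)
Lemma independent_tonelli (G : set (set T)) dS (S : measurableType dS)
    (Z : {mfun T >-> S}) (f : g_sigma_algebraType G * S -> \bar R) :
  G `<=` measurable ->
  (forall A B, <<s G >> A -> measurable B ->
    Pr (A `&` Z @^-1` B) = (Pr A * Pr (Z @^-1` B))%E) ->
  measurable_fun setT f -> (forall z, 0 <= f z)%E ->
  (\int[Pr]_w f (w, Z w) = \int[Pr]_w \int[distribution Pr Z]_s f (w, s))%E.
Proof.
move=> Gm ind mf f0.
have sGm : <<s G >> `<=` measurable by apply: smallest_sub => //; exact: sigma_algebra_measurable.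
pose TG := g_sigma_algebraType G.
have mid : measurable_fun [set: T] (id : T -> TG).
  by move=> _ B mB; rewrite setTI; exact: sGm.
have mgr : measurable_fun [set: T] (fun w => (w : TG, Z w)).
  by apply: measurable_fun_pair => //; exact: measurable_funPT.
pose idm : {mfun T >-> TG} := HB.pack (id : T -> TG) (isMeasurableFun.Build _ _ _ _ _ mid).
pose gr : {mfun T >-> (TG * S)%type} := HB.pack (fun w => (w : TG, Z w))
  (isMeasurableFun.Build _ _ _ _ _ mgr).
transitivity (\int[distribution Pr gr]_z f z)%E.
  by rewrite ge0_integral_distribution.
transitivity (\int[(distribution Pr idm) \x (distribution Pr Z)]_z f z)%E.
  apply: eq_measure_integral => A mA _; apply/esym.
  have H := @product_measure_unique _ _ _ _ R (distribution Pr idm) (distribution Pr Z)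
    (distribution Pr gr).
  by apply: H mA => B C mB mC; exact: ind.
rewrite fubini_tonelli1// ge0_integral_distribution//.
  exact: measurable_fun_fubini_tonelli_F.
by move=> y; apply: integral_ge0.
Qed.

Section Sources.
Context {I : choiceType} (F : I -> set (set T)).
Hypotheses (Fm : forall i, F i `<=` measurable) (FT : forall i, F i setT)
  (FI : forall i, setI_closed (F i)) (indF : mutually_independent Pr F).

(* A pi-system generating the sigma-algebra of the sources with index in C. *)
Definition cylinders (C : set I) : set (set T) :=
  [set A | exists J : {fset I}, exists E : I -> set T,
    [/\ [set` J] `<=` C, forall j, F j (E j) & A = \bigcap_(j in [set` J]) E j]].

Lemma cylindersS C D : C `<=` D -> cylinders C `<=` cylinders D.
Proof.
by move=> CD A [J [E [JC FE ->]]]; exists J, E; split => //; exact: subset_trans JC CD.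
Qed.

Lemma cylinders1 (C : set I) i B : C i -> F i B -> cylinders C B.
Proof.
move=> Ci FB; exists [fset i]%fset, (fun j => if j == i then B else setT).
split => [j /=|j|].
- by rewrite inE => /eqP ->.
- by case: eqP => [->|_] //; exact: FT.
- apply/seteqP; split => [w Bw j _|w]; first by case: ifP.
  by move/(_ i); rewrite /= inE eqxx => /(_ isT).
Qed.

Lemma cylinders_measurable C : cylinders C `<=` measurable.
Proof.
move=> _ [J [E [_ FE ->]]]; apply: fin_bigcap_measurable => //.
by move=> j _; exact: Fm.
Qed.

Lemma cylinders_setT C : cylinders C setT.
Proof.
exists fset0, (fun=> setT); split => [j /=|j|]; [by rewrite inE|exact: FT|].
by apply/seteqP; split => // w _ j.
Qed.

Lemma cylinders_setI C : setI_closed (cylinders C).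
Proof.
move=> _ _ [J [E [JC FE ->]]] [K [D [KC FD ->]]].
pose E' j := if j \in J then E j else setT.
pose D' j := if j \in K then D j else setT.
exists (J `|` K)%fset, (fun j => E' j `&` D' j); split => [j /=|j|].
- by rewrite inE => /orP[/JC|/KC].
- by apply: FI; rewrite /E' /D'; case: ifP => // _; exact: FT.
- apply/seteqP; split => [w [Ew Dw] j _|w h].
    by split; rewrite /E' /D'; case: ifP => // jJ; [exact: Ew|exact: Dw].
  split => j /= jJ; have := h j; rewrite /= inE jJ ?orbT => /(_ isT);
  by rewrite /E' /D' jJ => -[].
Qed.

(** As functions of [A], both sides are finite measures: a restriction of [Pr] and a multiple of
    [Pr]. They agree on the pi-system [cylinders F C], hence on the sigma-algebra it generates. *)
Lemma independent_cylinders (C : set I) (J : {fset I}) (E : I -> set T) A :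
  (forall j, j \in J -> ~ C j) -> (forall j, F j (E j)) -> <<s cylinders C >> A ->
  (Pr (A `&` \bigcap_(j in [set` J]) E j) =
   Pr A * Pr (\bigcap_(j in [set` J]) E j))%E.
Proof.
move=> JC FE sA; set B := \bigcap_(j in _) _.
have mB : measurable B by apply: fin_bigcap_measurable => // j _; exact: Fm.
have pB : (0 <= fine (Pr B))%R by rewrite fine_ge0// measure_ge0.
pose k := NngNum pB.
have kE : (fine (Pr B))%:E = Pr B by rewrite fineK// fin_num_measure.
have h : forall X, <<s cylinders C >> X -> mrestr Pr mB X = mscale k Pr X.
  apply: (@g_sigma_algebra_measure_unique _ _ _ (cylinders C) (@cylinders_measurable C) (fun=> setT)).
  - by move=> _; exact: cylinders_setT.
  - by rewrite bigcup_const//; exists 0%N.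
  - exact: cylinders_setI.
  - move=> _ [K [D [KC FD ->]]] /=; rewrite /mrestr /mscale /= kE.
    have := indF (J := J) (E := E) (fun j _ => FE j).
    rewrite -/B => ->.
    rewrite (@indF K D); last by move=> j _; exact: FD.
    rewrite /B.
    (* [K] lies in [C] and [J] avoids it, so the two families of events merge over a disjoint
       union. *)
    pose H j := if j \in K then D j else E j.
    have -> : \bigcap_(j in [set` K]) D j `&` \bigcap_(j in [set` J]) E j =
        \bigcap_(j in [set` (K `|` J)%fset]) H j.
      apply/seteqP; split => [w [Dw Ew] j /=|w h].
        by rewrite inE /H; case: ifP => [jK _|_ /= jJ]; [exact: Dw|exact: Ew].
      split => j /= jJ; have := h j; rewrite /= inE jJ ?orbT => /(_ isT); rewrite /H.
        by rewrite jJ.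
      by case: ifP => // /KC /(JC _ jJ).
    rewrite indF; last by move=> j _; rewrite /H; case: ifP.
    have pe : perm_eq (K `|` J)%fset (K ++ J).
      apply: uniq_perm; rewrite ?fset_uniq//.
        rewrite cat_uniq !fset_uniq andbT /=; apply/hasPn => j jJ.
        by apply/negP => /KC /(JC _ jJ).
      by move=> j; rewrite inE mem_cat.
    rewrite (perm_big _ pe) big_cat /= muleC; congr (_ * _)%E.
      rewrite big_seq [RHS]big_seq; apply: eq_bigr => j jJ; rewrite /H.
      by case: ifP => // /KC /(JC _ jJ).
    by rewrite big_seq [RHS]big_seq; apply: eq_bigr => j jK; rewrite /H jK.
  - move=> _; rewrite /= /mrestr; apply: le_lt_trans (ltry 1).
    by apply: probability_le1; exact: measurableI.
by have := h _ sA; rewrite /mrestr /mscale /= kE => ->; rewrite muleC.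
Qed.

End Sources.
End Independence.

(** * Averages over the sampled blocks *)

Section Average.
Context {R : realType} {m n : nat}.
Hypothesis m0 : (0 < m)%N.
Implicit Types F G : {ffun 'I_n -> 'I_m} -> R.

Definition mean (V : lmodType R) (X : 'I_m -> V) : V := m%:R^-1 *: \sum_j X j.

(** Expectation over independent uniform indices, one per node: [f] ranges over the [m ^ n] possible
    draws. *)
Definition avg F : R := (m%:R ^+ n)^-1 * \sum_f F f.

Let mN0 : m%:R != 0 :> R. Proof. by rewrite pnatr_eq0 -lt0n. Qed.

Lemma avg_le F G : (forall f, F f <= G f) -> avg F <= avg G.
Proof.
move=> FG; rewrite ler_wpM2l ?invr_ge0 ?exprn_ge0//; exact: ler_sum.
Qed.

Lemma avgD F G : avg (fun f => F f + G f) = avg F + avg G.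
Proof. by rewrite /avg big_split mulrDr. Qed.

Lemma avgZ a F : avg (fun f => a * F f) = a * avg F.
Proof. by rewrite /avg -mulr_sumr mulrCA. Qed.

Lemma avg_sum (J : Type) (r : seq J) (P : pred J) (F : J -> {ffun 'I_n -> 'I_m} -> R) :
  avg (fun f => \sum_(i <- r | P i) F i f) = \sum_(i <- r | P i) avg (F i).
Proof. by rewrite /avg exchange_big mulr_sumr. Qed.

Lemma eq_avg F G : F =1 G -> avg F = avg G.
Proof. by move=> FG; rewrite /avg (eq_bigr G). Qed.

(** Independence of the coordinates of a uniform [f], read off from the expansion of a product of
    sums. *)
Lemma avg_prod (h : 'I_n -> 'I_m -> R) :
  avg (fun f => \prod_tau h tau (f tau)) = \prod_tau (m%:R^-1 * \sum_j h tau j).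
Proof. by rewrite big_split prodr_const card_ord exprVn bigA_distr_bigA. Qed.

Lemma mean_cst (c : R) : m%:R^-1 * \sum_(j < m) c = c.
Proof. by rewrite sumr_const card_ord -[c *+ m]mulr_natl mulKf. Qed.

Lemma avg_indep tau sigma (h k : 'I_m -> R) : tau != sigma ->
  avg (fun f => h (f tau) * k (f sigma)) =
  (m%:R^-1 * \sum_j h j) * (m%:R^-1 * \sum_j k j).
Proof.
move=> ts; pose H x j : R := if x == tau then h j else if x == sigma then k j else 1.
have -> : avg (fun f => h (f tau) * k (f sigma)) = avg (fun f => \prod_x H x (f x)).
  apply: eq_avg => f; rewrite (bigD1 tau)//= (bigD1 sigma) 1?eq_sym//=.
  rewrite /H !eqxx eq_sym (negbTE ts) [\prod_(i < n | _) _]big1 ?mulr1// => x /andP[xt xs].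
  by rewrite (negbTE xt) (negbTE xs).
rewrite avg_prod (bigD1 tau)//= (bigD1 sigma) 1?eq_sym//=.
rewrite /H !eqxx eq_sym (negbTE ts) [\prod_(i < n | _) _]big1 ?mulr1// => x /andP[xt xs].
by rewrite (negbTE xt) (negbTE xs) mean_cst.
Qed.

Lemma avg_coord tau (h : 'I_m -> R) : avg (fun f => h (f tau)) = m%:R^-1 * \sum_j h j.
Proof.
pose H x j : R := if x == tau then h j else 1.
have -> : avg (fun f => h (f tau)) = avg (fun f => \prod_x H x (f x)).
  apply: eq_avg => f; rewrite (bigD1 tau)//= /H eqxx [\prod_(i < n | _) _]big1 ?mulr1// => x xt.
  by rewrite (negbTE xt).
rewrite avg_prod (bigD1 tau)//= /H eqxx [\prod_(i < n | _) _]big1 ?mulr1// => x xt.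
by rewrite (negbTE xt) mean_cst.
Qed.

Lemma avg_cst (c : R) : avg (fun=> c) = c.
Proof.
rewrite /avg sumr_const card_ffun !card_ord -[c *+ _]mulr_natl natrX mulKf//.
by rewrite expf_neq0.
Qed.

Section Vectors.
Context {d : nat}.
Implicit Types (X : 'I_n -> 'I_m -> 'cV[R]_d).

Lemma mean_coord (X : 'I_m -> 'cV[R]_d) j k :
  mean X j k = m%:R^-1 * \sum_i X i j k.
Proof. by rewrite mxE summxE. Qed.

Lemma meanDr (X : 'I_m -> 'cV[R]_d) c : mean (fun j => X j + c) = mean X + c.
Proof.
apply/matrixP => i k; rewrite [RHS]mxE !mean_coord.
under eq_bigr do rewrite mxE.
by rewrite big_split mulrDr mean_cst.
Qed.

(* The variance of X is invariant under translation. *)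
Lemma mean_nsqD (X : 'I_m -> 'cV[R]_d) c :
  m%:R^-1 * \sum_j dot (X j + c) (X j + c) =
  dot (mean X + c) (mean X + c) +
  (m%:R^-1 * \sum_j dot (X j) (X j) - dot (mean X) (mean X)).
Proof.
rewrite (eq_bigr (fun j => dot (X j) (X j) + 2 * dot (X j) c + dot c c)); last first.
  by move=> j _; rewrite !dotE (dotC c); ring.
rewrite !big_split /= !mulrDr mean_cst -mulr_sumr.
have -> : m%:R^-1 * (2 * \sum_j dot (X j) c) = 2 * dot (mean X) c.
  by rewrite dotZl dot_suml; ring.
by rewrite !dotE (dotC c); ring.
Qed.

Lemma avg_dot tau sigma X : tau != sigma ->
  avg (fun f => dot (X tau (f tau)) (X sigma (f sigma))) =
  dot (mean (X tau)) (mean (X sigma)).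
Proof.
move=> ts; rewrite avg_sum; apply: eq_bigr => k _.
rewrite (@avg_indep tau sigma (fun j => X tau j k 0) (fun j => X sigma j k 0))//.
by rewrite !mean_coord.
Qed.

(** Cross terms between distinct nodes factor through the means, so only the diagonal contributes a
    variance. The factors [1 / n] due to the sampling come from here. *)
Lemma avg_nsq_sum X :
  avg (fun f => dot (\sum_tau X tau (f tau)) (\sum_tau X tau (f tau))) =
  dot (\sum_tau mean (X tau)) (\sum_tau mean (X tau)) +
  \sum_tau (m%:R^-1 * \sum_j dot (X tau j) (X tau j) - dot (mean (X tau)) (mean (X tau))).
Proof.
have -> : avg (fun f => dot (\sum_tau X tau (f tau)) (\sum_tau X tau (f tau))) =
    \sum_tau \sum_sigma avg (fun f => dot (X tau (f tau)) (X sigma (f sigma))).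
  transitivity (avg (fun f => \sum_tau \sum_sigma dot (X tau (f tau)) (X sigma (f sigma)))).
    by apply: eq_avg => f; rewrite dot_suml; apply: eq_bigr => x _; rewrite dot_sumr.
  by rewrite avg_sum; apply: eq_bigr => x _; rewrite avg_sum.
rewrite dot_suml -big_split; apply: eq_bigr => x _ /=.
rewrite dot_sumr (bigD1 x)//= [in RHS](bigD1 x)//= (avg_coord x (fun j => dot (X x j) (X x j))).
rewrite (eq_bigr (fun s => dot (mean (X x)) (mean (X s)))); last first.
  by move=> s sx; rewrite avg_dot// eq_sym.
ring.
Qed.

End Vectors.
End Average.

(** * Moments of the increments and of the compressor inputs *)

Section Increments.
Context {R : realType} {m n d t : nat} (A : 'I_m -> 'I_n -> 'M[R]_(d, t)) (lam theta : R).
Hypotheses (m0 : (0 < m)%N) (n0 : (0 < n)%N) (lam0 : 0 < lam).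
Variables (r : 'I_m -> 'I_n -> 'cV[R]_t) (e : 'I_n -> 'cV[R]_d).

Let mR : 0 < m%:R :> R. Proof. by rewrite ltr0n. Qed.
Let nR : 0 < n%:R :> R. Proof. by rewrite ltr0n. Qed.
Let NE : (m * n)%:R = m%:R * n%:R :> R. Proof. by rewrite natrM. Qed.

(** What a node adds to its compressor input when block [j] is drawn; the inner factor [m%:R] is the
    inverse probability [p^-1]. *)
Definition incr tau j := (lam * m%:R)^-1 *: (A j tau *m ((theta * m%:R) *: r j tau)).

Local Notation X := (\sum_(tau < n) \sum_(j < m) dot (r j tau) (r j tau)).
Local Notation V := (n%:R^-1 *: \sum_tau mean (incr tau)).
Local Notation ebar := (n%:R^-1 *: \sum_tau e tau).

Lemma incrE tau j : incr tau j = (theta / lam) *: (A j tau *m r j tau).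
Proof.
by rewrite /incr -scalemxAr scalerA; congr (_ *: _); field; rewrite !gt_eqF.
Qed.

Lemma mean_incr tau : mean (incr tau) = (theta / (lam * m%:R)) *: \sum_j A j tau *m r j tau.
Proof.
rewrite /mean; under eq_bigr do rewrite incrE.
by rewrite -scaler_sumr scalerA; congr (_ *: _); field; rewrite !gt_eqF.
Qed.

(** The mean over the drawn index involves all blocks of the node together, hence [Rbar2]. Averaging
    over the nodes as well brings in [R2], while second moments see blocks one by one and cost
    [Rm]. *)
Lemma nsq_mean_incr_le tau : dot (mean (incr tau)) (mean (incr tau)) <=
  theta ^+ 2 * Rbar2 A / (lam ^+ 2 * m%:R) * \sum_j dot (r j tau) (r j tau).
Proof.
rewrite mean_incr dotZl dotZr mulrA -expr2.
apply: le_trans (ler_wpM2l (sqr_ge0 _) (Rbar2_le A m0 tau (r ^~ tau))) _.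
by rewrite le_eqVlt; apply/orP; left; apply/eqP; field; rewrite !gt_eqF.
Qed.

Lemma sum_mean_incr : V = (theta / (lam * (m * n)%:R)) *: \sum_tau \sum_j A j tau *m r j tau.
Proof.
under eq_bigr do rewrite mean_incr.
by rewrite -scaler_sumr scalerA NE; congr (_ *: _); field; rewrite !gt_eqF.
Qed.

Lemma nsq_sum_mean_incr_le : dot V V <= theta ^+ 2 * R2 A / (lam ^+ 2 * (m * n)%:R) * X.
Proof.
rewrite sum_mean_incr dotZl dotZr mulrA -expr2.
apply: le_trans (ler_wpM2l (sqr_ge0 _) (R2_le A m0 n0 r)) _.
by rewrite le_eqVlt NE; apply/orP; left; apply/eqP; field; rewrite !gt_eqF.
Qed.

Lemma mean_nsq_incr_le tau : m%:R^-1 * \sum_j dot (incr tau j) (incr tau j) <=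
  theta ^+ 2 * Rm A ^+ 2 / (lam ^+ 2 * m%:R) * \sum_j dot (r j tau) (r j tau).
Proof.
have -> : theta ^+ 2 * Rm A ^+ 2 / (lam ^+ 2 * m%:R) * \sum_j dot (r j tau) (r j tau) =
    m%:R^-1 * \sum_j ((theta / lam) ^+ 2 * (Rm A ^+ 2 * dot (r j tau) (r j tau))).
  by rewrite -!mulr_sumr; field; rewrite !gt_eqF.
rewrite ler_wpM2l ?invr_ge0 ?(ltW mR)//; apply: ler_sum => j _.
rewrite incrE dotZl dotZr mulrA -expr2 ler_wpM2l ?sqr_ge0//; exact: Rm_le.
Qed.

Lemma avg_nsq_incr_le :
  avg (fun f => dot (n%:R^-1 *: \sum_tau incr tau (f tau)) (n%:R^-1 *: \sum_tau incr tau (f tau)))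
  <= theta ^+ 2 / (lam ^+ 2 * (m * n)%:R) * (R2 A + Rm A ^+ 2 / n%:R) * X.
Proof.
under eq_avg do rewrite dotZl dotZr mulrA.
rewrite avgZ avg_nsq_sum// mulrDr.
have -> : n%:R^-1 * n%:R^-1 * dot (\sum_tau mean (incr tau)) (\sum_tau mean (incr tau)) = dot V V.
  by rewrite dotZl dotZr mulrA.
have h : \sum_tau (m%:R^-1 * (\sum_j dot (incr tau j) (incr tau j)) -
    dot (mean (incr tau)) (mean (incr tau))) <=
    theta ^+ 2 * Rm A ^+ 2 / (lam ^+ 2 * m%:R) * X.
  rewrite mulr_sumr; apply: ler_sum => tau _.
  by have := mean_nsq_incr_le tau; have := dot_ge0 (mean (incr tau)); lra.
have nn0 : 0 <= n%:R^-1 * n%:R^-1 :> R by rewrite mulr_ge0// invr_ge0 ltW.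
have := ler_wpM2l nn0 h; have := nsq_sum_mean_incr_le => h1 h2.
apply: le_trans (lerD h1 h2) _.
by rewrite le_eqVlt NE; apply/orP; left; apply/eqP; field; rewrite !gt_eqF.
Qed.

Section Errors.
Variable delta : R.
Hypotheses (delta0 : 0 < delta) (delta1 : delta < 1).

Let d1 : 0 < 1 - delta. Proof. by rewrite subr_gt0. Qed.

Let z f tau := incr tau (f tau) + e tau.

(** The Young parameter [c] is the one for which [(1 - delta) (1 + c) = 1 - delta / 2]: the
    contraction survives with half its strength. *)
Lemma young_delta (x y : 'cV[R]_d) : (1 - delta) * dot (x + y) (x + y) <=
  (1 - delta / 2) * dot y y + 2 * (1 - delta) / delta * dot x x.
Proof.
have c0 : 0 < delta / (2 * (1 - delta)) by rewrite divr_gt0// mulr_gt0.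
have := nsqD_young y x c0; rewrite addrC => h.
apply: le_trans (ler_wpM2l (ltW d1) h) _; rewrite mulrDr; apply: lerD.
  by rewrite le_eqVlt; apply/orP; left; apply/eqP; field; rewrite gt_eqF.
rewrite mulrA ler_wpM2r ?dot_ge0// -subr_ge0.
have -> : 2 * (1 - delta) / delta - (1 - delta) * (1 + (delta / (2 * (1 - delta)))^-1) = 1 - delta.
  by field; rewrite !gt_eqF.
exact: ltW.
Qed.

(** Only the mean of the increment goes through the inequality on [c1] and [c2]; its variance is
    simply added, with [Rm] and without the large factor [c2]. The two constants stay free because a
    contracting version and a crude one are both used. *)
Lemma avg_nsq_z_le c1 c2 tau : (forall x y : 'cV[R]_d,
    (1 - delta) * dot (x + y) (x + y) <= c1 * dot y y + c2 * dot x x) -> 0 <= c2 ->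
  (1 - delta) * avg (fun f => dot (z f tau) (z f tau)) <= c1 * dot (e tau) (e tau) +
   (c2 * Rbar2 A + (1 - delta) * Rm A ^+ 2) * theta ^+ 2 / (lam ^+ 2 * m%:R) *
   \sum_j dot (r j tau) (r j tau).
Proof.
move=> cc c20; rewrite (avg_coord m0 tau (fun j => dot (incr tau j + e tau) (incr tau j + e tau))).
rewrite mean_nsqD//.
have h1 := cc (mean (incr tau)) (e tau).
have h2 := ler_wpM2l c20 (nsq_mean_incr_le tau).
have h3 := ler_wpM2l (ltW d1) (mean_nsq_incr_le tau).
have h4 := mulr_ge0 (ltW d1) (dot_ge0 (mean (incr tau))).
rewrite -subr_ge0 in h2; rewrite -subr_ge0 in h3.
have -> : (c2 * Rbar2 A + (1 - delta) * Rm A ^+ 2) * theta ^+ 2 / (lam ^+ 2 * m%:R) *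
   (\sum_j dot (r j tau) (r j tau)) =
   c2 * (theta ^+ 2 * Rbar2 A / (lam ^+ 2 * m%:R) * \sum_j dot (r j tau) (r j tau)) +
   (1 - delta) * (theta ^+ 2 * Rm A ^+ 2 / (lam ^+ 2 * m%:R) * \sum_j dot (r j tau) (r j tau)).
  by field; rewrite !gt_eqF.
lra.
Qed.

Lemma avg_local_errors_le :
  (1 - delta) * avg (fun f => \sum_tau dot (z f tau) (z f tau)) <=
  (1 - delta / 2) * \sum_tau dot (e tau) (e tau) +
  (1 - delta) * (2 * Rbar2 A / delta + Rm A ^+ 2) * theta ^+ 2 / (lam ^+ 2 * m%:R) * X.
Proof.
rewrite avg_sum !mulr_sumr -big_split; apply: ler_sum => tau _ /=.
apply: le_trans (avg_nsq_z_le tau young_delta _) _.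
  by rewrite divr_ge0 ?mulr_ge0// ltW.
by rewrite lerD2l le_eqVlt; apply/orP; left; apply/eqP; field; rewrite !gt_eqF.
Qed.

(** The left-hand side bounds the mean square of the averaged error once the seeds are integrated
    out. Its second term already carries [delta / n ^ 2], so Young with parameter 1 is enough there,
    and avoids a factor [1 / delta] on [Rbar2]. *)
Lemma avg_global_error_le :
  (1 - delta) ^+ 2 * avg (fun f => dot (n%:R^-1 *: \sum_tau z f tau) (n%:R^-1 *: \sum_tau z f tau))
  + delta * (1 - delta) / n%:R ^+ 2 * avg (fun f => \sum_tau dot (z f tau) (z f tau)) <=
  (1 - delta / 2) * dot ebar ebar +
  2 * delta * (1 - delta) / n%:R ^+ 2 * \sum_tau dot (e tau) (e tau) +
  (1 - delta) * (2 * R2 A / delta + (1 - delta) * Rm A ^+ 2 / n%:R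
    + delta * (2 * Rbar2 A + Rm A ^+ 2) / n%:R)
   * theta ^+ 2 / (lam ^+ 2 * (m * n)%:R) * X.
Proof.
have dn0 : 0 <= delta / n%:R ^+ 2 by rewrite divr_ge0 ?sqr_ge0// ltW.
have loc : delta * (1 - delta) / n%:R ^+ 2 * avg (fun f => \sum_tau dot (z f tau) (z f tau)) <=
   2 * delta * (1 - delta) / n%:R ^+ 2 * \sum_tau dot (e tau) (e tau) +
   delta * (1 - delta) * (2 * Rbar2 A + Rm A ^+ 2) / n%:R * theta ^+ 2 / (lam ^+ 2 * (m * n)%:R) * X.
  have -> : delta * (1 - delta) / n%:R ^+ 2 * avg (fun f => \sum_tau dot (z f tau) (z f tau)) =
    delta / n%:R ^+ 2 * ((1 - delta) * avg (fun f => \sum_tau dot (z f tau) (z f tau))) by ring.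
  have yy x y : (1 - delta) * dot (x + y) (x + y) <=
      (2 * (1 - delta)) * dot y y + (2 * (1 - delta)) * dot x x :> R.
    move=> *; have := @nsqD_young _ _ 1 x y ltr01; rewrite invr1 => h.
    by have := ler_wpM2l (ltW d1) h; lra.
  have c20 : 0 <= 2 * (1 - delta) by rewrite mulr_ge0// ltW.
  have h : (1 - delta) * avg (fun f => \sum_tau dot (z f tau) (z f tau)) <=
    2 * (1 - delta) * \sum_tau dot (e tau) (e tau) +
    (2 * (1 - delta) * Rbar2 A + (1 - delta) * Rm A ^+ 2) * theta ^+ 2 / (lam ^+ 2 * m%:R) * X.
    rewrite avg_sum !mulr_sumr -big_split; apply: ler_sum => tau _.
    exact: avg_nsq_z_le.
  apply: le_trans (ler_wpM2l dn0 h) _.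
  by rewrite le_eqVlt NE; apply/orP; left; apply/eqP; field; rewrite !gt_eqF.
have glob : (1 - delta) ^+ 2 *
    avg (fun f => dot (n%:R^-1 *: \sum_tau z f tau) (n%:R^-1 *: \sum_tau z f tau)) <=
    (1 - delta / 2) * dot ebar ebar +
    (1 - delta) * (2 * R2 A / delta + (1 - delta) * Rm A ^+ 2 / n%:R)
   * theta ^+ 2 / (lam ^+ 2 * (m * n)%:R) * X.
  have -> : avg (fun f => dot (n%:R^-1 *: \sum_tau z f tau) (n%:R^-1 *: \sum_tau z f tau)) =
      dot (V + ebar) (V + ebar) + n%:R^-1 ^+ 2 * \sum_tau (m%:R^-1 *
        \sum_j dot (incr tau j) (incr tau j) - dot (mean (incr tau)) (mean (incr tau))).
    under eq_avg do rewrite dotZl dotZr mulrA -expr2.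
    rewrite avgZ (avg_nsq_sum m0 (fun tau j => incr tau j + e tau)) mulrDr; congr (_ + _).
      under eq_bigr do rewrite meanDr//.
      by rewrite big_split -scalerDr dotZl dotZr mulrA -expr2.
    congr (_ * _); apply: eq_bigr => tau _.
    by rewrite mean_nsqD// meanDr//; ring.
  have hv : \sum_tau (m%:R^-1 * (\sum_j dot (incr tau j) (incr tau j)) -
      dot (mean (incr tau)) (mean (incr tau))) <=
      theta ^+ 2 * Rm A ^+ 2 / (lam ^+ 2 * m%:R) * X.
    rewrite mulr_sumr; apply: ler_sum => tau _.
    by have := mean_nsq_incr_le tau; have := dot_ge0 (mean (incr tau)); lra.
  have k0 : 0 <= (1 - delta) ^+ 2 * n%:R^-1 ^+ 2 by rewrite mulr_ge0 ?sqr_ge0.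
  have h1 := ler_wpM2l k0 hv.
  have dd1 : 1 - delta <= 1 by rewrite lerBlDr lerDl ltW.
  have hy := young_delta V ebar.
  have hd0 : 0 <= (1 - delta / 2) * dot ebar ebar + 2 * (1 - delta) / delta * dot V V.
    by apply: le_trans hy; rewrite mulr_ge0 ?dot_ge0// ltW.
  (* One factor [1 - delta] is spent on [young_delta], the other is bounded by 1. *)
  have h2 : (1 - delta) ^+ 2 * dot (V + ebar) (V + ebar) <=
      (1 - delta / 2) * dot ebar ebar + 2 * (1 - delta) / delta * dot V V.
    rewrite expr2 -mulrA; apply: le_trans (ler_wpM2l (ltW d1) hy) _.
    by rewrite ler_piMl.
  have c0 : 0 <= 2 * (1 - delta) / delta by rewrite divr_ge0 ?mulr_ge0// ltW.
  have h3 := ler_wpM2l c0 nsq_sum_mean_incr_le.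
  rewrite mulrDr mulrA; apply: le_trans (lerD (le_trans h2 (lerD (lexx _) h3)) h1) _.
  by rewrite -addrA lerD2l le_eqVlt NE; apply/orP; left; apply/eqP; field; rewrite !gt_eqF.
apply: le_trans (lerD glob loc) _.
by rewrite le_eqVlt; apply/orP; left; apply/eqP; ring.
Qed.

End Errors.
End Increments.

(** * One step of dual ascent *)

Section Coefficients.
Context {R : realType}.
Variables (M n lam gam delta theta rho Rt Q R2 Rm2 Rb2 a2 : R).
Hypotheses (M0 : 0 < M) (n0 : 0 < n) (lam0 : 0 < lam) (gam0 : 0 < gam)
  (delta0 : 0 < delta) (delta1 : delta < 1) (theta0 : 0 < theta)
  (Rt0 : 0 < Rt) (Q0 : 0 < Q) (R2E : R2 = Rt ^+ 2) (Rm20 : 0 <= Rm2) (Rb20 : 0 <= Rb2)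
  (a2E : a2 = (1 - delta) * (2 * R2 + 16 * Rb2 / n + 9 * delta * Rm2 / n))
  (QE : Q ^+ 2 = a2) (rhoE : rho = delta * lam * Rt / (2 * Q)).
Hypotheses
  (h1 : 12 * a2 * theta ^+ 2 <= lam * gam * delta ^+ 2 * (1 - theta * M))
  (h2 : 3 * (Rm2 + n * R2) * theta <= n * lam * gam * (1 - theta * M))
  (h3 : 12 * Rt * Q * theta <= delta * lam * gam * (1 - theta * M)).

(** By [S], the last two terms together cost at most [2 K a2 / (delta lam)^2] times
    [theta ^ 2 / (M n)]. With [K = rho + theta lam], the part in [theta lam] is absorbed by [h1];
    the part in [rho] equals the first term by the choice of [rho], and both are absorbed by [h3];
    the second term is absorbed by [h2]. Each hypothesis provides one third of
    [gam (1 - theta M)]. *)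
Lemma stepsize_coef_le (K := rho + theta * lam) :
  theta ^+ 2 * R2 / (2 * rho * (M * n)) + theta ^+ 2 * (R2 + Rm2 / n) / (2 * lam * (M * n))
  + 2 * K / delta * ((1 - delta) * (2 * R2 / delta + (1 - delta) * Rm2 / n
      + delta * (2 * Rb2 + Rm2) / n) * theta ^+ 2 / (lam ^+ 2 * (M * n)))
  + 16 * (1 - delta) * K / (delta * n ^+ 2) *
    ((1 - delta) * (2 * Rb2 / delta + Rm2) * theta ^+ 2 / (lam ^+ 2 * M))
  <= theta * gam * (1 - theta * M) / (2 * (M * n)).
Proof.
move: h1 h2 h3 => g1 g2 g3.
have rho0 : 0 < rho by rewrite rhoE divr_gt0 ?mulr_gt0.
have K0 : 0 < K by rewrite addr_gt0// mulr_gt0.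
have d1 : 0 < 1 - delta by rewrite subr_gt0.
have S : (2 * R2 / delta + (1 - delta) * Rm2 / n + delta * (2 * Rb2 + Rm2) / n)
    + 8 * (1 - delta) / n * (2 * Rb2 / delta + Rm2) <=
    (2 * R2 + 16 * Rb2 / n + 9 * delta * Rm2 / n) / delta.
  rewrite -subr_ge0.
  have -> : (2 * R2 + 16 * Rb2 / n + 9 * delta * Rm2 / n) / delta -
    (2 * R2 / delta + (1 - delta) * Rm2 / n + delta * (2 * Rb2 + Rm2) / n +
     8 * (1 - delta) / n * (2 * Rb2 / delta + Rm2)) =
    (16 * Rb2 - 2 * delta * Rb2 + 8 * delta * Rm2) / n by field; rewrite !gt_eqF.
  have p1 : 0 <= (1 - delta) * Rb2 by rewrite mulr_ge0// ltW.
  have p2 : 0 <= delta * Rm2 by rewrite mulr_ge0// ltW.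
  have p3 : 0 <= 16 * Rb2 - 2 * delta * Rb2 + 8 * delta * Rm2.
    have -> : 16 * Rb2 - 2 * delta * Rb2 + 8 * delta * Rm2 =
      14 * Rb2 + 2 * ((1 - delta) * Rb2) + 8 * (delta * Rm2) by ring.
    by rewrite !addr_ge0// mulr_ge0.
  by rewrite divr_ge0// ltW.
have k0 : 0 <= 2 * K / delta * (1 - delta) * theta ^+ 2 / (lam ^+ 2 * (M * n)).
  by rewrite ltW// divr_gt0 ?mulr_gt0 ?invr_gt0 ?exprn_gt0.
have e1 := ler_wpM2l k0 S.
have mn0 : 0 < theta / (2 * (M * n)) by rewrite divr_gt0 ?mulr_gt0.
have f1 : 4 * theta ^+ 2 * a2 / (lam * delta ^+ 2) <= gam * (1 - theta * M) / 3.
  by rewrite ler_pdivrMr ?mulr_gt0 ?exprn_gt0//; lra.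
have f2 : theta * (Rm2 + n * R2) / (n * lam) <= gam * (1 - theta * M) / 3.
  by rewrite ler_pdivrMr ?mulr_gt0//; lra.
have f3 : theta * (4 * Rt * Q) / (delta * lam) <= gam * (1 - theta * M) / 3.
  by rewrite ler_pdivrMr ?mulr_gt0//; lra.
have e2 := ler_wpM2l (ltW mn0) (lerD (lerD f1 f2) f3).
have -> : theta * gam * (1 - theta * M) / (2 * (M * n)) = theta / (2 * (M * n)) *
   (gam * (1 - theta * M) / 3 + gam * (1 - theta * M) / 3 + gam * (1 - theta * M) / 3).
  by field; rewrite !gt_eqF.
apply: le_trans e2.
(* Subtracts and adds back the bound in [a2]: what the subtraction leaves is exactly the sum of the
   first two terms. *)
rewrite -[X in _ <= X](subrK (2 * K / delta * (1 - delta) * theta ^+ 2 / (lam ^+ 2 * (M * n)) *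
  ((2 * R2 + 16 * Rb2 / n + 9 * delta * Rm2 / n) / delta))).
have -> : theta / (2 * (M * n)) *
    (4 * theta ^+ 2 * a2 / (lam * delta ^+ 2) + theta * (Rm2 + n * R2) / (n * lam) +
     theta * (4 * Rt * Q) / (delta * lam)) -
  2 * K / delta * (1 - delta) * theta ^+ 2 / (lam ^+ 2 * (M * n)) *
    ((2 * R2 + 16 * Rb2 / n + 9 * delta * Rm2 / n) / delta) =
  theta ^+ 2 * R2 / (2 * rho * (M * n)) + theta ^+ 2 * (R2 + Rm2 / n) / (2 * lam * (M * n)).
  have -> : 2 * K / delta * (1 - delta) * theta ^+ 2 / (lam ^+ 2 * (M * n)) *
    ((2 * R2 + 16 * Rb2 / n + 9 * delta * Rm2 / n) / delta) =
    2 * K / delta * theta ^+ 2 / (lam ^+ 2 * (M * n)) * (a2 / delta).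
    by rewrite a2E; field; rewrite !gt_eqF.
  by rewrite /K rhoE -QE R2E; field; rewrite !gt_eqF.
rewrite -[leLHS]addrA lerD2l; apply: le_trans e1.
by rewrite le_eqVlt; apply/orP; left; apply/eqP; field; rewrite !gt_eqF.
Qed.

End Coefficients.

(** Linear bookkeeping with every nonlinear quantity made a variable: [E] and [S] stand for the
    squares of the mean and of the local errors, [X] for the squared residual. Half of the margin
    [dl / 2] absorbs [k * E] and the leak [c * S]; the other half, with the margin [th - eta] on the
    dual gap, yields the rate. *)
Lemma lyapunov_arith (R : realType) (D Ds Dn P Ps th eta dl E S X B1 B2 k c C2 C3 t1 t2 t4 GZ LZ : R) :
  D + th * (P - D) - k * E - X * (t1 + t2 - t4) <= Dn ->
  B1 * GZ <= B1 * ((1 - dl / 2) * E + c * S + C2 * X) ->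
  B2 * LZ <= B2 * ((1 - dl / 2) * S + C3 * X) ->
  X * (t1 + t2 + B1 * C2 + B2 * C3) <= X * t4 ->
  k = B1 * (dl / 4) -> B1 * c = B2 * (dl / 4) ->
  0 <= B1 * E -> 0 <= B2 * S -> eta <= dl / 4 -> eta <= th -> D <= Ds -> Ds <= Ps -> 0 <= th ->
  Ds - Dn + th * (P - Ps) + B1 * GZ + B2 * LZ <= (1 - eta) * (Ds - D + B1 * E + B2 * S).
Proof.
move=> hD hg hl hc q1 q2 BE BS etad etat DD DP th0.
have w1 : 0 <= (dl / 4 - eta) * (B1 * E) by rewrite mulr_ge0 ?subr_ge0.
have w2 : 0 <= (dl / 4 - eta) * (B2 * S) by rewrite mulr_ge0 ?subr_ge0.
have w3 : 0 <= (th - eta) * (Ds - D) by rewrite mulr_ge0 ?subr_ge0.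
have w4 : 0 <= th * (Ps - Ds) by rewrite mulr_ge0 ?subr_ge0.
have q2S : B1 * c * S = B2 * (dl / 4) * S by rewrite q2.
rewrite q1 in hD; lra.
Qed.

Section DualAscent.
Context {R : realType} {m n d t : nat} (A : 'I_m -> 'I_n -> 'M[R]_(d, t))
  (phi : 'I_m -> 'I_n -> 'cV[R]_t -> R) (g : 'cV[R]_d -> \bar R) (lam gam : R).
Hypotheses (m0 : (0 < m)%N) (n0 : (0 < n)%N) (gam0 : 0 < gam) (lam0 : 0 < lam)
  (phic : forall i tau, convex_function [set: convex_lmodType 'cV[R]_t] (phi i tau))
  (phis : forall i tau, smooth gam^-1 (phi i tau))
  (gp : proper_closed_convex g) (gs : strongly_convex 1 g).

Local Notation h := (fine \o conjugate g).
Local Notation N := ((m * n)%:R : R).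

Let mR : 0 < m%:R :> R. Proof. by rewrite ltr0n. Qed.
Let nR : 0 < n%:R :> R. Proof. by rewrite ltr0n. Qed.
Let NE : N = m%:R * n%:R. Proof. by rewrite natrM. Qed.
Let N0 : 0 < N. Proof. by rewrite NE mulr_gt0. Qed.

Definition finite_dual (alpha : 'I_m -> 'I_n -> 'cV[R]_t) :=
  forall i tau, conjugate (EFin \o phi i tau) (- alpha i tau) \is a fin_num.

Definition conjR (alpha : 'I_m -> 'I_n -> 'cV[R]_t) i tau : R :=
  fine (conjugate (EFin \o phi i tau) (- alpha i tau)).

Definition dualR alpha : R :=
  - (lam * h (dual_point A lam alpha)) - N^-1 * \sum_tau \sum_i conjR alpha i tau.

(** Here [g (grad h u)] is written as [dot (grad h u) u - h u], the equality case of
    Fenchel-Young. *)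
Definition primalR u : R :=
  N^-1 * \sum_tau \sum_i phi i tau ((A i tau)^T *m grad h u) +
  lam * (dot (grad h u) u - h u).

Lemma dual_finite alpha : finite_dual alpha -> dual A phi g lam alpha = (dualR alpha)%:E.
Proof.
move=> fa; rewrite /dual (conjugate_fin gp gs).
rewrite (eq_bigr (fun tau => (\sum_i conjR alpha i tau)%:E)); last first.
  by move=> tau _; rewrite -sumEFin; apply: eq_bigr => i _; rewrite /conjR fineK.
by rewrite sumEFin -!EFinM -EFinN -EFinB.
Qed.

(** Conjugates of the finite functions [phi] never take the value [-oo], so a single infinite term
    makes the whole sum [+oo]. *)
Lemma dual_infinite alpha : ~ finite_dual alpha -> dual A phi g lam alpha = -oo%E.
Proof.
move=> nf; have [i [tau fit]] : exists i tau,
    conjugate (EFin \o phi i tau) (- alpha i tau) = +oo%E.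
  apply: contrapT => H; apply: nf => i tau.
  rewrite fin_numE (conjugate_gt_ninfty _ _) /=; apply/eqP => e.
  by apply: H; exists i, tau.
rewrite /dual (conjugate_fin gp gs).
have -> : (\sum_(tau < n) \sum_(i < m) conjugate (EFin \o phi i tau) (- alpha i tau)%R)%E = +oo%E.
  have Ny sigma : (\sum_(i < m) conjugate (EFin \o phi i sigma) (- alpha i sigma)%R != -oo)%E.
    by rewrite esum_eqNy; apply/exists_inPn => j _; exact: conjugate_gt_ninfty.
  apply/eqP; rewrite esum_eqy; last by move=> sigma _; exact: Ny.
  apply/exists_inP; exists tau => //; rewrite esum_eqy.
    by apply/exists_inP; exists i => //; rewrite fit.
  by move=> j _; exact: conjugate_gt_ninfty.
by rewrite gt0_muley ?lte_fin ?invr_gt0// -EFinM -EFinN.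
Qed.

Lemma primal_grad_conjugate u : primal A phi g lam (grad h u) = (primalR u)%:E.
Proof. by rewrite /primal (g_grad_conjugate gp gs) -EFinM -EFinD. Qed.

(** Fenchel-Young for [g] at the dual point and for each block; the inner products cancel by
    adjunction. *)
Lemma weak_duality alpha x : finite_dual alpha ->
  ((dualR alpha)%:E <= primal A phi g lam x)%E.
Proof.
move=> fa; have := fenchel_young gp gs x (dual_point A lam alpha).
rewrite /primal; move: (proper_gt_ninfty gp x); case gx : (g x) => [r| |] //= _; last first.
  by move=> _; rewrite gt0_muley ?lte_fin// addey// leey.
rewrite lee_fin -EFinM -EFinD lee_fin => /(ler_wpM2l (ltW lam0)) h1.
rewrite /dualR.
have : - (N^-1 * \sum_tau \sum_i conjR alpha i tau) <=
    N^-1 * \sum_tau \sum_i phi i tau ((A i tau)^T *m x) + lam * dot x (dual_point A lam alpha).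
  have -> : lam * dot x (dual_point A lam alpha) =
      N^-1 * \sum_tau \sum_i dot ((A i tau)^T *m x) (alpha i tau).
    rewrite /dual_point dotZr dot_sumr invfM mulrA mulVKf ?gt_eqF//.
    congr (_ * _); apply: eq_bigr => tau _; rewrite dot_sumr; apply: eq_bigr => i _.
    by rewrite dotC dot_mulmx dotC.
  rewrite -mulrN -mulrDr ler_pM2l ?invr_gt0// -sumrN -big_split; apply: ler_sum => tau _ /=.
  rewrite -sumrN -big_split; apply: ler_sum => i _ /=.
  have := conjugate_ge (EFin \o phi i tau) ((A i tau)^T *m x) (- alpha i tau).
  rewrite -[X in (_ <= X)%E]fineK// -/(conjR alpha i tau) /= -EFinB lee_fin dotNr; lra.
rewrite /= in h1 *; lra.
Qed.

Section Step.
Variables (theta : R) (alpha : 'I_m -> 'I_n -> 'cV[R]_t) (u : 'cV[R]_d) (e : 'I_n -> 'cV[R]_d).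
Hypotheses (theta0 : 0 < theta) (theta1 : theta * m%:R <= 1) (fa : finite_dual alpha).
Local Notation ebar := (n%:R^-1 *: \sum_tau e tau).
Hypothesis uE : dual_point A lam alpha = u + ebar.

Let x := grad h u.
Let b i tau := - grad (phi i tau) ((A i tau)^T *m x).
Definition residual i tau := b i tau - alpha i tau.
Let s := theta * m%:R.
Let s0 : 0 <= s. Proof. by rewrite mulr_ge0// ltW. Qed.
Local Notation r := residual.
Local Notation X := (\sum_(tau < n) \sum_(j < m) dot (r j tau) (r j tau)).
Local Notation v := (incr A lam theta r).
Local Notation V := (n%:R^-1 *: \sum_tau mean (v tau)).

Definition alpha_next (f : 'I_n -> 'I_m) j tau :=
  if j == f tau then alpha j tau + s *: r j tau else alpha j tau.

Lemma dual_point_next f : dual_point A lam (alpha_next f) =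
  dual_point A lam alpha + n%:R^-1 *: \sum_tau v tau (f tau).
Proof.
rewrite /dual_point.
have -> : \sum_(tau < n) \sum_(i < m) A i tau *m alpha_next f i tau =
    \sum_(tau < n) \sum_(i < m) A i tau *m alpha i tau +
    \sum_tau A (f tau) tau *m (s *: r (f tau) tau).
  rewrite -big_split; apply: eq_bigr => tau _ /=.
  rewrite (bigD1 (f tau))//= [in RHS](bigD1 (f tau))//= /alpha_next eqxx mulmxDr.
  rewrite addrAC; congr (_ + _ + _); apply: eq_bigr => j jf.
  by rewrite (negbTE jf).
rewrite scalerDr; congr (_ + _); rewrite /incr -scaler_sumr scalerA.
by congr (_ *: _); rewrite NE; field; rewrite !gt_eqF.
Qed.

Let cb i tau := - dot ((A i tau)^T *m x) (b i tau) - phi i tau ((A i tau)^T *m x).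

Let conj_b i tau : conjugate (EFin \o phi i tau) (- b i tau) = (cb i tau)%:E.
Proof. by rewrite opprK (conjugate_grad gam0 (phis i tau))// /cb /b dotNr opprK. Qed.

(** Strong convexity bound for the conjugate at parameter [s] of the segment from [- alpha i tau] to
    the gradient [- b i tau]. *)
Let kappa i tau := conjR alpha i tau + s * (cb i tau - conjR alpha i tau)
   - gam / 2 * s * (1 - s) * dot (r i tau) (r i tau).

Lemma conj_next f i tau :
  (conjugate (EFin \o phi i tau) (- alpha_next f i tau) <=
   (if i == f tau then kappa i tau else conjR alpha i tau)%:E)%E.
Proof.
rewrite /alpha_next; case: ifP => _; last by rewrite /conjR fineK.
have s01 : 0 <= s <= 1 by rewrite s0.
have ca : conjugate (EFin \o phi i tau) (- alpha i tau) = (conjR alpha i tau)%:E.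
  by rewrite /conjR fineK.
have := conjugate_smooth_strongly_convex gam0 (phis i tau) s01 ca (conj_b i tau).
have -> : - alpha i tau + s *: (- b i tau - - alpha i tau) = - (alpha i tau + s *: r i tau).
  by rewrite /r -opprD scalerN -opprD.
have -> : dot (- b i tau - - alpha i tau) (- b i tau - - alpha i tau) = dot (r i tau) (r i tau).
  by rewrite -opprD dotNl dotNr opprK.
by rewrite (_ : _ - gam / 2 * s * _ * _ = kappa i tau)// /kappa; ring.
Qed.

(** A moved block stays on a segment whose two ends, the old point and a gradient of [phi], have
    finite conjugate. *)
Lemma finite_next f : finite_dual (alpha_next f).
Proof.
move=> i tau; rewrite fin_numE conjugate_gt_ninfty /=.
by rewrite -ltey; apply: le_lt_trans (conj_next f i tau) (ltry _).
Qed.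

Lemma avg_dot_const (a : 'cV[R]_d) :
  avg (fun f => dot a (n%:R^-1 *: \sum_tau v tau (f tau))) = dot a V.
Proof.
under eq_avg do rewrite dotZr dot_sumr.
rewrite avgZ avg_sum dotZr dot_sumr; congr (_ * _); apply: eq_bigr => tau _.
by rewrite (avg_coord m0 tau (fun j => dot a (v tau j))) dotZr dot_sumr.
Qed.

Lemma dual_next_ge f :
  dualR alpha - lam * dot (grad h (dual_point A lam alpha)) (n%:R^-1 *: \sum_tau v tau (f tau))
  - lam / 2 * dot (n%:R^-1 *: \sum_tau v tau (f tau)) (n%:R^-1 *: \sum_tau v tau (f tau))
  - N^-1 * \sum_tau (kappa (f tau) tau - conjR alpha (f tau) tau) <= dualR (alpha_next f).
Proof.
rewrite /dualR dual_point_next; set w := dual_point A lam alpha; set Vf := n%:R^-1 *: _.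
have [_] := andP (conjugate_smooth gp gs w (w + Vf)).
rewrite [w + Vf - w]addrAC subrr add0r => /(ler_wpM2l (ltW lam0)) h1.
have h2 : N^-1 * \sum_tau \sum_i conjR (alpha_next f) i tau <=
   N^-1 * (\sum_tau \sum_i conjR alpha i tau +
     \sum_tau (kappa (f tau) tau - conjR alpha (f tau) tau)).
  rewrite ler_pM2l ?invr_gt0// -big_split; apply: ler_sum => tau _ /=.
  rewrite (bigD1 (f tau))//= [in leRHS](bigD1 (f tau))//= addrAC.
  have key i : conjR (alpha_next f) i tau <=
      if i == f tau then kappa i tau else conjR alpha i tau.
    by rewrite -lee_fin /conjR fineK; [exact: conj_next|exact: finite_next].
  apply: lerD; first by have := key (f tau); rewrite eqxx; lra.
  by apply: ler_sum => i ift; have := key i; rewrite (negbTE ift).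
rewrite /= in h1 *; lra.
Qed.

(** The blocks move according to the gradient at [u], whereas the conjugate of [g] is expanded at
    the dual point [w = u + ebar]. Replacing [grad h w] by [x = grad h u] costs the two terms with
    [rho]; passing from [h w] to [h u] costs [theta * lam / 2] times |ebar|^2. The remaining linear
    terms form [theta] times the duality gap, because [cb] is the equality case of Fenchel-Young at
    [x]. *)
Lemma avg_dual_ge (rho : R) : 0 < rho ->
  dualR alpha + theta * (primalR u - dualR alpha)
  - (theta * lam + rho) / 2 * dot ebar ebar
  - X * (theta ^+ 2 * R2 A / (2 * rho * N) +
         theta ^+ 2 * (R2 A + Rm A ^+ 2 / n%:R) / (2 * lam * N)
         - theta * gam * (1 - theta * m%:R) / (2 * N)) <=
  avg (fun f => dualR (alpha_next f)).
Proof.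
move=> rho0; set w := dual_point A lam alpha.
apply: le_trans (avg_le dual_next_ge).
rewrite -/w.
have -> : avg (fun f : {ffun 'I_n -> 'I_m} => dualR alpha -
    lam * dot (grad h w) (n%:R^-1 *: \sum_tau v tau (f tau))
  - lam / 2 * dot (n%:R^-1 *: \sum_tau v tau (f tau)) (n%:R^-1 *: \sum_tau v tau (f tau))
  - N^-1 * \sum_tau (kappa (f tau) tau - conjR alpha (f tau) tau)) =
  dualR alpha - lam * dot (grad h w) V
  - lam / 2 * avg (fun f => dot (n%:R^-1 *: \sum_tau v tau (f tau)) (n%:R^-1 *: \sum_tau v tau (f tau)))
  - N^-1 * \sum_tau (m%:R^-1 * \sum_j (kappa j tau - conjR alpha j tau)).
  move: (dualR alpha) => D0; under eq_avg do rewrite -!mulNr.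
  rewrite !avgD !avgZ avg_cst// avg_dot_const avg_sum !mulNr.
  by congr (_ - _ * _); apply: eq_bigr => tau _;
    rewrite (avg_coord m0 tau (fun j => kappa j tau - conjR alpha j tau)).
have kE : N^-1 * \sum_tau (m%:R^-1 * \sum_j (kappa j tau - conjR alpha j tau)) =
    theta * (N^-1 * \sum_tau \sum_j cb j tau) - theta * (N^-1 * \sum_tau \sum_j conjR alpha j tau)
    - theta * gam * (1 - theta * m%:R) / (2 * N) * X.
  have -> : \sum_tau (m%:R^-1 * \sum_j (kappa j tau - conjR alpha j tau)) =
     theta * \sum_tau \sum_j cb j tau - theta * \sum_tau \sum_j conjR alpha j tau
     - theta * gam * (1 - theta * m%:R) / 2 * X.
    rewrite !mulr_sumr -!sumrN -!big_split; apply: eq_bigr => tau _ /=.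
    rewrite !mulr_sumr -!sumrN -!big_split; apply: eq_bigr => j _ /=.
    by rewrite /kappa /s; field; rewrite gt_eqF.
  by field; rewrite !gt_eqF.
rewrite kE.
have avgle := avg_nsq_incr_le A theta m0 n0 lam0 r.
have VV := nsq_sum_mean_incr_le A theta m0 n0 lam0 r.
have xV : lam * dot x V = theta * (N^-1 * (\sum_tau \sum_j dot ((A j tau)^T *m x) (b j tau)
    - \sum_tau \sum_j dot ((A j tau)^T *m x) (alpha j tau))).
  rewrite sum_mean_incr// dotZr.
  have -> : dot x (\sum_tau \sum_j A j tau *m r j tau) =
      \sum_tau \sum_j dot ((A j tau)^T *m x) (b j tau)
    - \sum_tau \sum_j dot ((A j tau)^T *m x) (alpha j tau).
    rewrite dot_sumr -sumrN -big_split; apply: eq_bigr => tau _ /=.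
    rewrite dot_sumr -sumrN -big_split; apply: eq_bigr => j _ /=.
    by rewrite dotC dot_mulmx dotC /r dotDr dotNr.
  by field; rewrite !gt_eqF.
have xw : lam * dot x w = N^-1 * \sum_tau \sum_j dot ((A j tau)^T *m x) (alpha j tau).
  rewrite /w /dual_point dotZr dot_sumr invfM mulrA mulVKf ?gt_eqF//.
  congr (_ * _); apply: eq_bigr => tau _; rewrite dot_sumr; apply: eq_bigr => i _.
  by rewrite dotC dot_mulmx dotC.
have cbE : N^-1 * \sum_tau \sum_j cb j tau =
    - (N^-1 * \sum_tau \sum_j dot ((A j tau)^T *m x) (b j tau)) -
    N^-1 * \sum_tau \sum_j phi j tau ((A j tau)^T *m x).
  rewrite -!mulrN -mulrDr; congr (_ * _); rewrite -!sumrN -big_split.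
  apply: eq_bigr => tau _ /=; rewrite -!sumrN -big_split; apply: eq_bigr => j _ /=.
  by rewrite /cb.
have [_ sm] := andP (conjugate_smooth gp gs u w).
have wu : w - u = ebar by rewrite /w uE addrAC subrr add0r.
rewrite wu -/x in sm.
have xe : dot x ebar = dot x w - dot x u by rewrite -wu dotDr dotNr.
have lip := grad_conjugate_lipschitz gp gs w u.
rewrite wu -/x in lip.
(* The parameter [rho / lam] becomes [rho / 2] in front of |ebar|^2 after multiplication by
   [lam]. *)
have yg := dot_young (grad h w - x) V (divr_gt0 rho0 lam0).
have gw : dot (grad h w) V = dot x V + dot (grad h w - x) V by rewrite !dotDl dotNl; ring.
have yg2 : lam * dot (grad h w - x) V <= rho / 2 * dot ebar ebar +
    theta ^+ 2 * R2 A / (2 * rho * N) * X.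
  apply: le_trans (ler_wpM2l (ltW lam0) yg) _; rewrite mulrDr; apply: lerD.
    apply: (@le_trans _ _ (rho / 2 * dot (grad h w - x) (grad h w - x))).
      by rewrite le_eqVlt; apply/orP; left; apply/eqP; field; rewrite !gt_eqF.
    by rewrite ler_wpM2l// divr_ge0// ltW.
  have c0 : 0 <= lam ^+ 2 / (2 * rho) by rewrite divr_ge0 ?sqr_ge0// mulr_ge0// ltW.
  apply: (@le_trans _ _ (lam ^+ 2 / (2 * rho) * dot V V)).
    by rewrite le_eqVlt; apply/orP; left; apply/eqP; field; rewrite !gt_eqF.
  apply: le_trans (ler_wpM2l c0 VV) _.
  by rewrite le_eqVlt; apply/orP; left; apply/eqP; field; rewrite !gt_eqF.
have l20 : 0 <= lam / 2 by rewrite divr_ge0// ltW.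
have avg2 : lam / 2 * avg (fun f => dot (n%:R^-1 *: \sum_tau v tau (f tau)) (n%:R^-1 *: \sum_tau v tau (f tau)))
   <= theta ^+ 2 * (R2 A + Rm A ^+ 2 / n%:R) / (2 * lam * N) * X.
  apply: le_trans (ler_wpM2l l20 avgle) _.
  by rewrite le_eqVlt; apply/orP; left; apply/eqP; field; rewrite !gt_eqF.
have DE : N^-1 * \sum_tau \sum_j conjR alpha j tau = - dualR alpha - lam * h w.
  by rewrite /dualR -/w; ring.
have PE : N^-1 * \sum_tau \sum_j phi j tau ((A j tau)^T *m x) =
   primalR u - lam * (dot x u - h u).
  by rewrite /primalR -/x; ring.
have tl : 0 <= theta * lam by rewrite mulr_ge0// ltW.
have sm2 := ler_wpM2l tl sm.
have gwl : lam * dot (grad h w) V = lam * dot x V + lam * dot (grad h w - x) V.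
  by rewrite gw mulrDr.
have xVl : lam * dot x V =
    theta * (N^-1 * \sum_tau \sum_j dot ((A j tau)^T *m x) (b j tau)) - theta * (lam * dot x w).
  by rewrite xV xw; ring.
rewrite gwl xVl cbE DE PE; rewrite xe in sm2.
lra.
Qed.

(** The averaged quantity bounds the next potential plus [theta] times the primal gap, for given
    indices, once the seeds are integrated out. *)
Lemma avg_lyapunov_le (rho delta eta Dst Pst : R) (K := rho + theta * lam)
    (B1 := 2 * K / delta) (B2 := 16 * (1 - delta) * K / (delta * n%:R ^+ 2)) :
  0 < rho -> 0 < delta < 1 -> eta <= theta -> eta <= delta / 4 ->
  dualR alpha <= Dst -> Dst <= Pst ->
  theta ^+ 2 * R2 A / (2 * rho * (m%:R * n%:R))
  + theta ^+ 2 * (R2 A + Rm A ^+ 2 / n%:R) / (2 * lam * (m%:R * n%:R))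
  + 2 * K / delta * ((1 - delta) * (2 * R2 A / delta + (1 - delta) * Rm A ^+ 2 / n%:R
      + delta * (2 * Rbar2 A + Rm A ^+ 2) / n%:R) * theta ^+ 2 / (lam ^+ 2 * (m%:R * n%:R)))
  + 16 * (1 - delta) * K / (delta * n%:R ^+ 2) *
    ((1 - delta) * (2 * Rbar2 A / delta + Rm A ^+ 2) * theta ^+ 2 / (lam ^+ 2 * m%:R))
  <= theta * gam * (1 - theta * m%:R) / (2 * (m%:R * n%:R)) ->
  avg (fun f => (Dst - dualR (alpha_next f)) + theta * (primalR u - Pst)
    + B1 * ((1 - delta) ^+ 2 * dot (n%:R^-1 *: \sum_tau (v tau (f tau) + e tau))
                                   (n%:R^-1 *: \sum_tau (v tau (f tau) + e tau))
            + delta * (1 - delta) / n%:R ^+ 2 *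
              \sum_tau dot (v tau (f tau) + e tau) (v tau (f tau) + e tau))
    + B2 * ((1 - delta) * \sum_tau dot (v tau (f tau) + e tau) (v tau (f tau) + e tau))) <=
  (1 - eta) * (Dst - dualR alpha + B1 * dot ebar ebar + B2 * \sum_tau dot (e tau) (e tau)).
Proof.
move=> rho0 /andP[delta0 delta1] etat etad DD DP coef.
have K0 : 0 < K by rewrite addr_gt0// mulr_gt0.
have d1 : 0 < 1 - delta by rewrite subr_gt0.
have B10 : 0 <= B1 by rewrite divr_ge0 ?mulr_ge0// ltW.
have B20 : 0 <= B2 by rewrite divr_ge0 ?mulr_ge0 ?sqr_ge0// ltW.
rewrite !avgD avg_cst//.
have -> : avg (fun f => - dualR (alpha_next f)) = - avg (fun f => dualR (alpha_next f)).
  by rewrite -mulN1r -avgZ; apply: eq_avg => f; rewrite mulN1r.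
have hD := avg_dual_ge rho0.
move: hD; move: (avg (fun f => dualR (alpha_next f))) => Dn hD.
rewrite avg_cst// !avgZ avgD !avgZ.
have hg := ler_wpM2l B10 (avg_global_error_le A theta m0 n0 lam0 r e delta0 delta1).
have hl := ler_wpM2l B20 (avg_local_errors_le A theta m0 lam0 r e delta0 delta1).
rewrite NE in hD hg.
have X0 : 0 <= X by apply: sumr_ge0 => tau _; exact: sum_dot_ge0.
have hc := ler_wpM2l X0 coef.
have E0 := dot_ge0 ebar.
have S0 : 0 <= \sum_tau dot (e tau) (e tau) by exact: sum_dot_ge0.
(* These two identities determine the weights [B1] and [B2]. *)
have q1 : (theta * lam + rho) / 2 = B1 * (delta / 4) by rewrite /B1 /K; field; rewrite gt_eqF.
have q2 : B1 * (2 * delta * (1 - delta) / n%:R ^+ 2) = B2 * (delta / 4).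
  by rewrite /B1 /B2; field; rewrite !gt_eqF.
have p1 := mulr_ge0 B10 E0; have p2 := mulr_ge0 B20 S0.
exact: (lyapunov_arith hD hg hl hc q1 q2 p1 p2 etad etat DD DP (ltW theta0)).
Qed.

End Step.
End DualAscent.

(** * Integration over the sampling and the compressor *)

Section Compressor.
Context {R : realType} dS {S : measurableType dS} (nu : probability S R) {d : nat}
  (Q : S -> 'cV[R]_d -> 'cV[R]_d) (delta : R).
Hypotheses (Qc : contraction_compressor nu Q delta)
  (Qm : forall x j, ('E_nu[(fun s => Q s x j 0)%R] = (delta * x j 0)%:E)%E).

Let delta0 : 0 < delta. Proof. by case: Qc => /andP[]. Qed.

Lemma compressor_measurable dX (X : measurableType dX) (f : X -> S) (z : X -> borel_cV d) :
  measurable_fun [set: X] f -> measurable_fun [set: X] z ->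
  measurable_fun [set: X] ((fun w => Q (f w) (z w)) : X -> borel_cV d).
Proof.
move=> mf mz; apply: measurable_cV => j; case: Qc => _ mQ _.
apply: (@measurableT_comp _ _ _ _ _ _ (fun p : S * borel_cV d => Q p.1 p.2 j 0) _
  (fun w => (f w, z w))); first exact: mQ.
exact: measurable_fun_pair.
Qed.

Lemma compressor_error_le (c x : 'cV[R]_d) :
  (\int[nu]_s (dot (c + (x - Q s x)) (c + (x - Q s x)))%:E <=
   (dot (c + (1 - delta) *: x) (c + (1 - delta) *: x) +
    delta * (1 - delta) * dot x x)%:E)%E.
Proof.
pose r s := x - Q s x.
have mQx : measurable_fun [set: S] ((fun s => Q s x) : S -> borel_cV d).
  by apply: compressor_measurable => //; exact: measurable_cst.
have mr : measurable_fun [set: S] (r : S -> borel_cV d).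
  by apply: (measurable_continuous_cV (h := fun y => x - y)) => // y;
    apply: continuousB; [exact: cst_continuous|exact: cvg_id].
have mrj j : measurable_fun [set: S] (fun s => r s j 0) by exact: measurable_coord.
have r2 : (\int[nu]_s (dot (r s) (r s))%:E <= ((1 - delta) * dot x x)%:E)%E.
  case: Qc => _ _ /(_ x); rewrite unlock sqr_enorm; apply: le_trans.
  by rewrite le_eqVlt; apply/orP; left; apply/eqP; apply: eq_integral => s _; rewrite sqr_enorm.
have mrr : measurable_fun [set: S] (fun s => dot (r s) (r s)) by exact: measurable_dot.
have ir2 : nu.-integrable setT (EFin \o (fun s => dot (r s) (r s))).
  apply/integrableP; split; first exact/measurable_EFinP.
  rewrite (eq_integral (fun s => (dot (r s) (r s))%:E)).
    by apply: le_lt_trans r2 _; rewrite ltry.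
  by move=> s _; rewrite /= ger0_norm ?dot_ge0.
have icst (a : R) : nu.-integrable setT (EFin \o cst a) by exact: finite_measure_integrable_cst.
have icstE (a : R) : (\int[nu]_s (cst a s)%:E = a%:E)%E.
  transitivity (a%:E * nu setT)%E; first exact: (integral_cst nu measurableT a%:E).
  by rewrite probability_setT mule1.
(* Integrability of a coordinate follows from the finite second moment, by [|r_j| <= 1 + |r|^2]. *)
have irj j : nu.-integrable setT (EFin \o (fun s => r s j 0)).
  have := integrableD measurableT (icst 1) ir2.
  apply: le_integrable => //; first exact/measurable_EFinP.
  move=> s _ /=; rewrite lee_fin [leRHS]ger0_norm ?addr_ge0 ?dot_ge0//.
  have := dot_coord_le (r s) j; have := sqr_ge0 (`|r s j 0| - 1).
  by rewrite -(real_normK (num_real (r s j 0))); have := normr_ge0 (r s j 0); nra.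
have Erj j : (\int[nu]_s (r s j 0)%:E = ((1 - delta) * x j 0)%:E)%E.
  have iQ : nu.-integrable setT (EFin \o (fun s => Q s x j 0)).
    have := integrableB measurableT (icst (x j 0)) (irj j).
    apply: eq_integrable => // s _ /=; rewrite !mxE -EFinB; congr (_%:E); ring.
  rewrite (eq_integral (fun s => ((cst (x j 0) s)%:E - (Q s x j 0)%:E)%E)); last first.
    by move=> s _; rewrite /r !mxE EFinB.
  rewrite integralB_EFin//.
  have := Qm x j; rewrite unlock => ->.
  rewrite icstE -EFinB; congr (_%:E); ring.
pose lin s := \sum_j (2 * c j 0) * r s j 0.
have ilin : nu.-integrable setT (EFin \o lin).
  rewrite (_ : _ \o _ = fun s => (\sum_j (2 * c j 0)%:E * (r s j 0)%:E)%E); last first.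
    by apply/funext => s /=; rewrite -sumEFin.
  by apply: (integrable_sum measurableT) => j _; exact: (integrableZl measurableT _ (irj j)).
have Elin : (\int[nu]_s (lin s)%:E = (2 * (1 - delta) * dot c x)%:E)%E.
  rewrite (eq_integral (fun s => (\sum_j (2 * c j 0)%:E * (r s j 0)%:E)%E)); last first.
    by move=> s _; rewrite -sumEFin.
  rewrite integral_sum//; last by move=> j; exact: (integrableZl measurableT _ (irj j)).
  rewrite (eq_bigr (fun j => (2 * c j 0 * ((1 - delta) * x j 0))%:E)).
    rewrite sumEFin /dot mulr_sumr; congr (_%:E); apply: eq_bigr => j _; ring.
  by move=> j _; rewrite (integralZl measurableT (irj j)) Erj.
rewrite (eq_integral (fun s => ((dot c c + lin s)%:E + (dot (r s) (r s))%:E)%E)); last first.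
  move=> s _; rewrite -EFinD; congr (_%:E); rewrite -/(r s).
  have -> : lin s = 2 * dot c (r s).
    by rewrite /lin /dot mulr_sumr; apply: eq_bigr => j _; ring.
  by move: (r s) => y; rewrite !dotE (dotC y c); ring.
have icl : nu.-integrable setT (EFin \o (fun s => dot c c + lin s)).
  exact: (integrableD measurableT (icst (dot c c)) ilin).
rewrite integralD//.
have -> : (\int[nu]_s (dot c c + lin s)%:E = (dot c c + 2 * (1 - delta) * dot c x)%:E)%E.
  rewrite (eq_integral (fun s => ((cst (dot c c) s)%:E + (lin s)%:E)%E)); last first.
    by move=> s _; rewrite EFinD.
  by rewrite integralD//; [rewrite icstE Elin -EFinD|exact: icst].
apply: le_trans (leeD (lexx _) r2) _.
rewrite -EFinD lee_fin !dotE (dotC x c); lra.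
Qed.

End Compressor.

Section Sampling.
Context {R : realType} dT {T : measurableType dT} (Pr : probability T R)
  {I : choiceType} (F : I -> set (set T)).
Hypotheses (Fm : forall i, F i `<=` measurable) (FT : forall i, F i setT)
  (FI : forall i, setI_closed (F i)) (indF : mutually_independent Pr F).

Local Notation TG C := (g_sigma_algebraType (cylinders F C)).

Lemma measurable_cylinders dX (X : measurableType dX) C (f : T -> X) :
  measurable_fun [set: TG C] (f : TG C -> X) -> measurable_fun [set: T] f.
Proof.
move=> mf _ B mB; have := mf measurableT B mB.
have h : <<s cylinders F C >> `<=` measurable.
  by apply: smallest_sub; [exact: sigma_algebra_measurable|exact: cylinders_measurable].
exact: h.
Qed.

Lemma measurable_cylindersS dX (X : measurableType dX) C D (f : T -> X) : C `<=` D ->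
  measurable_fun [set: TG C] (f : TG C -> X) -> measurable_fun [set: TG D] (f : TG D -> X).
Proof.
move=> CD mf _ B mB; have := mf measurableT B mB.
have h : <<s cylinders F C >> `<=` <<s cylinders F D >>.
  by apply: sub_sigma_algebra2; exact: cylindersS.
exact: h.
Qed.

Lemma measurable_source dX (X : measurableType dX) (C : set I) i (f : T -> X) : C i ->
  (forall B, measurable B -> F i (f @^-1` B)) -> measurable_fun [set: TG C] (f : TG C -> X).
Proof.
move=> Ci fF _ B mB; rewrite setTI; apply: sub_sigma_algebra.
by apply: (cylinders1 FT Ci); exact: fF.
Qed.

Lemma measurable_select dX dY (X : measurableType dX) (Y : measurableType dY) m
    (ix : X -> 'I_m) (f : 'I_m -> X -> Y) :
  (forall i, measurable (ix @^-1` [set i])) ->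
  (forall i, measurable_fun [set: X] (f i)) -> measurable_fun [set: X] (fun w => f (ix w) w).
Proof.
move=> mi mf _ B mB; rewrite setTI.
have -> : (fun w => f (ix w) w) @^-1` B =
    \bigcup_(i in [set: 'I_m]) (ix @^-1` [set i] `&` f i @^-1` B).
  by apply/seteqP; split => [w /= Bw|w [i _ [/= <-]]] //; exists (ix w).
apply: fin_bigcup_measurable => // i _; apply: measurableI => //.
by rewrite -[X in measurable X]setTI; exact: mf.
Qed.

(** A source outside [C] is independent of all that is measurable for [C], so it can be replaced by
    a fresh variable of law [nu]. *)
Lemma integral_fresh_source dS (S : measurableType dS) (nu : probability S R) (C : set I) c
    (Z : T -> S) (f : TG C * S -> \bar R) : ~ C c ->
  measurable_fun [set: T] Z -> (forall B, measurable B -> F c (Z @^-1` B)) ->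
  (forall B, measurable B -> Pr (Z @^-1` B) = nu B) ->
  measurable_fun setT f -> (forall z, 0 <= f z)%E ->
  (\int[Pr]_w f (w, Z w) = \int[Pr]_w \int[nu]_s f (w, s))%E.
Proof.
move=> nCc mZ FZ nuZ mf f0.
pose Zm : {mfun T >-> S} := HB.pack Z (isMeasurableFun.Build _ _ _ _ _ mZ).
rewrite (@independent_tonelli _ _ _ Pr _ _ _ Zm f)//; last first.
- move=> A B sA mB /=.
  have := @independent_cylinders _ _ _ Pr _ F Fm FT FI indF C [fset c]%fset
    (fun j => if j == c then Z @^-1` B else setT) A.
  rewrite (_ : \bigcap_(j in _) _ = Z @^-1` B).
    apply => //; first by move=> j; rewrite inE => /eqP ->.
    by move=> j; case: eqP => [->|_]; [exact: FZ|exact: FT].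
  apply/seteqP; split => [w|w Bw j /=]; last by rewrite inE => /eqP ->; rewrite eqxx.
  by move=> /(_ c); rewrite /= inE eqxx => /(_ isT).
- exact: cylinders_measurable.
by apply: eq_integral => w _; apply: eq_measure_integral => A mA _; exact: nuZ.
Qed.

(** The event is encoded as a Boolean variable [Z], so that [independent_tonelli] applies. *)
Lemma integral_indep_event (C : set I) (J : {fset I}) (E : I -> set T) (f : T -> \bar R) :
  (forall j, j \in J -> ~ C j) -> (forall j, F j (E j)) ->
  measurable_fun [set: TG C] (f : TG C -> \bar R) -> (forall w, 0 <= f w)%E ->
  (\int[Pr]_w ((\1_(\bigcap_(j in [set` J]) E j) w)%:E * f w) =
   Pr (\bigcap_(j in [set` J]) E j) * \int[Pr]_w f w)%E.
Proof.
move=> JC FE mf f0; set B := \bigcap_(j in _) _.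
have mB : measurable B by apply: fin_bigcap_measurable => // j _; exact: Fm.
pose Z (w : T) : bool := w \in B.
have ZB b : Z @^-1` [set b] = if b then B else ~` B.
  case: b; apply/seteqP; split => w; rewrite /Z /=.
  - by move/set_mem.
  - by move/mem_set.
  - by move=> h wB; rewrite (mem_set wB) in h.
  - by move=> wB; rewrite memNset.
have mZ : measurable_fun [set: T] Z.
  by apply: (measurable_fun_bool true); rewrite setTI ZB.
pose Zm : {mfun T >-> bool} := HB.pack Z (isMeasurableFun.Build _ _ _ _ _ mZ).
pose h (p : TG C * bool) : \bar R := ((if p.2 then 1 else 0)%:E * f p.1)%E.
have mh : measurable_fun [set: (TG C * bool)%type] h.
  apply: emeasurable_funM; last exact: (measurableT_comp mf measurable_fst).
  apply/measurable_EFinP.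
  exact: (measurableT_comp (f := fun b : bool => if b then 1 else 0 : R) _ measurable_snd).
have h0 p : (0 <= h p)%E by rewrite mule_ge0// lee_fin; case: ifP.
have := @independent_tonelli _ _ _ Pr _ _ _ Zm h (@cylinders_measurable _ _ _ _ Fm C) _ mh h0.
have ind : forall A D, <<s cylinders F C >> A -> measurable D ->
    Pr (A `&` Z @^-1` D) = (Pr A * Pr (Z @^-1` D))%E.
  move=> A D sA _; have sAm : measurable A.
    by have h2 : <<s cylinders F C >> `<=` measurable;
      [by apply: smallest_sub; [exact: sigma_algebra_measurable|exact: cylinders_measurable]|exact: h2].
  have AB : Pr (A `&` B) = (Pr A * Pr B)%E by exact: independent_cylinders sA.
  have ABc : Pr (A `&` ~` B) = (Pr A * Pr (~` B))%E.
    rewrite probability_setC// -setDE measureD// ?AB; last by rewrite ltey_eq fin_num_measure.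
    transitivity (Pr A - Pr A * Pr B)%E; first by congr (_ - _)%E.
    have [a aE] : exists a, Pr A = a%:E by exists (fine (Pr A)); rewrite fineK// fin_num_measure.
    have [b bE] : exists b, Pr B = b%:E by exists (fine (Pr B)); rewrite fineK// fin_num_measure.
    rewrite aE bE -EFinM -!EFinB -EFinM; congr (_%:E); ring.
  have -> : Z @^-1` D = (if true \in D then B else set0) `|` (if false \in D then ~` B else set0).
    apply/seteqP; split => w; rewrite /Z /=.
      have [wB|wB] := boolP (w \in B) => Dw.
        by left; rewrite mem_set//; exact: set_mem.
      by right; rewrite mem_set//; move: wB; rewrite notin_setE.
    by case=> [|]; case: ifP => // /set_mem D' wB; [rewrite mem_set//|rewrite memNset].
  case: ifP => _; case: ifP => _; rewrite ?set0U ?setU0 ?setUv ?setIT ?setI0 ?measure0 ?mule0//.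
  by rewrite probability_setT mule1.
move=> /(_ ind); rewrite /h /= => E1.
rewrite (eq_integral (fun w => ((if Z w then 1 else 0)%:E * f w)%E)); last first.
  by move=> w _; rewrite /Z indicE; case: (w \in B).
rewrite E1 (eq_integral (fun w => (Pr B * f w)%E)); last first.
  move=> w _; rewrite ge0_integralZr//.
    congr (_ * _)%E.
    transitivity (\int[distribution Pr Zm]_s (\1_[set true] s)%:E)%E.
      by apply: eq_integral => -[] _; rewrite indicE; [rewrite mem_set|rewrite memNset].
    transitivity (distribution Pr Zm [set true]); last exact: congr1 (ZB true).
    by rewrite integral_indic ?setIT.
  by move=> b _; rewrite lee_fin; case: ifP.
rewrite ge0_integralZl//; first exact: measurable_cylinders mf.
Qed.

End Sampling.

(* Measurability is not needed: the integral of a nonnegative function is a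
   supremum over the simple functions below it. *)
Lemma le_integral_nonneg dT (T : measurableType dT) (R : realType)
    (mu : {measure set T -> \bar R}) (f1 f2 : T -> \bar R) :
  (forall x, 0 <= f1 x)%E -> (forall x, f1 x <= f2 x)%E ->
  (\int[mu]_x f1 x <= \int[mu]_x f2 x)%E.
Proof.
move=> f10 f12; have f20 x : (0 <= f2 x)%E by exact: le_trans (f10 x) (f12 x).
rewrite !ge0_integralTE//; apply: ereal_sup_le => _ [h hf <-]; exists h => // x.
exact: le_trans (hf x) (f12 x).
Qed.

Section Randomness.
Context {R : realType} {n m : nat} {dS : measure_display} {S : measurableType dS}
  (nu : probability S R) {d : nat} (Q : S -> 'cV[R]_d -> 'cV[R]_d) (delta : R)
  {dT : measure_display} {T : measurableType dT} (Pr : probability T R)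
  (idx : nat -> 'I_n -> T -> 'I_m) (seed : nat -> 'I_n -> T -> S).
Hypotheses (samp : ec_sampling nu Pr idx seed)
  (Qc : contraction_compressor nu Q delta)
  (Qm : forall x j, ('E_nu[(fun s => Q s x j 0)%R] = (delta * x j 0)%:E)%E).

Definition source (c : (nat * 'I_n) + (nat * 'I_n)) : set (set T) :=
  match c with
  | inl (k, tau) => preimage_set_system [set: T] (idx k tau) setT
  | inr (k, tau) => preimage_set_system [set: T] (seed k tau) measurable
  end.

Local Notation TG C := (g_sigma_algebraType (cylinders source C)).

Lemma source_idx k tau B : source (inl (k, tau)) (idx k tau @^-1` B).
Proof. by exists B => //; rewrite setTI. Qed.

Lemma source_seed k tau B : measurable B -> source (inr (k, tau)) (seed k tau @^-1` B).
Proof. by move=> mB; exists B => //; rewrite setTI. Qed.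

Lemma source_measurable c : source c `<=` measurable.
Proof.
have [mi ms _ _] := samp.
case: c => -[k tau] _ [B mB <-]; rewrite setTI; last first.
  by rewrite -[X in measurable X]setTI; exact: ms.
have -> : idx k tau @^-1` B = \bigcup_(i in B) (idx k tau @^-1` [set i]).
  by apply/seteqP; split => [w /= Bw|w [i Bi wi]]; [by exists (idx k tau w)|by rewrite /= wi].
by apply: fin_bigcup_measurable => // i _; exact: (mi k tau i).1.
Qed.

Lemma source_setT c : source c setT.
Proof. by case: c => -[k tau]; exists setT; rewrite ?setTI ?preimage_setT. Qed.

Lemma source_setI c : setI_closed (source c).
Proof.
case: c => -[k tau] _ _ [B mB <-] [D mD <-]; rewrite !setTI -preimage_setI.
  exact: source_idx.
by apply: source_seed; exact: measurableI.
Qed.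

Lemma source_indep : mutually_independent Pr source.
Proof.
have [_ _ _] := samp; rewrite /mutually_independent => h J E JE; apply: h => c cJ.
by have := JE c cJ; case: c {cJ} => -[].
Qed.

Let delta0 : 0 < delta. Proof. by case: Qc => /andP[]. Qed.
Let delta1 : delta <= 1. Proof. by case: Qc => /andP[]. Qed.

Let dd0 : 0 <= delta * (1 - delta).
Proof. by rewrite mulr_ge0 ?subr_ge0// ltW. Qed.

Lemma measurable_seed (C : set _) k tau : C (inr (k, tau)) ->
  measurable_fun [set: TG C] (seed k tau : TG C -> S).
Proof.
move=> Cc; apply: (measurable_source source_setT Cc) => B mB; exact: source_seed.
Qed.

Lemma measurable_idx (C : set _) k tau i : C (inl (k, tau)) ->
  measurable (idx k tau @^-1` [set i] : set (TG C)).
Proof.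
move=> Cc; apply: sub_sigma_algebra; apply: (cylinders1 source_setT Cc); exact: source_idx.
Qed.

Lemma measurable_cV_add dX (X : measurableType dX) (f h : X -> borel_cV d) :
  measurable_fun [set: X] f -> measurable_fun [set: X] h ->
  measurable_fun [set: X] ((fun w => (f w : 'cV[R]_d) + (h w : 'cV[R]_d)) : X -> borel_cV d).
Proof.
move=> mf mh; apply: measurable_cV => j; under eq_fun do rewrite mxE.
by apply: measurable_funD; exact: measurable_coord.
Qed.

Lemma measurable_cV_scale dX (X : measurableType dX) (f : X -> borel_cV d) a :
  measurable_fun [set: X] f ->
  measurable_fun [set: X] ((fun w => a *: (f w : 'cV[R]_d)) : X -> borel_cV d).
Proof.
move=> mf; apply: measurable_cV => j; under eq_fun do rewrite mxE.
by apply: measurable_funM; [exact: measurable_cst|exact: measurable_coord].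
Qed.

Lemma measurable_cV_sum dX (X : measurableType dX) (J : Type) (r : seq J) (f : J -> X -> borel_cV d) :
  (forall j, measurable_fun [set: X] (f j)) ->
  measurable_fun [set: X] ((fun w => \sum_(j <- r) (f j w : 'cV[R]_d)) : X -> borel_cV d).
Proof.
move=> mf; apply: measurable_cV => j; under eq_fun do rewrite summxE.
by apply: measurable_sum => i; exact: measurable_coord.
Qed.

Lemma measurable_residual dX (X : measurableType dX) (f : X -> S) (z : X -> borel_cV d) :
  measurable_fun [set: X] f -> measurable_fun [set: X] z ->
  measurable_fun [set: X] ((fun w => (z w : 'cV[R]_d) - Q (f w) (z w)) : X -> borel_cV d).
Proof.
move=> mf mz; have mQ := compressor_measurable Qc mf mz.
have := measurable_cV_add mz (measurable_cV_scale (-1) mQ).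
by apply: eq_measurable_fun => w _; rewrite scaleN1r.
Qed.

Lemma integral_compressor_le (C : set _) k tau (c z : T -> 'cV[R]_d) : ~ C (inr (k, tau)) ->
  measurable_fun [set: TG C] (c : TG C -> borel_cV d) ->
  measurable_fun [set: TG C] (z : TG C -> borel_cV d) ->
  (\int[Pr]_w (dot (c w + (z w - Q (seed k tau w) (z w)))
                   (c w + (z w - Q (seed k tau w) (z w))))%:E <=
   \int[Pr]_w (dot (c w + (1 - delta) *: z w) (c w + (1 - delta) *: z w) +
               delta * (1 - delta) * dot (z w) (z w))%:E)%E.
Proof.
move=> nC mc mz; have [_ ms nus _] := samp.
pose f (p : TG C * S) : \bar R :=
  (dot (c p.1 + (z p.1 - Q p.2 (z p.1))) (c p.1 + (z p.1 - Q p.2 (z p.1))))%:E.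
have m1 := @measurable_fst _ _ (TG C) S; have m2 := @measurable_snd _ _ (TG C) S.
have mf : measurable_fun setT f.
  apply/measurable_EFinP.
  have mr := measurable_residual m2 (measurableT_comp mz m1).
  have ma := measurable_cV_add (measurableT_comp mc m1) mr.
  exact: (measurable_dot ma ma).
have f0 p : (0 <= f p)%E by rewrite lee_fin dot_ge0.
have := @integral_fresh_source _ _ _ Pr _ source source_measurable source_setT source_setI
  source_indep _ _ nu C (inr (k, tau)) (seed k tau) f nC (ms k tau) _ _ mf f0.
move=> /(_ (fun B mB => source_seed k tau mB) (fun B mB => nus k tau B mB)).
rewrite {1}/f /= => ->; apply: le_integral_nonneg => w; first exact: integral_ge0.
exact: (compressor_error_le Qc Qm (c w) (z w)).
Qed.

(* The seeds are integrated out one at a time: the errors of the remaining calls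
   are frozen into c, and each step of the induction enlarges C by one seed. *)
Lemma integral_compressors_le k (r : seq 'I_n) : uniq r -> forall (C : set _) (c : T -> 'cV[R]_d)
    (z : 'I_n -> T -> 'cV[R]_d), (forall tau, tau \in r -> ~ C (inr (k, tau))) ->
  measurable_fun [set: TG C] (c : TG C -> borel_cV d) ->
  (forall tau, measurable_fun [set: TG C] (z tau : TG C -> borel_cV d)) ->
  (\int[Pr]_w (dot (c w + \sum_(tau <- r) (z tau w - Q (seed k tau w) (z tau w)))
                   (c w + \sum_(tau <- r) (z tau w - Q (seed k tau w) (z tau w))))%:E <=
   \int[Pr]_w (dot (c w + (1 - delta) *: \sum_(tau <- r) z tau w)
                   (c w + (1 - delta) *: \sum_(tau <- r) z tau w) +
               delta * (1 - delta) * \sum_(tau <- r) dot (z tau w) (z tau w))%:E)%E.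
Proof.
elim: r => [_|tau r IH /= /andP[taur ur]] C c z rC mc mz.
  apply: le_integral_nonneg => w; first by rewrite lee_fin dot_ge0.
  by rewrite lee_fin !big_nil scaler0 mulr0 !addr0.
pose C' := C `|` [set inr (k, tau)].
have CC' : C `<=` C' by move=> ? ?; left.
pose e w := z tau w - Q (seed k tau w) (z tau w).
have lift (f : T -> @borel_cV R d) : measurable_fun [set: TG C] f -> measurable_fun [set: TG C'] f.
  exact: measurable_cylindersS.
have me : measurable_fun [set: TG C'] (e : TG C' -> borel_cV d).
  by apply: measurable_residual; [apply: measurable_seed; right|exact: lift].
have rC' sigma : sigma \in r -> ~ C' (inr (k, sigma)).
  move=> sr [Cs|[sE]]; first by apply: (rC sigma) => //; rewrite inE sr orbT.
  by move: taur; rewrite -sE sr.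
have := IH ur C' (fun w => c w + e w) z rC' (measurable_cV_add (lift _ mc) me)
  (fun s => lift _ (mz s)).
under [X in (X <= _)%E -> _]eq_integral do rewrite -addrA.
under [X in _ -> (X <= _)%E]eq_integral do rewrite big_cons.
move=> /le_trans; apply.
pose zr w := \sum_(tau <- r) z tau w.
have mzr : measurable_fun [set: TG C] (zr : TG C -> borel_cV d) by exact: measurable_cV_sum.
pose c' w := c w + (1 - delta) *: zr w.
have mc' : measurable_fun [set: TG C] (c' : TG C -> borel_cV d).
  by apply: measurable_cV_add => //; exact: measurable_cV_scale.
pose q w := delta * (1 - delta) * \sum_(tau <- r) dot (z tau w) (z tau w).
have q0 w : 0 <= q w by rewrite mulr_ge0// sum_dot_ge0.
have mT dX (X : measurableType dX) (D : set _) (f : T -> X) :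
    measurable_fun [set: TG D] (f : TG D -> X) -> measurable_fun [set: T] f.
  exact: (measurable_cylinders source_measurable).
have mq : measurable_fun [set: T] q.
  apply: (mT _ _ C); apply: measurable_funM; first exact: measurable_cst.
  by apply: measurable_sum => s; exact: measurable_dot.
have mce : measurable_fun [set: T] (fun w => dot (c' w + e w) (c' w + e w)).
  have h := measurable_cV_add (lift _ mc') me.
  by apply: (mT _ _ C'); exact: (measurable_dot h h).
have mcz : measurable_fun [set: T] (fun w => dot (c' w + (1 - delta) *: z tau w) (c' w + (1 - delta) *: z tau w)
    + delta * (1 - delta) * dot (z tau w) (z tau w)).
  apply: (mT _ _ C).
  have h := measurable_cV_add mc' (measurable_cV_scale (1 - delta) (mz tau)).
  apply: measurable_funD; first exact: (measurable_dot h h).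
  apply: measurable_funM; first exact: measurable_cst.
  exact: measurable_dot.
rewrite (eq_integral (fun w => ((dot (c' w + e w) (c' w + e w))%:E + (q w)%:E)%E)); last first.
  move=> w _; rewrite -EFinD /c' /zr /q.
  by congr (_%:E); congr (dot _ _ + _); rewrite addrAC.
rewrite [leRHS](eq_integral (fun w => ((dot (c' w + (1 - delta) *: z tau w) (c' w + (1 - delta) *: z tau w)
    + delta * (1 - delta) * dot (z tau w) (z tau w))%:E + (q w)%:E)%E)); last first.
  move=> w _; rewrite -EFinD /c' /zr /q !big_cons scalerDr mulrDr.
  congr (_%:E); rewrite -[in RHS]addrA; congr (dot _ _ + _);
  by rewrite -addrA; congr (_ + _); rewrite addrC.
have p1 w : (0 <= (dot (c' w + (1 - delta) *: z tau w) (c' w + (1 - delta) *: z tau w)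
    + delta * (1 - delta) * dot (z tau w) (z tau w))%:E)%E.
  by rewrite lee_fin; apply: addr_ge0; [exact: dot_ge0|apply: mulr_ge0 => //; exact: dot_ge0].
rewrite !ge0_integralD//; try by [exact/measurable_EFinP | move=> w _; rewrite lee_fin ?dot_ge0].
apply: leeD => //; apply: (integral_compressor_le (C := C)) => //.
by apply: rC; rewrite inE eqxx.
Qed.

(** The space splits into the [m ^ n] events that fix every index of iteration [k]; these are
    equally likely, and each is independent of [Phi f], which is measurable for [C]. *)
Lemma integral_indices k (C : set _) (Phi : {ffun 'I_n -> 'I_m} -> T -> R) :
  (forall tau, ~ C (inl (k, tau))) ->
  (forall f, measurable_fun [set: TG C] (Phi f : TG C -> R)) -> (forall f w, 0 <= Phi f w) ->
  (\int[Pr]_w (Phi [ffun tau => idx k tau w] w)%:E = \int[Pr]_w (avg (fun f => Phi f w))%:E)%E.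
Proof.
move=> nC mPhi Phi0; have [mi _ _ _] := samp.
pose J := [fset (inl (k, tau) : (nat * 'I_n) + (nat * 'I_n)) | tau in [set: 'I_n]%SET]%fset.
pose E (f : {ffun 'I_n -> 'I_m}) (c : (nat * 'I_n) + (nat * 'I_n)) : set T :=
  match c with inl (l, tau) => idx l tau @^-1` [set f tau] | inr _ => setT end.
pose B f := \bigcap_(j in [set` J]) E f j.
have JP c : c \in J -> exists tau, c = inl (k, tau).
  by move=> /imfsetP[tau _ ->]; exists tau.
have BP f w : B f w <-> f = [ffun tau => idx k tau w].
  split=> [Bw|-> c /JP[tau ->]] /=; last by rewrite ffunE.
  apply/ffunP => tau; rewrite ffunE.
  by have := Bw (inl (k, tau)); rewrite /= in_imfset ?inE// => /(_ isT) ->.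
have sE f c : source c (E f c).
  case: c => -[l tau]; first exact: source_idx.
  exact: source_setT.
have JC j : j \in J -> ~ C j by move=> /JP[tau ->]; exact: nC.
have PrB f : Pr (B f) = ((m%:R ^+ n)^-1)%:E.
  rewrite /B source_indep; last by move=> j _; exact: sE.
  rewrite big_imfset /=; last by move=> x y _ _ [].
  rewrite (eq_bigr (fun=> (m%:R^-1)%:E)); last by move=> tau _; exact: (mi k tau (f tau)).2.
  rewrite prodEFin; congr (_%:E).
  by rewrite big_enum /= prodr_const cardsT card_ord exprVn.
have mB f : measurable (B f).
  by apply: fin_bigcap_measurable => // c _; apply: source_measurable (sE f c).
have mPT f : measurable_fun [set: T] (Phi f).
  exact: (measurable_cylinders source_measurable (mPhi f)).
rewrite (eq_integral (fun w => (\sum_f (\1_(B f) w)%:E * (Phi f w)%:E)%E)); last first.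
  move=> w _; rewrite (bigD1 [ffun tau => idx k tau w])//= [X in (_ + X)%E]big1.
    by rewrite adde0 indicE mem_set ?mul1e//; exact/BP.
  by move=> f ff; rewrite indicE memNset ?mul0e// => /BP fE; rewrite fE eqxx in ff.
rewrite ge0_integral_sum//; last 2 first.
  move=> f; apply: emeasurable_funM; apply/measurable_EFinP => //.
  by move=> f w _; rewrite mule_ge0// lee_fin.
rewrite [RHS](eq_integral (fun w => (((m%:R ^+ n)^-1)%:E * \sum_f (Phi f w)%:E)%E)); last first.
  by move=> w _; rewrite sumEFin -EFinM.
have ms : measurable_fun [set: T] (fun w => \sum_f (Phi f w)%:E)%E.
  by apply: emeasurable_sum => f; exact/measurable_EFinP.
have s0 w : [set: T] w -> (0 <= \sum_f (Phi f w)%:E)%E.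
  by move=> _; apply: sume_ge0 => f _; rewrite lee_fin.
rewrite (ge0_integralZl Pr measurableT ms s0) ?lee_fin ?invr_ge0 ?exprn_ge0//.
rewrite ge0_integral_sum//; last 2 first.
  by move=> f; exact/measurable_EFinP.
  by move=> f w _; rewrite lee_fin.
rewrite ge0_sume_distrr; last by move=> f _; apply: integral_ge0 => w _; rewrite lee_fin.
apply: eq_bigr => f _.
have := @integral_indep_event _ _ _ Pr _ source source_measurable source_setT source_setI
  source_indep C J (E f) (EFin \o Phi f) JC (sE f).
rewrite -/(B f) PrB /= => -> //; first exact/measurable_EFinP.
by move=> w; rewrite lee_fin.
Qed.

End Randomness.

(** * Decay along the iterates *)

Section MeasurableStep.
Context {R : realType} {m n d t : nat} (A : 'I_m -> 'I_n -> 'M[R]_(d, t))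
  (phi : 'I_m -> 'I_n -> 'cV[R]_t -> R) (g : 'cV[R]_d -> \bar R) (lam gam theta : R).
Hypotheses (gam0 : 0 < gam) (phis : forall i tau, smooth gam^-1 (phi i tau))
  (gp : proper_closed_convex g) (gs : strongly_convex 1 g).
Context dX {X : measurableType dX}.

Local Notation h := (fine \o conjugate g).

Let Vgam0 : 0 <= gam^-1. Proof. by rewrite invr_ge0 ltW. Qed.

Lemma measurable_mulmx d1 t1 (M : 'M[R]_(d1, t1)) (f : X -> borel_cV t1) :
  measurable_fun [set: X] f ->
  measurable_fun [set: X] ((fun w => M *m (f w : 'cV[R]_t1)) : X -> borel_cV d1).
Proof.
move=> mf.
have c : continuous (fun x : 'cV[R]_t1 => M *m x) by exact: continuous_mulmx.
pose ff := measurable_continuous_cV c mf.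
exact: ff.
Qed.

Variables (alpha : X -> 'I_m -> 'I_n -> 'cV[R]_t) (u : X -> 'cV[R]_d).
Hypotheses
  (ma : forall i tau, measurable_fun [set: X] ((fun w => alpha w i tau) : X -> borel_cV t))
  (mu : measurable_fun [set: X] (u : X -> borel_cV d)).

Let mx : measurable_fun [set: X] ((fun w => grad h (u w)) : X -> borel_cV d).
Proof. exact: (measurable_continuous_cV (grad_conjugate_continuous gp gs) mu). Qed.

Lemma measurable_dual_residual i tau : measurable_fun [set: X]
  ((fun w => residual A phi g (alpha w) (u w) i tau) : X -> borel_cV t).
Proof.
have mp := measurable_continuous_cV (grad_continuous Vgam0 (phis i tau))
  (measurable_mulmx (A i tau)^T mx).
have := measurable_cV_add (measurable_cV_scale (-1) mp) (measurable_cV_scale (-1) (ma i tau)).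
by apply: eq_measurable_fun => w _; rewrite !scaleN1r.
Qed.

Lemma measurable_incr tau j : measurable_fun [set: X]
  ((fun w => incr A lam theta (residual A phi g (alpha w) (u w)) tau j) : X -> borel_cV d).
Proof.
apply: measurable_cV_scale; apply: measurable_mulmx; apply: measurable_cV_scale.
exact: measurable_dual_residual.
Qed.

Lemma measurable_alpha_next (f : 'I_n -> 'I_m) j tau : measurable_fun [set: X]
  ((fun w => alpha_next A phi g theta (alpha w) (u w) f j tau) : X -> borel_cV t).
Proof.
rewrite /alpha_next; case: (j == f tau) => //.
by apply: measurable_cV_add => //; apply: measurable_cV_scale; exact: measurable_dual_residual.
Qed.

Lemma measurable_dualR : measurable_fun [set: X] (fun w => dualR A phi g lam (alpha w)).
Proof.
apply: measurable_funB.
  apply: measurableT_comp => //; apply: measurable_funM; first exact: measurable_cst.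
  apply: (measurableT_comp (continuous_borel (conjugate_continuous gp gs))).
  apply: measurable_cV_scale; apply: measurable_cV_sum => tau; apply: measurable_cV_sum => i.
  exact: measurable_mulmx.
apply: measurable_funM; first exact: measurable_cst.
apply: measurable_sum => tau; apply: measurable_sum => i; rewrite /conjR.
apply: (measurableT_comp (fine_measurable measurableT)).
have mc : measurable_fun [set: borel_cV t]
    (conjugate (EFin \o phi i tau) : borel_cV t -> \bar R).
  by apply: closed_sublevel_borel => a; exact: conjugate_lsc.
apply: (measurableT_comp mc).
have := measurable_cV_scale (-1) (ma i tau).
by apply: eq_measurable_fun => w _; rewrite scaleN1r.
Qed.

Lemma measurable_primalR : measurable_fun [set: X] (fun w => primalR A phi g lam (u w)).
Proof.
apply: measurable_funD; apply: measurable_funM; try exact: measurable_cst.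
  apply: measurable_sum => tau; apply: measurable_sum => i.
  have mAx := measurable_mulmx (A i tau)^T mx.
  have mp := continuous_borel (smooth_continuous (phis i tau)).
  exact: (measurableT_comp mp mAx).
apply: measurable_funB; first exact: measurable_dot.
exact: (measurableT_comp (continuous_borel (conjugate_continuous gp gs))).
Qed.

End MeasurableStep.

Section Iteration.
Context {R : realType} {m n d t : nat} (A : 'I_m -> 'I_n -> 'M[R]_(d, t))
  (phi : 'I_m -> 'I_n -> 'cV[R]_t -> R) (g : 'cV[R]_d -> \bar R) (lam gam theta : R).
Hypotheses (m0 : (0 < m)%N) (n0 : (0 < n)%N) (gam0 : 0 < gam) (lam0 : 0 < lam)
  (phic : forall i tau, convex_function [set: convex_lmodType 'cV[R]_t] (phi i tau))
  (phis : forall i tau, smooth gam^-1 (phi i tau))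
  (gp : proper_closed_convex g) (gs : strongly_convex 1 g).
Hypotheses (theta0 : 0 < theta) (theta1 : theta * m%:R <= 1).
Local Notation state := (@ec_state R m n d t).
Implicit Types (s : state) (i : 'I_n -> 'I_m) (q : 'I_n -> 'cV[R]_d -> 'cV[R]_d).

Definition node_input s tau j : 'cV[R]_d :=
  incr A lam theta (residual A phi g (ec_alpha s) (ec_u s)) tau j + ec_e s tau.

Definition mean_error s : 'cV[R]_d := n%:R^-1 *: \sum_(tau < n) ec_e s tau.

Local Notation step := (ec_step A phi g lam theta).

Let direction i s tau :
  - (theta * m%:R^-1^-1) *: ec_alpha s (i tau) tau -
  (theta * m%:R^-1^-1) *: grad (phi (i tau) tau)
    ((A (i tau) tau)^T *m grad (fine \o conjugate g) (ec_u s)) =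
  (theta * m%:R) *: residual A phi g (ec_alpha s) (ec_u s) (i tau) tau.
Proof. by rewrite invrK /residual scalerBr scalerN scaleNr addrC. Qed.

Lemma ec_step_alpha i q s :
  ec_alpha (step i q s) = alpha_next A phi g theta (ec_alpha s) (ec_u s) i.
Proof.
apply/funext => j; apply/funext => tau; rewrite /= direction /alpha_next.
by case: eqP => [->|].
Qed.

Lemma ec_step_e i q s tau : ec_e (step i q s) tau =
  node_input s tau (i tau) - q tau (node_input s tau (i tau)).
Proof. by rewrite /= direction -/(incr _ _ _ _ _ _) /node_input [ec_e _ _ + _]addrC. Qed.

Lemma ec_step_u i q s : ec_u (step i q s) =
  ec_u s + n%:R^-1 *: \sum_tau q tau (node_input s tau (i tau)).
Proof.
by rewrite /=; congr (_ + _ *: _); apply: eq_bigr => tau _; rewrite direction.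
Qed.

Definition consistent s :=
  finite_dual phi (ec_alpha s) /\ dual_point A lam (ec_alpha s) = ec_u s + mean_error s.

(** What the compressor drops from the update of [u] is stored in the errors, so [u + mean_error]
    moves by the uncompressed increments, exactly as the dual point does. *)
Lemma ec_step_consistent i q s : consistent s -> consistent (step i q s).
Proof.
move=> [fa uE]; split.
  by rewrite ec_step_alpha; exact: (finite_next A g gam0).
rewrite ec_step_alpha (dual_point_next _ _ _ m0 n0 lam0)// uE ec_step_u /mean_error.
rewrite -!addrA -!scalerDr; congr (_ + _ *: _).
rewrite -!big_split; apply: eq_bigr => tau _ /=.
rewrite -[RHS]/(q tau (node_input s tau (i tau)) + ec_e (step i q s) tau) ec_step_e.
by rewrite [RHS]addrC subrK /node_input addrC.
Qed.

End Iteration.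

Section NonnegReal.
Context dT {T : measurableType dT} {R : realType} (mu : {measure set T -> \bar R}).
Implicit Types f : T -> R.

Lemma integral_EFinZ c f : 0 <= c -> measurable_fun [set: T] f -> (forall w, 0 <= f w) ->
  (\int[mu]_w (c * f w)%:E = c%:E * \int[mu]_w (f w)%:E)%E.
Proof.
move=> c0 mf f0; rewrite -ge0_integralZl_EFin//; first by move=> w _; rewrite lee_fin.
exact/measurable_EFinP.
Qed.

Lemma integral_EFinD f1 f2 : measurable_fun [set: T] f1 -> (forall w, 0 <= f1 w) ->
  measurable_fun [set: T] f2 -> (forall w, 0 <= f2 w) ->
  (\int[mu]_w (f1 w + f2 w)%:E = \int[mu]_w (f1 w)%:E + \int[mu]_w (f2 w)%:E)%E.
Proof.
move=> m1 p1 m2 p2.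
rewrite -ge0_integralD//; try by [move=> w _; rewrite lee_fin | exact/measurable_EFinP].
Qed.

Lemma integral_EFin_sum (J : Type) (r : seq J) (f : J -> T -> R) :
  (forall j, measurable_fun [set: T] (f j)) -> (forall j w, 0 <= f j w) ->
  (\int[mu]_w (\sum_(j <- r) f j w)%:E = \sum_(j <- r) \int[mu]_w (f j w)%:E)%E.
Proof.
move=> mf f0; rewrite -ge0_integral_sum//; last 2 first.
  by move=> j; exact/measurable_EFinP.
  by move=> j w _; rewrite lee_fin.
by apply: eq_integral => w _; rewrite sumEFin.
Qed.

End NonnegReal.

(** * Expected decrease of the potential along the random process *)

Section Process.
Context {R : realType} {m n d t : nat} (A : 'I_m -> 'I_n -> 'M[R]_(d, t))
  (phi : 'I_m -> 'I_n -> 'cV[R]_t -> R) (g : 'cV[R]_d -> \bar R) (lam gam theta : R).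
Context {dS : measure_display} {S : measurableType dS}
  (nu : probability S R) (Q : S -> 'cV[R]_d -> 'cV[R]_d) (delta : R)
  {dT : measure_display} {T : measurableType dT} (Pr : probability T R)
  (idx : nat -> 'I_n -> T -> 'I_m) (seed : nat -> 'I_n -> T -> S)
  (x0 : 'cV[R]_d) (alpha0 : 'I_m -> 'I_n -> 'cV[R]_t).
Hypotheses (m0 : (0 < m)%N) (n0 : (0 < n)%N) (gam0 : 0 < gam) (lam0 : 0 < lam)
  (phic : forall i tau, convex_function [set: convex_lmodType 'cV[R]_t] (phi i tau))
  (phis : forall i tau, smooth gam^-1 (phi i tau))
  (gp : proper_closed_convex g) (gs : strongly_convex 1 g)
  (theta0 : 0 < theta) (theta1 : theta * m%:R <= 1)
  (samp : ec_sampling nu Pr idx seed)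
  (Qc : contraction_compressor nu Q delta)
  (Qm : forall x j, ('E_nu[(fun s => Q s x j 0)%R] = (delta * x j 0)%:E)%E).

Local Notation st k w := (ec_sdca A phi g lam theta x0 alpha0
  (fun l tau => idx l tau w) (fun l tau => Q (seed l tau w)) k).
Local Notation TG C := (g_sigma_algebraType (cylinders (source idx seed) C)).
Local Notation input s tau j := (node_input A phi g lam theta s tau j).

Definition past k : set ((nat * 'I_n) + (nat * 'I_n)) :=
  fun c => match c with inl (l, _) | inr (l, _) => (l < k)%N end.

Definition measurable_state dX (X : measurableType dX) (s : X -> @ec_state R m n d t) :=
  [/\ forall i tau, measurable_fun [set: X] ((fun w => ec_alpha (s w) i tau) : X -> borel_cV t),
      measurable_fun [set: X] ((fun w => ec_u (s w)) : X -> borel_cV d)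
    & forall tau, measurable_fun [set: X] ((fun w => ec_e (s w) tau) : X -> borel_cV d)].

Lemma measurable_input dX (X : measurableType dX) (s : X -> @ec_state R m n d t) tau j :
  measurable_state s -> measurable_fun [set: X] ((fun w => input (s w) tau j) : X -> borel_cV d).
Proof.
move=> [ma mu me]; apply: measurable_cV_add => //.
exact: (measurable_incr A lam theta gam0 phis gp gs ma mu).
Qed.

(** Stated for every [C] containing the past, because later arguments add sources of the current
    iteration to [C]. *)
Lemma measurable_process k C : past k `<=` C ->
  measurable_state ((fun w => st k w) : TG C -> _).
Proof.
elim: k C => [|k IH] C kC.
  by split => *; exact: measurable_cst.
have kC' : past k `<=` C.
  by move=> c ck; apply: kC; case: c ck => -[l tau] /= lk; rewrite ltnS ltnW.
have mi tau i : measurable (idx k tau @^-1` [set i] : set (TG C)).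
  by apply: measurable_idx; apply: kC => /=.
have ms tau : measurable_fun [set: TG C] (seed k tau : TG C -> S).
  by apply: measurable_seed; apply: kC => /=.
have mst := IH C kC'; have [ma mu me] := mst.
have mz tau : measurable_fun [set: TG C]
    ((fun w => input (st k w) tau (idx k tau w)) : TG C -> borel_cV d).
  exact: (measurable_select (mi tau) (fun j => measurable_input tau j mst)).
split.
- move=> i tau.
  under eq_fun do rewrite [st _ _]/= ec_step_alpha /alpha_next.
  pose f (j : 'I_m) w : borel_cV t := if i == j then ec_alpha (st k w) i tau +
    (theta * m%:R) *: residual A phi g (ec_alpha (st k w)) (ec_u (st k w)) i tau
    else ec_alpha (st k w) i tau.
  have mf j : measurable_fun [set: TG C] (f j : TG C -> _).
    rewrite /f; case: (i == j) => //.
    apply: measurable_cV_add => //; apply: measurable_cV_scale.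
    exact: (measurable_dual_residual A gam0 phis gp gs ma mu).
  exact: (measurable_select (mi tau) mf).
- under eq_fun do rewrite [st _ _]/= ec_step_u.
  apply: measurable_cV_add => //; apply: measurable_cV_scale; apply: measurable_cV_sum => tau.
  exact: (compressor_measurable Qc).
- move=> tau; under eq_fun do rewrite [st _ _]/= ec_step_e.
  exact: (measurable_residual Qc).
Qed.

Let sm := source_measurable samp.

Let measurable_trivial dX (X : measurableType dX) (C : set _) (f : T -> X) :
  measurable_fun [set: TG C] (f : TG C -> X) -> measurable_fun [set: T] f.
Proof. exact: (measurable_cylinders sm). Qed.

Lemma measurable_iterate k : measurable_state ((fun w => st k w) : T -> _).
Proof.
have [ma mu me] := @measurable_process k setT (@subsetT _ _).
by split => [i tau||tau]; apply: (measurable_trivial (C := setT)).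
Qed.

Lemma process_consistent k w : finite_dual phi alpha0 -> consistent A phi lam (st k w).
Proof.
move=> fa; elim: k => [|k IH]; last first.
  exact: (ec_step_consistent g m0 n0 gam0 lam0 phic phis theta0 theta1).
by split => //=; rewrite /mean_error big1// scaler0 addr0.
Qed.

Section OneStep.
Variables (rho eta Dst Pst : R).
Let K := rho + theta * lam.
Let B1 := 2 * K / delta.
Let B2 := 16 * (1 - delta) * K / (delta * n%:R ^+ 2).
Hypotheses (rho0 : 0 < rho) (delta1 : delta < 1) (etat : eta <= theta) (etad : eta <= delta / 4)
  (Dmax : forall alpha, finite_dual phi alpha -> dualR A phi g lam alpha <= Dst)
  (Pmin : forall u, Pst <= primalR A phi g lam u) (DP : Dst <= Pst)
  (fa0 : finite_dual phi alpha0)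
  (coef : theta ^+ 2 * R2 A / (2 * rho * (m%:R * n%:R))
  + theta ^+ 2 * (R2 A + Rm A ^+ 2 / n%:R) / (2 * lam * (m%:R * n%:R))
  + 2 * K / delta * ((1 - delta) * (2 * R2 A / delta + (1 - delta) * Rm A ^+ 2 / n%:R
      + delta * (2 * Rbar2 A + Rm A ^+ 2) / n%:R) * theta ^+ 2 / (lam ^+ 2 * (m%:R * n%:R)))
  + 16 * (1 - delta) * K / (delta * n%:R ^+ 2) *
    ((1 - delta) * (2 * Rbar2 A / delta + Rm A ^+ 2) * theta ^+ 2 / (lam ^+ 2 * m%:R))
  <= theta * gam * (1 - theta * m%:R) / (2 * (m%:R * n%:R))).

Definition lyapunov (s : @ec_state R m n d t) : R :=
  Dst - dualR A phi g lam (ec_alpha s) + B1 * dot (mean_error s) (mean_error s)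
  + B2 * \sum_tau dot (ec_e s tau) (ec_e s tau).

Let delta0 : 0 < delta. Proof. by case: Qc => /andP[]. Qed.
Let d1 : 0 < 1 - delta. Proof. by rewrite subr_gt0. Qed.
Let K0 : 0 < K. Proof. by rewrite addr_gt0// mulr_gt0. Qed.
Let B10 : 0 <= B1. Proof. by rewrite divr_ge0 ?mulr_ge0// ltW. Qed.
Let B20 : 0 <= B2. Proof. by rewrite divr_ge0 ?mulr_ge0 ?sqr_ge0// ltW. Qed.
Let dd0 : 0 <= delta * (1 - delta). Proof. by rewrite mulr_ge0// ltW. Qed.

Lemma lyapunov_ge0 s : finite_dual phi (ec_alpha s) -> 0 <= lyapunov s.
Proof.
move=> fs; apply: addr_ge0; last by apply: mulr_ge0 => //; exact: sum_dot_ge0.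
by rewrite addr_ge0 ?subr_ge0 ?Dmax//; apply: mulr_ge0 => //; exact: dot_ge0.
Qed.

Lemma measurable_lyapunov dX (X : measurableType dX) (s : X -> @ec_state R m n d t) :
  measurable_state s -> measurable_fun [set: X] (fun w => lyapunov (s w)).
Proof.
move=> [ma _ me].
have mme := measurable_cV_scale (n%:R^-1 : R) (measurable_cV_sum (index_enum 'I_n) me).
apply: measurable_funD; first apply: measurable_funD.
- by apply: measurable_funB => //; exact: (measurable_dualR A phi lam gp gs ma).
- by apply: measurable_funM => //; exact: (measurable_dot mme mme).
- by apply: measurable_funM => //; apply: measurable_sum => tau; exact: measurable_dot.
Qed.

Section Increment.
Variable k : nat.

Let z tau w : 'cV[R]_d := input (st k w) tau (idx k tau w).
Let nsqz tau w := dot (z tau w) (z tau w).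
Let nsqZ w := dot (n%:R^-1 *: \sum_tau z tau w) (n%:R^-1 *: \sum_tau z tau w).
(** Contains the indices of iteration [k] but none of its seeds: the inputs [z] are measurable for
    [C] while the seeds are still fresh. *)
Let C : set ((nat * 'I_n) + (nat * 'I_n)) :=
  fun c => match c with inl (l, _) => (l <= k)%N | inr (l, _) => (l < k)%N end.

Let mz tau : measurable_fun [set: TG C] (z tau : TG C -> borel_cV d).
Proof.
have mi i : measurable (idx k tau @^-1` [set i] : set (TG C)).
  by apply: measurable_idx => /=.
have mst : measurable_state ((fun w => st k w) : TG C -> _).
  by apply: measurable_process => -[] [l ?] //= /ltnW.
exact: (measurable_select mi (fun j => measurable_input tau j mst)).
Qed.

Let nC tau : ~ C (inr (k, tau)). Proof. by rewrite /C /= ltnn. Qed.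

Let mnsqz tau : measurable_fun [set: T] (nsqz tau).
Proof. by apply: (measurable_trivial (C := C)); exact: measurable_dot. Qed.

Let mnsqZ : measurable_fun [set: T] nsqZ.
Proof.
apply: (measurable_trivial (C := C)).
have mZ := measurable_cV_scale (n%:R^-1 : R) (measurable_cV_sum (index_enum 'I_n) mz).
exact: (measurable_dot mZ mZ).
Qed.

Let nsqZ_ge0 w : 0 <= nsqZ w. Proof. exact: dot_ge0. Qed.
Let nsqz_ge0 tau w : 0 <= nsqz tau w. Proof. exact: dot_ge0. Qed.

Let m_cst : measurable_fun [set: TG C] ((fun=> 0 : 'cV[R]_d) : TG C -> borel_cV d).
Proof. exact: measurable_cst. Qed.

Let process_e tau w : ec_e (st k.+1 w) tau = z tau w - Q (seed k tau w) (z tau w).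
Proof. by rewrite [st k.+1 w]/= ec_step_e. Qed.

Lemma integral_local_error_le tau :
  (\int[Pr]_w (dot (ec_e (st k.+1 w) tau) (ec_e (st k.+1 w) tau))%:E <=
   \int[Pr]_w ((1 - delta) * nsqz tau w)%:E)%E.
Proof.
have := integral_compressor_le samp Qc Qm (@nC tau) m_cst (@mz tau).
under eq_integral do rewrite add0r -process_e.
move=> /le_trans; apply.
rewrite le_eqVlt; apply/orP; left; apply/eqP; apply: eq_integral => w _.
by rewrite add0r dotZl dotZr /nsqz; congr (_%:E); ring.
Qed.

Let nn0 : 0 <= n%:R^-1 ^+ 2 :> R. Proof. exact: sqr_ge0. Qed.

Lemma integral_mean_error_le :
  (\int[Pr]_w (dot (mean_error (st k.+1 w)) (mean_error (st k.+1 w)))%:E <=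
   \int[Pr]_w ((1 - delta) ^+ 2 * nsqZ w +
                delta * (1 - delta) / n%:R ^+ 2 * \sum_tau nsqz tau w)%:E)%E.
Proof.
have [_ _ me] := measurable_iterate k.+1.
have := integral_compressors_le samp Qc Qm (index_enum_uniq 'I_n) (fun tau _ => @nC tau) m_cst mz.
pose E w := \sum_tau ec_e (st k.+1 w) tau.
have mE : measurable_fun [set: T] (E : T -> borel_cV d) by exact: measurable_cV_sum.
rewrite (eq_integral (fun w => (dot (E w) (E w))%:E)); last first.
  by move=> w _; rewrite add0r /E; under [in RHS]eq_bigr do rewrite process_e.
move=> /(lee_wpmul2l (x := (n%:R^-1 ^+ 2)%:E)).
rewrite lee_fin => /(_ nn0).
rewrite -integral_EFinZ//; [|exact: measurable_dot|by move=> w; exact: dot_ge0].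
rewrite -integral_EFinZ//; first last.
- move=> w; apply: addr_ge0; first exact: dot_ge0.
  by apply: mulr_ge0 => //; exact: sum_dot_ge0.
- apply: (measurable_trivial (C := C)); apply: measurable_funD.
    have mZ := measurable_cV_add m_cst
      (measurable_cV_scale (1 - delta) (measurable_cV_sum (index_enum 'I_n) mz)).
    exact: (measurable_dot mZ mZ).
  by apply: measurable_funM => //; apply: measurable_sum => tau; exact: measurable_dot.
rewrite (eq_integral (fun w =>
  (dot (mean_error (st k.+1 w)) (mean_error (st k.+1 w)))%:E)); last first.
  by move=> w _; rewrite /mean_error dotZl dotZr mulrA expr2.
move=> /le_trans; apply.
rewrite le_eqVlt; apply/orP; left; apply/eqP; apply: eq_integral => w _.
rewrite add0r /nsqZ /nsqz !dotZl !dotZr -exprVn; congr (_%:E); ring.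
Qed.

Lemma integral_lyapunov_le :
  (\int[Pr]_w (lyapunov (st k.+1 w) + theta * (primalR A phi g lam (ec_u (st k w)) - Pst))%:E <=
   (1 - eta)%:E * \int[Pr]_w (lyapunov (st k w))%:E)%E.
Proof.
have [ma mu me] := measurable_iterate k.+1.
have cons w l : consistent A phi lam (st l w) by exact: process_consistent.
have mst : measurable_state ((fun w => st k w) : TG (past k) -> _).
  exact: measurable_process.
have [mak muk mek] := measurable_iterate k.
pose gp' w := theta * (primalR A phi g lam (ec_u (st k w)) - Pst).
(* The part of the potential that does not depend on the seeds of iteration [k]; only the errors
   do. *)
pose G w := Dst - dualR A phi g lam (ec_alpha (st k.+1 w)) + gp' w.
have gp0 w : 0 <= gp' w by rewrite mulr_ge0 ?subr_ge0// ltW.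
have G0 w : 0 <= G w by rewrite addr_ge0// subr_ge0 Dmax//; have [] := cons w k.+1.
have mgp dX (X : measurableType dX) (v : X -> 'cV[R]_d) :
    measurable_fun [set: X] (v : X -> borel_cV d) ->
    measurable_fun [set: X] (fun w => theta * (primalR A phi g lam (v w) - Pst)).
  move=> mv; apply: measurable_funM => //; apply: measurable_funB => //.
  exact: (measurable_primalR A lam phis gp gs mv).
have mD dX (X : measurableType dX) (a : X -> 'I_m -> 'I_n -> 'cV[R]_t) :
    (forall i tau, measurable_fun [set: X] ((fun w => a w i tau) : X -> borel_cV t)) ->
    measurable_fun [set: X] (fun w => Dst - dualR A phi g lam (a w)).
  move=> mv; apply: measurable_funB => //.
  exact: (measurable_dualR A phi lam gp gs mv).
have mG : measurable_fun [set: T] G.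
  by apply: measurable_funD; [exact: mD|exact: mgp].
pose M w := dot (mean_error (st k.+1 w)) (mean_error (st k.+1 w)).
pose E tau w := dot (ec_e (st k.+1 w) tau) (ec_e (st k.+1 w) tau).
have mM : measurable_fun [set: T] M.
  have mme := measurable_cV_scale (n%:R^-1 : R) (measurable_cV_sum (index_enum 'I_n) me).
  exact: (measurable_dot mme mme).
have mE tau : measurable_fun [set: T] (E tau) by exact: measurable_dot.
pose M' w := (1 - delta) ^+ 2 * nsqZ w + delta * (1 - delta) / n%:R ^+ 2 * \sum_tau nsqz tau w.
pose E' tau w := (1 - delta) * nsqz tau w.
have M0 w : 0 <= M w by exact: dot_ge0.
have E0 tau w : 0 <= E tau w by exact: dot_ge0.
have M'0 w : 0 <= M' w.
  apply: addr_ge0; apply: mulr_ge0 => //; first exact: sqr_ge0.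
    by rewrite mulr_ge0// invr_ge0 sqr_ge0.
  exact: sum_dot_ge0.
have E'0 tau w : 0 <= E' tau w by rewrite mulr_ge0// ltW.
have mE' tau : measurable_fun [set: T] (E' tau) by exact: measurable_funM.
have mM' : measurable_fun [set: T] M'.
  apply: measurable_funD; apply: measurable_funM => //.
  exact: measurable_sum.
have split (N : T -> R) (F : 'I_n -> T -> R) : measurable_fun [set: T] N ->
    (forall w, 0 <= N w) -> (forall tau, measurable_fun [set: T] (F tau)) ->
    (forall tau w, 0 <= F tau w) ->
    (\int[Pr]_w (G w + B1 * N w + B2 * \sum_tau F tau w)%:E =
     \int[Pr]_w (G w)%:E + B1%:E * \int[Pr]_w (N w)%:E +
     B2%:E * \sum_tau \int[Pr]_w (F tau w)%:E)%E.
  move=> mN N0 mF F0.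
  have mB1 : measurable_fun [set: T] (fun w => B1 * N w) by exact: measurable_funM.
  have mSF : measurable_fun [set: T] (fun w => \sum_tau F tau w) by exact: measurable_sum.
  have SF0 w : 0 <= \sum_tau F tau w by exact: sumr_ge0.
  rewrite integral_EFinD; last 4 first.
  - exact: measurable_funD.
  - by move=> w; rewrite addr_ge0// mulr_ge0.
  - exact: measurable_funM.
  - by move=> w; rewrite mulr_ge0.
  rewrite integral_EFinD//; last by move=> w; rewrite mulr_ge0.
  by rewrite !integral_EFinZ// integral_EFin_sum.
(* Integrand left once the seeds are gone, as a function of frozen indices [f] and of the past;
   [integral_indices] then replaces the drawn indices by an average. *)
pose Phi (f : {ffun 'I_n -> 'I_m}) w :=
  (Dst - dualR A phi g lam (alpha_next A phi g theta (ec_alpha (st k w)) (ec_u (st k w)) f)) +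
  theta * (primalR A phi g lam (ec_u (st k w)) - Pst)
  + B1 * ((1 - delta) ^+ 2 * dot (n%:R^-1 *: \sum_tau input (st k w) tau (f tau))
                                 (n%:R^-1 *: \sum_tau input (st k w) tau (f tau))
          + delta * (1 - delta) / n%:R ^+ 2 *
            \sum_tau dot (input (st k w) tau (f tau)) (input (st k w) tau (f tau)))
  + B2 * ((1 - delta) * \sum_tau dot (input (st k w) tau (f tau)) (input (st k w) tau (f tau))).
have PhiE w : G w + B1 * M' w + B2 * \sum_tau E' tau w = Phi [ffun tau => idx k tau w] w.
  have aE : ec_alpha (st k.+1 w) = alpha_next A phi g theta (ec_alpha (st k w)) (ec_u (st k w))
      [ffun tau => idx k tau w].
    rewrite [st _ _]/= ec_step_alpha.
    by apply/funext => i; apply/funext => tau; rewrite /alpha_next ffunE.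
  have zE : \sum_tau z tau w = \sum_tau input (st k w) tau ([ffun tau => idx k tau w] tau).
    by apply: eq_bigr => tau _; rewrite ffunE.
  have nE : \sum_tau nsqz tau w =
      \sum_tau dot (input (st k w) tau ([ffun tau => idx k tau w] tau))
                   (input (st k w) tau ([ffun tau => idx k tau w] tau)).
    by apply: eq_bigr => tau _; rewrite /nsqz /z ffunE.
  by rewrite /Phi /G /M' /E' /nsqZ -mulr_sumr aE zE nE.
apply: (@le_trans _ _ (\int[Pr]_w (Phi [ffun tau => idx k tau w] w)%:E)%E).
  rewrite (eq_integral (fun w => (G w + B1 * M w + B2 * \sum_tau E tau w)%:E)); last first.
    by move=> w _; congr (_%:E); rewrite /lyapunov /G /gp' /M /E; ring.
  rewrite [leRHS](eq_integral (fun w => (G w + B1 * M' w + B2 * \sum_tau E' tau w)%:E)); last first.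
    by move=> w _; rewrite PhiE.
  rewrite !split//; apply: leeD; first apply: leeD => //.
    by apply: lee_wpmul2l; rewrite ?lee_fin//; exact: integral_mean_error_le.
  apply: lee_wpmul2l; rewrite ?lee_fin//; apply: lee_sum => tau _.
  exact: integral_local_error_le.
have mIn tau j : measurable_fun [set: TG (past k)]
    ((fun w => input (st k w) tau j) : TG (past k) -> borel_cV d) by exact: measurable_input.
have Phi0 f w : 0 <= Phi f w.
  have s0 : 0 <= \sum_tau dot (input (st k w) tau (f tau)) (input (st k w) tau (f tau)).
    exact: sum_dot_ge0.
  have [fa _] := cons w k.
  apply: addr_ge0; last by apply: mulr_ge0 => //; apply: mulr_ge0 => //; exact: ltW.
  apply: addr_ge0; first apply: addr_ge0; last 2 first.
  - exact: gp0.
  - apply: mulr_ge0 => //; apply: addr_ge0; apply: mulr_ge0 => //; first exact: sqr_ge0.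
      exact: dot_ge0.
    by rewrite mulr_ge0// invr_ge0 sqr_ge0.
  - by rewrite subr_ge0; apply: Dmax; exact: (finite_next A g gam0).
have mPhi f : measurable_fun [set: TG (past k)] (Phi f : TG (past k) -> R).
  have [ak uk ek] := mst.
  have mS : measurable_fun [set: TG (past k)]
      ((fun w => \sum_tau dot (input (st k w) tau (f tau)) (input (st k w) tau (f tau)))
       : TG (past k) -> R).
    by apply: measurable_sum => tau; exact: measurable_dot.
  have mZ := measurable_cV_scale (n%:R^-1 : R) (measurable_cV_sum (index_enum 'I_n) (fun tau => mIn tau (f tau))).
  apply: measurable_funD; last by apply: measurable_funM => //; exact: measurable_funM.
  apply: measurable_funD.
    apply: measurable_funD; last exact: mgp.
    apply: mD => i tau; exact: (measurable_alpha_next A theta gam0 phis gp gs ak uk).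
  apply: measurable_funM => //; apply: measurable_funD; apply: measurable_funM => //.
  exact: (measurable_dot mZ mZ).
rewrite (integral_indices samp (C := past k) (k := k))//.
have l0 w : 0 <= lyapunov (st k w) by apply: lyapunov_ge0; have [] := cons w k.
have ml : measurable_fun [set: T] (fun w => lyapunov (st k w)).
  exact: (measurable_lyapunov (measurable_iterate k)).
have step w : avg (fun f => Phi f w) <= (1 - eta) * lyapunov (st k w).
  have [fa uE] := cons w k.
  apply: (avg_lyapunov_le m0 n0 gam0 lam0 phic phis gp gs theta0 theta1 fa uE) => //.
  - by rewrite delta0.
  - exact: Dmax.
have eta1 : 0 <= 1 - eta.
  rewrite subr_ge0; apply: le_trans etad _; rewrite ler_pdivrMr// mul1r.
  by apply: le_trans (ltW delta1) _; rewrite ler1n.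
rewrite -integral_EFinZ//; apply: le_integral_nonneg => w; rewrite lee_fin//.
by rewrite mulr_ge0 ?invr_ge0 ?exprn_ge0//; exact: sumr_ge0.
Qed.

End Increment.

Let eta1 : 0 < 1 - eta.
Proof.
rewrite subr_gt0; apply: le_lt_trans etad _; rewrite ltr_pdivrMr// mul1r.
by apply: lt_le_trans delta1 _; rewrite ler1n.
Qed.

Let st0 := ec_init A lam x0 alpha0.
Let gap k w := primalR A phi g lam (ec_u (st k w)) - Pst.

Let lyapunov_st_ge0 k w : 0 <= lyapunov (st k w).
Proof. by apply: lyapunov_ge0; have [] := @process_consistent k w fa0. Qed.

Let theta_gap_ge0 k w : 0 <= theta * gap k w.
Proof. by rewrite mulr_ge0 ?subr_ge0// ltW. Qed.

Let m_theta_gap k : measurable_fun [set: T] (fun w => theta * gap k w).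
Proof.
have [_ mu _] := measurable_iterate k.
apply: measurable_funM => //; apply: measurable_funB => //.
exact: (measurable_primalR A lam phis gp gs mu).
Qed.

Let m_lyapunov k : measurable_fun [set: T] (fun w => lyapunov (st k w)).
Proof. exact: (measurable_lyapunov (measurable_iterate k)). Qed.

Let integral_st0 : (\int[Pr]_w (lyapunov (st 0 w))%:E = (lyapunov st0)%:E)%E.
Proof.
transitivity ((lyapunov st0)%:E * Pr setT)%E; last by rewrite probability_setT mule1.
exact: (integral_cst Pr measurableT (lyapunov st0)%:E).
Qed.

Lemma integral_lyapunov_decay k :
  (\int[Pr]_w (lyapunov (st k w))%:E <= ((1 - eta) ^+ k * lyapunov st0)%:E)%E.
Proof.
elim: k => [|k IH]; first by rewrite expr0 mul1r integral_st0.
apply: (@le_trans _ _ (\int[Pr]_w (lyapunov (st k.+1 w) + theta * gap k w)%:E)%E).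
  by apply: le_integral_nonneg => w; rewrite lee_fin// lerDl.
apply: le_trans (integral_lyapunov_le k) _.
by rewrite exprS -mulrA EFinM; apply: lee_wpmul2l; rewrite ?lee_fin// ltW.
Qed.

(** The one-step inequality multiplied by [(1 - eta) ^- k.+1] telescopes. [gap i] is taken at the
    state [i], whose [ec_u] produces the iterate [i.+1]; hence the exponent [i.+1]. *)
Lemma weighted_lyapunov_le k :
  (((1 - eta) ^- k)%:E * \int[Pr]_w (lyapunov (st k w))%:E +
   \sum_(0 <= i < k) ((1 - eta) ^- i.+1)%:E * \int[Pr]_w (theta * gap i w)%:E
   <= (lyapunov st0)%:E)%E.
Proof.
elim: k => [|k IH]; first by rewrite big_geq// adde0 expr0 invr1 mul1e integral_st0.
apply: le_trans IH; rewrite big_nat_recr//= [X in (_ + X)%E]addeC addeA; apply: leeD => //.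
have h : (\int[Pr]_w (lyapunov (st k.+1 w) + theta * gap k w)%:E <=
  (1 - eta)%:E * \int[Pr]_w (lyapunov (st k w))%:E)%E by exact: integral_lyapunov_le.
rewrite (integral_EFinD Pr (m_lyapunov _) (lyapunov_st_ge0 _) (m_theta_gap _)
  (theta_gap_ge0 _)) in h.
have l0 j : (0 <= \int[Pr]_w (lyapunov (st j w))%:E)%E.
  by apply: integral_ge0 => w _; rewrite lee_fin.
have t0 : (0 <= \int[Pr]_w (theta * gap k w)%:E)%E.
  by apply: integral_ge0 => w _; rewrite lee_fin.
rewrite -(ge0_muleDr _ (l0 k.+1) t0).
have v0 : 0 <= (1 - eta) ^- k.+1 by rewrite invr_ge0 exprn_ge0// ltW.
apply: le_trans (lee_wpmul2l _ h) _; first by rewrite lee_fin.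
by rewrite muleA -EFinM exprS invfM mulrAC mulVf ?mul1r// gt_eqF.
Qed.

Lemma integral_weighted_gap_le k :
  (\int[Pr]_w (\sum_(1 <= i < k.+1) (1 - eta) ^- i * gap i.-1 w)%:E <=
   (theta^-1 * lyapunov st0)%:E)%E.
Proof.
have v0 i : 0 <= (1 - eta) ^- i by rewrite invr_ge0 exprn_ge0// ltW.
have l0 : (0 <= ((1 - eta) ^- k)%:E * \int[Pr]_w (lyapunov (st k w))%:E)%E.
  by rewrite mule_ge0 ?lee_fin//; apply: integral_ge0 => w _; rewrite lee_fin.
have := le_trans (leeDr _ l0) (weighted_lyapunov_le k).
rewrite EFinM => /(lee_wpmul2l (x := (theta^-1)%:E)).
rewrite lee_fin invr_ge0 (ltW theta0) => /(_ isT); apply: le_trans.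
rewrite le_eqVlt; apply/orP; left; apply/eqP.
under eq_bigr do rewrite -integral_EFinZ//.
rewrite -integral_EFin_sum; last 2 first.
- by move=> i; exact: measurable_funM.
- by move=> i w; rewrite mulr_ge0.
rewrite -integral_EFinZ//; last 3 first.
- by rewrite invr_ge0 ltW.
- by apply: measurable_sum => i; exact: measurable_funM.
- by move=> w; apply: sumr_ge0 => i _; rewrite mulr_ge0.
apply: eq_integral => w _; congr (_%:E); rewrite big_add1 mulr_sumr.
by apply: eq_bigr => i _ /=; move: (_ ^- _) => a; field; rewrite gt_eqF.
Qed.

End OneStep.
End Process.

(** * Step size, rates and averaging *)

Lemma inv_min_le (R : realType) (a b : R) : 0 < a -> 0 < b ->
  (Num.min a b)^-1 <= a^-1 + b^-1.
Proof.
by move=> a0 b0; case: (leP a b) => _; rewrite ?lerDl ?lerDr invr_ge0 ltW.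
Qed.

Section StepSize.
Context {R : realType}.
Variables (M n lam gam delta Rt Q R2 Rm2 Rb2 a2 : R).
Hypotheses (M0 : 0 < M) (n0 : 0 < n) (lam0 : 0 < lam) (gam0 : 0 < gam)
  (delta0 : 0 < delta) (delta1 : delta < 1)
  (Rt0 : 0 < Rt) (Q0 : 0 < Q) (R2E : R2 = Rt ^+ 2) (Rm20 : 0 <= Rm2) (Rb20 : 0 <= Rb2)
  (a2E : a2 = (1 - delta) * (2 * R2 + 16 * Rb2 / n + 9 * delta * Rm2 / n))
  (QE : Q ^+ 2 = a2) (lamR2 : lam * gam <= R2) (RbR2 : Rb2 <= n * R2).

Let s := Num.sqrt (delta ^+ 2 * lam ^+ 2 * gam ^+ 2 * M ^+ 2 + 48 * lam * gam * a2).
Let T1 := 2 * delta * lam * gam / (delta * lam * gam * M + s).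
Let T2 := M * n * lam * gam * M^-1 / (3 * (Rm2 + n * R2) + M * n * lam * gam).
Let T3 := delta * lam * gam / (delta * lam * gam * M + 12 * Rt * Q).

Definition stepsize := Num.min T1 (Num.min T2 T3).
Local Notation theta := stepsize.

Let dlg0 : 0 < delta * lam * gam. Proof. by rewrite !mulr_gt0. Qed.
Let a20 : 0 < a2. Proof. by rewrite -QE exprn_gt0. Qed.
Let R20 : 0 < R2. Proof. by rewrite R2E exprn_gt0. Qed.

Let rad0 : 0 < delta ^+ 2 * lam ^+ 2 * gam ^+ 2 * M ^+ 2 + 48 * lam * gam * a2.
Proof. by rewrite addr_gt0// !mulr_gt0 ?exprn_gt0. Qed.

Let s0 : 0 < s. Proof. by rewrite sqrtr_gt0. Qed.
Let sE : s ^+ 2 = delta ^+ 2 * lam ^+ 2 * gam ^+ 2 * M ^+ 2 + 48 * lam * gam * a2.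
Proof. by rewrite sqr_sqrtr// ltW. Qed.

Let den1 : 0 < delta * lam * gam * M + s. Proof. by rewrite addr_gt0// mulr_gt0. Qed.
Let den2 : 0 < 3 * (Rm2 + n * R2) + M * n * lam * gam.
Proof. by rewrite addr_gt0 ?mulr_gt0// ltr_wpDl ?mulr_gt0. Qed.
Let den3 : 0 < delta * lam * gam * M + 12 * Rt * Q.
Proof. by rewrite addr_gt0// !mulr_gt0. Qed.

Let T10 : 0 < T1. Proof. by rewrite divr_gt0// !mulr_gt0. Qed.
Let T20 : 0 < T2. Proof. by rewrite divr_gt0// !mulr_gt0 ?invr_gt0. Qed.
Let T30 : 0 < T3. Proof. by rewrite divr_gt0. Qed.

Lemma stepsize_gt0 : 0 < theta.
Proof. by rewrite !lt_min T10 T20. Qed.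

Let theta2 : theta * (3 * (Rm2 + n * R2) + M * n * lam * gam) <= n * lam * gam.
Proof.
have -> : n * lam * gam = T2 * (3 * (Rm2 + n * R2) + M * n * lam * gam).
  by rewrite /T2; field; rewrite !gt_eqF.
by rewrite ler_pM2r// /theta !ge_min lexx orbT.
Qed.

Let theta1 : theta * (delta * lam * gam * M + s) <= 2 * delta * lam * gam.
Proof.
have -> : 2 * delta * lam * gam = T1 * (delta * lam * gam * M + s).
  by rewrite /T1; field; rewrite !gt_eqF.
by rewrite ler_pM2r// /theta !ge_min lexx.
Qed.

(* T1 is the positive root, with rationalized numerator, of the quadratic equation
   12 a2 x^2 + lam gam delta^2 M x = lam gam delta^2. *)
Lemma stepsize_cond1 :
  12 * a2 * theta ^+ 2 <= lam * gam * delta ^+ 2 * (1 - theta * M).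
Proof.
have th0 := stepsize_gt0; move: theta1 sE => h1 h2; move: (theta) th0 h1 => th th0 h1.
have g1 : s * th <= 2 * delta * lam * gam - delta * lam * gam * M * th by lra.
have g2 : (s * th) ^+ 2 <= (2 * delta * lam * gam - delta * lam * gam * M * th) ^+ 2.
  rewrite ler_pXn2r ?nnegrE//; first by rewrite mulr_ge0// ltW.
  by apply: le_trans g1; rewrite mulr_ge0// ltW.
rewrite exprMn h2 in g2.
have lg0 : 0 < 4 * lam * gam by rewrite !mulr_gt0.
rewrite -(ler_pM2l lg0); lra.
Qed.

Lemma stepsize_cond2 : 3 * (Rm2 + n * R2) * theta <= n * lam * gam * (1 - theta * M).
Proof. move: theta2; lra. Qed.

Lemma stepsize_cond3 : 12 * Rt * Q * theta <= delta * lam * gam * (1 - theta * M).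
Proof.
have : theta * (delta * lam * gam * M + 12 * Rt * Q) <= delta * lam * gam.
  by rewrite -ler_pdivlMr// /theta !ge_min lexx !orbT.
lra.
Qed.

Lemma stepsize_le1 : theta * M <= 1.
Proof.
have h : 0 <= 3 * (Rm2 + n * R2) * theta.
  by rewrite mulr_ge0 ?(ltW stepsize_gt0)// mulr_ge0// addr_ge0// mulr_ge0// ltW.
have := le_trans h stepsize_cond2.
by rewrite pmulr_rge0 ?mulr_gt0// subr_ge0.
Qed.

(** By [lam * gam <= R2], the radicand is at most [(delta lam gam M)^2 + 48 (Rt Q)^2], and 48 is
    below the square of 7. *)
Let s_le : s <= delta * lam * gam * M + 7 * (Rt * Q).
Proof.
rewrite -(@ler_pXn2r _ 2) ?nnegrE ?(ltW s0)//; last first.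
  by rewrite addr_ge0// !mulr_ge0// ltW.
rewrite sE -QE; have := ler_wpM2r (sqr_ge0 Q) lamR2; rewrite R2E => h.
have p1 : 0 <= delta * lam * gam * M * (Rt * Q) by rewrite ltW// !mulr_gt0.
have p2 : 0 <= Rt ^+ 2 * Q ^+ 2 by rewrite mulr_ge0 ?sqr_ge0.
lra.
Qed.

(** Compared after squaring, with [w ^ 2 = 1 - delta]. [Rb2 <= n R2] turns the coefficients 2 and 16
    into 18, below the square of 13/2; in the mixed term, [9 w ^ 2] is below twice the product of
    13/2 and 3/2 times [w], since [w <= 1]. *)
Let RtQ_le : Rt * Q <= 13 / 2 * (Num.sqrt (1 - delta) * R2) + 3 / 2 * (delta * (Rm2 / n)).
Proof.
have wE : Num.sqrt (1 - delta) ^+ 2 = 1 - delta by rewrite sqr_sqrtr// subr_ge0 ltW.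
have w0 : 0 < Num.sqrt (1 - delta) by rewrite sqrtr_gt0 subr_gt0.
move: (Num.sqrt (1 - delta)) wE w0 => w wE w0.
have r0 : 0 <= Rm2 / n by rewrite divr_ge0// ltW.
have w1 : w <= 1.
  rewrite -(@ler_pXn2r _ 2) ?nnegrE ?(ltW w0)// wE expr1n.
  by rewrite lerBlDr lerDl ltW.
have rhs0 : 0 <= 13 / 2 * (w * R2) + 3 / 2 * (delta * (Rm2 / n)).
  by rewrite addr_ge0// mulr_ge0// mulr_ge0// ltW.
rewrite -(@ler_pXn2r _ 2) ?nnegrE ?mulr_ge0 ?(ltW Rt0) ?(ltW Q0)//.
rewrite exprMn -R2E QE a2E -wE.
have -> : 2 * R2 + 16 * Rb2 / n + 9 * delta * Rm2 / n =
   2 * R2 + 16 * (Rb2 / n) + 9 * (delta * (Rm2 / n)) by ring.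
have b1 : Rb2 / n <= R2 by rewrite ler_pdivrMr// mulrC.
have u0 : 0 <= delta * (Rm2 / n) by rewrite mulr_ge0// ltW.
have p1 : 0 <= w ^+ 2 * R2 * (R2 - Rb2 / n).
  by rewrite mulr_ge0 ?subr_ge0// mulr_ge0 ?sqr_ge0// ltW.
have p3 : 0 <= w * (R2 * (delta * (Rm2 / n))).
  by apply: mulr_ge0; [exact: ltW|apply: mulr_ge0 => //; exact: ltW].
have p2 : 0 <= (1 - w) * (w * (R2 * (delta * (Rm2 / n)))) by rewrite mulr_ge0 ?subr_ge0.
have p4 := sqr_ge0 (w * R2).
have p5 := sqr_ge0 (delta * (Rm2 / n)).
move: p1 p2 p3 p4 p5; move: (Rb2 / n) (delta * (Rm2 / n)) => rb u; lra.
Qed.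

(** The inverse of a minimum is at most the sum of the inverses. The worst coefficient is that of
    the last term: 7/2 from [T1] plus 12 from [T3], times the 13/2 of [RtQ_le], is 100.75. *)
Lemma inv_stepsize_le :
  theta^-1 <= 101 * (M + Rm2 / (n * lam * gam) + R2 / (lam * gam)
                     + Num.sqrt (1 - delta) / delta * (R2 / (lam * gam))).
Proof.
have w0 := sqrtr_ge0 (1 - delta).
move: (Num.sqrt (1 - delta)) w0 RtQ_le => w w0 h.
have i1 : T1^-1 <= M + 7 / 2 * (Rt * Q / (delta * lam * gam)).
  have -> : T1^-1 = (delta * lam * gam * M + s) / (2 * (delta * lam * gam)).
    by rewrite /T1 invf_div !mulrA.
  rewrite ler_pdivrMr ?mulr_gt0//.
  have -> : (M + 7 / 2 * (Rt * Q / (delta * lam * gam))) * (2 * (delta * lam * gam)) =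
     2 * (delta * lam * gam * M) + 7 * (Rt * Q) by field; rewrite !gt_eqF.
  by move: s_le; lra.
have i2 : T2^-1 = M + 3 * (Rm2 / (n * lam * gam)) + 3 * (R2 / (lam * gam)).
  by rewrite /T2; field; rewrite !gt_eqF.
have i3 : T3^-1 = M + 12 * (Rt * Q / (delta * lam * gam)).
  by rewrite /T3; field; rewrite !gt_eqF.
have hd : Rt * Q / (delta * lam * gam) <=
    13 / 2 * (w / delta * (R2 / (lam * gam))) + 3 / 2 * (Rm2 / (n * lam * gam)).
  rewrite ler_pdivrMr//.
  have -> : (13 / 2 * (w / delta * (R2 / (lam * gam))) + 3 / 2 * (Rm2 / (n * lam * gam))) *
     (delta * lam * gam) = 13 / 2 * (w * R2) + 3 / 2 * (delta * (Rm2 / n)).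
    by field; rewrite !gt_eqF.
  exact: h.
have p1 : 0 <= Rm2 / (n * lam * gam) by rewrite divr_ge0// !mulr_ge0// ltW.
have p2 : 0 <= R2 / (lam * gam) by rewrite divr_ge0 ?mulr_ge0// ltW.
have p3 : 0 <= w / delta * (R2 / (lam * gam)) by rewrite mulr_ge0// divr_ge0// ltW.
have p4 := M0.
have t1 : theta^-1 <= T1^-1 + (Num.min T2 T3)^-1 by rewrite inv_min_le// lt_min T20.
have t2 := inv_min_le T20 T30.
lra.
Qed.

End StepSize.

Lemma rate_le (R : realType) (eta c eps : R) (k : nat) :
  0 < eta <= 1 -> eta^-1 <= 105 * c -> 0 < eps <= 1 ->
  210 * (c * ln eps^-1) <= k%:R -> (1 - eta) ^+ k <= eps ^+ 2.
Proof.
move=> /andP[eta0 eta1] etac /andP[eps0 eps1] kc.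
have l0 : 0 <= ln eps^-1 by rewrite ln_ge0// invf_ge1.
have h : 2 * ln eps^-1 <= eta * k%:R.
  rewrite [leRHS]mulrC -ler_pdivrMr//; apply: le_trans kc.
  rewrite mulrAC -mulrA [eta^-1 * _]mulrC mulrA.
  by have := ler_wpM2l l0 etac; lra.
apply: (@le_trans _ _ (expR (- eta) ^+ k)).
  rewrite lerXn2r ?nnegrE ?expR_ge0 ?subr_ge0//.
  by have := expR_ge1Dx (- eta).
rewrite -expRM_natl.
have -> : eps ^+ 2 = expR (2 * ln eps).
  by rewrite -[eps in LHS]lnK// -expRM_natl.
rewrite ler_expR; rewrite lnV ?posrE// in h; lra.
Qed.

(** Jensen by induction on the number of terms; the real bounds [r] spare sums of extended values.
    Indices start at 1, the iterate 0 being arbitrary, and the upper end [k.+2] keeps the total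
    weight positive. *)
Lemma econvex_jensen (R : realType) d (f : 'cV[R]_d -> \bar R) (x : nat -> 'cV[R]_d)
    (r w : nat -> R) : econvex f -> (forall i, 0 < w i) ->
  (forall i, (0 < i)%N -> (f (x i) <= (r i)%:E)%E) -> forall k,
  (f ((\sum_(1 <= i < k.+2) w i)^-1 *: \sum_(1 <= i < k.+2) w i *: x i) <=
   ((\sum_(1 <= i < k.+2) w i)^-1 * \sum_(1 <= i < k.+2) w i * r i)%:E)%E.
Proof.
move=> fc w0 fx; elim=> [|k IH].
  by rewrite !big_nat1 scalerA mulrA mulVf ?gt_eqF// scale1r mul1r fx.
rewrite !(big_nat_recr k.+2)//=.
move: IH; set W := \sum_(1 <= i < k.+2) w i; set X := \sum_(_ <= _ < _) _ *: _.
set F := \sum_(_ <= _ < _) _ * _ => IH.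
have W0 : 0 < W.
  rewrite /W big_nat_recr//= ltr_wpDl// big_nat_cond sumr_ge0// => i _; exact: ltW.
have V0 : 0 < W + w k.+2 by rewrite addr_gt0.
pose a := W / (W + w k.+2).
have a01 : 0 <= a <= 1.
  by rewrite divr_ge0 ?(ltW W0) ?(ltW V0)//= ler_pdivrMr// mul1r lerDl ltW.
have aE : 1 - a = w k.+2 / (W + w k.+2) by rewrite /a; field; rewrite gt_eqF.
have -> : (W + w k.+2)^-1 *: (X + w k.+2 *: x k.+2) = a *: (W^-1 *: X) + (1 - a) *: x k.+2.
  rewrite scalerDr !scalerA aE /a; congr (_ *: _ + _ *: _); first by field; rewrite !gt_eqF.
  by rewrite mulrC.
apply: le_trans (fc _ _ _ a01) _.
have /andP[a0 a1] := a01.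
have -> : ((W + w k.+2)^-1 * (F + w k.+2 * r k.+2))%:E =
    (a%:E * (W^-1 * F)%:E + (1 - a)%:E * (r k.+2)%:E)%E.
  by rewrite -!EFinM -EFinD aE /a; congr (_%:E); field; rewrite !gt_eqF.
by apply: leeD; apply: lee_wpmul2l; rewrite ?lee_fin ?subr_ge0// fx.
Qed.

Lemma sum_geometric (R : realType) (q : R) k : 0 < q < 1 ->
  \sum_(1 <= i < k.+1) q ^- i = (q ^- k - 1) / (1 - q).
Proof.
move=> /andP[q0 q1]; have h : 0 < 1 - q by rewrite subr_gt0.
elim: k => [|k IH]; first by rewrite big_geq// expr0 invr1 subrr mul0r.
rewrite big_nat_recr//= IH exprS; have := exprn_gt0 k q0; move: (q ^+ k) => p p0.
by field; rewrite !gt_eqF.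
Qed.

Section Optimality.
Context {R : realType} {m n d t : nat} (A : 'I_m -> 'I_n -> 'M[R]_(d, t))
  (phi : 'I_m -> 'I_n -> 'cV[R]_t -> R) (g : 'cV[R]_d -> \bar R) (lam gam : R).
Hypotheses (m0 : (0 < m)%N) (n0 : (0 < n)%N) (gam0 : 0 < gam) (lam0 : 0 < lam)
  (phic : forall i tau, convex_function [set: convex_lmodType 'cV[R]_t] (phi i tau))
  (phis : forall i tau, smooth gam^-1 (phi i tau))
  (gp : proper_closed_convex g) (gs : strongly_convex 1 g).

Local Notation h := (fine \o conjugate g).

Lemma finite_dual_grad : finite_dual phi (fun i tau => - grad (phi i tau) 0).
Proof. by move=> i tau; rewrite opprK (conjugate_grad gam0 (phis i tau)). Qed.

(** Gradients of the [phi] at 0 give a feasible dual point, so the dual optimum is not [-oo]; weak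
    duality bounds the primal optimum from below, and a point [grad h u] bounds it from above. *)
Lemma optimal_values xstar alphastar :
  (forall x, primal A phi g lam xstar <= primal A phi g lam x)%E ->
  (forall alpha, dual A phi g lam alpha <= dual A phi g lam alphastar)%E ->
  exists Pst, [/\ finite_dual phi alphastar, primal A phi g lam xstar = Pst%:E,
    forall u, Pst <= primalR A phi g lam u, dualR A phi g lam alphastar <= Pst &
    forall alpha, finite_dual phi alpha ->
      dualR A phi g lam alpha <= dualR A phi g lam alphastar].
Proof.
move=> xmin amax.
have fs : finite_dual phi alphastar.
  apply: contrapT => nf; have := amax (fun i tau => - grad (phi i tau) 0).
  by rewrite (dual_infinite A lam m0 n0 gp gs nf) (dual_finite A lam gp gs finite_dual_grad).
have Px u := primal_grad_conjugate A phi lam gp gs u.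
have [Pst PE] : exists Pst, primal A phi g lam xstar = Pst%:E.
  exists (fine (primal A phi g lam xstar)); rewrite fineK//.
  rewrite fin_numElt; apply/andP; split.
    exact: lt_le_trans (ltNyr _) (weak_duality A m0 n0 lam0 gp gs xstar fs).
  by apply: le_lt_trans (xmin (grad h 0)) _; rewrite Px ltry.
exists Pst; split=> //.
- by move=> u; rewrite -lee_fin -PE -Px.
- by rewrite -lee_fin -PE; exact: weak_duality.
- by move=> alpha fa; rewrite -lee_fin -!(dual_finite _ _ gp gs).
Qed.

(** Jensen is applied separately to the finite part and to [g], whose values at the iterates are
    explicit. *)
Lemma primal_average_le (x u : nat -> 'cV[R]_d) (w : nat -> R) k :
  (forall i, 0 < w i) -> (forall i, (0 < i)%N -> x i = grad h (u i)) ->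
  (primal A phi g lam
     ((\sum_(1 <= i < k.+2) w i)^-1 *: \sum_(1 <= i < k.+2) w i *: x i) <=
   ((\sum_(1 <= i < k.+2) w i)^-1 * \sum_(1 <= i < k.+2) w i * primalR A phi g lam (u i))%:E)%E.
Proof.
move=> w0 xu.
pose Phi (x : 'cV[R]_d) := (m * n)%:R^-1 *
  \sum_(tau < n) \sum_(i < m) phi i tau ((A i tau)^T *m x).
have Phic : econvex (EFin \o Phi).
  move=> y z s s01; rewrite /= -!EFinM -EFinD lee_fin /Phi [s * _]mulrCA [(1 - s) * _]mulrCA -mulrDr.
  rewrite ler_wpM2l ?invr_ge0// !mulr_sumr -big_split; apply: ler_sum => tau _ /=.
  rewrite !mulr_sumr -big_split; apply: ler_sum => i _ /=.
  by rewrite mulmxDr -!scalemxAr; exact: convex_functionP.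
have [_ _ _ gc] := gp.
have jg := econvex_jensen (x := x) (r := fun i => dot (grad h (u i)) (u i) - h (u i)) gc w0.
have jP := econvex_jensen (x := x) (r := fun i => Phi (grad h (u i))) Phic w0.
have {}jg := jg _ k; have {}jP := jP _ k.
rewrite /primal; apply: le_trans (leeD (jP _) (lee_wpmul2l _ (jg _))) _.
- by move=> i i0; rewrite xu.
- by rewrite lee_fin ltW.
- by move=> i i0; rewrite xu// g_grad_conjugate.
rewrite -EFinM -EFinD lee_fin mulrCA -mulrDr le_eqVlt; apply/orP; left; apply/eqP.
congr (_ * _); rewrite mulr_sumr -big_split; apply: eq_bigr => i _ /=.
by rewrite [lam * _]mulrCA -mulrDr.
Qed.

End Optimality.

Theorem theorem3p6 (R : realType) :
  exists (C : R) (eps0 : R -> R), 0 < C /\ (forall r, 0 < eps0 r) /\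
  forall (m n d t : nat)
    (A : 'I_m -> 'I_n -> 'M[R]_(d, t)) (phi : 'I_m -> 'I_n -> 'cV[R]_t -> R)
    (g : 'cV[R]_d -> \bar R) (lam gam delta : R)
    (dS : measure_display) (S : measurableType dS) (nu : probability S R)
    (Q : S -> 'cV[R]_d -> 'cV[R]_d)
    (dT : measure_display) (T : measurableType dT) (Pr : probability T R)
    (idx : nat -> 'I_n -> T -> 'I_m) (seed : nat -> 'I_n -> T -> S)
    (x0 : 'cV[R]_d) (alpha0 : 'I_m -> 'I_n -> 'cV[R]_t)
    (xstar : 'cV[R]_d) (alphastar : 'I_m -> 'I_n -> 'cV[R]_t),
  (0 < m)%N -> (0 < n)%N ->
  0 < gam -> 0 < lam -> lam <= R2 A / gam ->
  (forall i tau,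
     convex_function [set: convex_lmodType 'cV[R]_t] (phi i tau)) ->
  (forall i tau, smooth gam^-1 (phi i tau)) ->
  proper_closed_convex g -> strongly_convex 1 g ->
  contraction_compressor nu Q delta -> delta < 1 ->
  (forall x j, ('E_nu[(fun s => Q s x j 0)%R] = (delta * x j 0)%:E)%E) ->
  ec_sampling nu Pr idx seed ->
  (forall x, primal A phi g lam xstar <= primal A phi g lam x)%E ->
  (forall alpha, dual A phi g lam alpha <= dual A phi g lam alphastar)%E ->
  let N : R := (m * n)%:R in
  let Rt := Num.sqrt (R2 A) in
  let a2 := (1 - delta) * (2 * R2 A + 16 * Rbar2 A / n%:R
                           + 9 * delta * Rm A ^+ 2 / n%:R) in
  let rho := delta * lam * Rt / (2 * Num.sqrt a2) in
  let p : R := m%:R^-1 in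
  let v := Rm A ^+ 2 + n%:R * R2 A in
  let theta :=
    Num.min
      (2 * delta * lam * gam
       / (delta * lam * gam * m%:R
          + Num.sqrt (delta ^+ 2 * lam ^+ 2 * gam ^+ 2 * m%:R ^+ 2
                      + 48 * lam * gam * a2)))
      (Num.min
        (N * lam * gam * p / (3 * v + N * lam * gam))
        (delta * lam * gam
         / (delta * lam * gam * m%:R + 12 * Rt * Num.sqrt a2))) in
  let eta := Num.min theta (delta / 4) in
  let st k w := ec_sdca A phi g lam theta x0 alpha0
    (fun l tau => idx l tau w) (fun l tau => Q (seed l tau w)) k in
  let epsD s :=
    (dual A phi g lam alphastar - dual A phi g lam (ec_alpha s))%E in
  let ebar s := n%:R^-1 *: \sum_(tau < n) ec_e s tau in
  let Psi s :=
    (epsD s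
     + (2 * (rho + theta * lam) / delta * enorm (ebar s) ^+ 2)%:E
     + (16 * (1 - delta) * (rho + theta * lam) / (delta * n%:R ^+ 2)
        * \sum_(tau < n) enorm (ec_e s tau) ^+ 2)%:E)%E in
  let st0 := ec_init A lam x0 alpha0 in
  let wt k := (1 - eta) ^- k in
  let W k := \sum_(1 <= i < k.+1) wt i in
  let xbar k w := (W k)^-1 *: \sum_(1 <= i < k.+1) wt i *: ec_x (st i w) in
  let gap k w := (primal A phi g lam (xbar k w) - primal A phi g lam xstar)%E in
  let complexity :=
    delta^-1 + m%:R + Rm A ^+ 2 / (n%:R * lam * gam) + R2 A / (lam * gam)
    + Num.sqrt (1 - delta) / delta * (R2 A / (lam * gam)) in
  [/\ forall k,
        (\int[Pr]_w Psi (st k w) <= ((1 - eta) ^+ k)%:E * Psi st0)%E,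
      forall (D0 eps : R) k, epsD st0 = D0%:E -> 0 < eps <= eps0 D0 ->
        C * (complexity * ln eps^-1) <= k%:R ->
        (\int[Pr]_w Psi (st k w) <= eps%:E)%E,
      forall k, (0 < k)%N ->
        (\int[Pr]_w gap k w
         <= ((1 - eta) ^+ k / (1 - (1 - eta) ^+ k))%:E * epsD st0)%E
    & forall (D0 eps : R) k, epsD st0 = D0%:E -> 0 < eps <= eps0 D0 -> eps <= D0 ->
        C * (complexity * ln eps^-1) <= k%:R ->
        (\int[Pr]_w gap k w <= eps%:E)%E].
Proof.
(* (1 - eta)^k <= exp(- eta k) <= eps^2 as soon as k >= (2 / eta) ln(1 / eps), and
   eps <= 1 / (2 + 2 |D0|) makes eps^2 small against eps even after multiplication
   by D0; 105 bounds the ratio of 1 / eta to the complexity. *)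
exists 210, (fun r => (2 + 2 * `|r|)^-1); split=> //; split=> [r|].
  by rewrite invr_gt0 ltr_pwDl// mulr_ge0.
move=> m n d t A phi g lam gam delta dS S nu Q dT T Pr idx seed x0 alpha0 xstar alphastar.
move=> m0 n0 gam0 lam0 lamle phic phis gp gs Qc delta1 Qm samp xmin amax.
move=> N Rt a2 rho p v theta eta st epsD ebar Psi st0 wt W xbar gap complexity.
have delta0 : 0 < delta by case: Qc => /andP[].
have mR : 0 < m%:R :> R by rewrite ltr0n.
have nR : 0 < n%:R :> R by rewrite ltr0n.
have lamR2 : lam * gam <= R2 A by rewrite -ler_pdivlMr.
have R20 : 0 < R2 A by apply: lt_le_trans lamR2; rewrite mulr_gt0.
have Rt0 : 0 < Rt by rewrite sqrtr_gt0.
have R2E : R2 A = Rt ^+ 2 by rewrite sqr_sqrtr// ltW.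
have Rm20 : 0 <= Rm A ^+ 2 by exact: sqr_ge0.
have Rb20 := Rbar2_ge0 A.
have a20 : 0 < a2.
  rewrite mulr_gt0 ?subr_gt0// ltr_wpDr//.
    by rewrite divr_ge0 ?(ltW nR)// mulr_ge0// mulr_ge0// ltW.
  by apply: ltr_wpDr; [rewrite divr_ge0 ?(ltW nR)// mulr_ge0|rewrite mulr_gt0].
have Q0 : 0 < Num.sqrt a2 by rewrite sqrtr_gt0.
have QE : Num.sqrt a2 ^+ 2 = a2 by rewrite sqr_sqrtr// ltW.
have rho0 : 0 < rho by rewrite divr_gt0 ?mulr_gt0.
have thetaE : theta =
    stepsize m%:R n%:R lam gam delta Rt (Num.sqrt a2) (R2 A) (Rm A ^+ 2) a2.
  by rewrite /theta /N natrM.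
have theta0 : 0 < theta by rewrite thetaE; exact: stepsize_gt0.
have theta1 : theta * m%:R <= 1 by rewrite thetaE; exact: stepsize_le1.
have coef : theta ^+ 2 * R2 A / (2 * rho * (m%:R * n%:R))
  + theta ^+ 2 * (R2 A + Rm A ^+ 2 / n%:R) / (2 * lam * (m%:R * n%:R))
  + 2 * (rho + theta * lam) / delta * ((1 - delta) * (2 * R2 A / delta + (1 - delta) * Rm A ^+ 2 / n%:R
      + delta * (2 * Rbar2 A + Rm A ^+ 2) / n%:R) * theta ^+ 2 / (lam ^+ 2 * (m%:R * n%:R)))
  + 16 * (1 - delta) * (rho + theta * lam) / (delta * n%:R ^+ 2) *
    ((1 - delta) * (2 * Rbar2 A / delta + Rm A ^+ 2) * theta ^+ 2 / (lam ^+ 2 * m%:R))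
  <= theta * gam * (1 - theta * m%:R) / (2 * (m%:R * n%:R)).
  apply: (@stepsize_coef_le _ _ _ _ _ _ _ _ Rt (Num.sqrt a2) _ _ _ a2) => //.
  - by rewrite thetaE; exact: stepsize_cond1.
  - by rewrite thetaE; exact: stepsize_cond2.
  - by rewrite thetaE; exact: stepsize_cond3.
have inv_theta : theta^-1 <= 101 * (m%:R + Rm A ^+ 2 / (n%:R * lam * gam) + R2 A / (lam * gam)
    + Num.sqrt (1 - delta) / delta * (R2 A / (lam * gam))).
  rewrite thetaE; apply: (@inv_stepsize_le _ _ _ _ _ _ _ _ _ _ (Rbar2 A)) => //.
  exact: Rbar2_le_R2.
have etat : eta <= theta by rewrite ge_min lexx.
have etad : eta <= delta / 4 by rewrite ge_min lexx orbT.
have eta0 : 0 < eta by rewrite lt_min theta0 divr_gt0.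
have eta1 : eta < 1.
  apply: le_lt_trans etad _; rewrite ltr_pdivrMr// mul1r.
  by apply: lt_le_trans delta1 _; rewrite ler1n.
have q01 : 0 < 1 - eta < 1 by rewrite subr_gt0 eta1 ltrBlDr ltrDl.
have /andP[q0 q1] := q01.
(* 105 is the 101 of the step size plus the 4 of the alternative [delta / 4] in [eta]. *)
have inv_eta : eta^-1 <= 105 * complexity.
  have : eta^-1 <= theta^-1 + 4 * delta^-1.
    by have := inv_min_le theta0 (divr_gt0 delta0 (ltr0n R 4)); rewrite invf_div.
  have c1 : 0 < delta^-1 by rewrite invr_gt0.
  have c2 : 0 <= Rm A ^+ 2 / (n%:R * lam * gam) by rewrite divr_ge0// !mulr_ge0// ltW.
  have c3 : 0 <= R2 A / (lam * gam) by exact: divr_ge0 (ltW R20) (mulr_ge0 (ltW lam0) (ltW gam0)).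
  have c4 : 0 <= Num.sqrt (1 - delta) / delta * (R2 A / (lam * gam)).
    by rewrite mulr_ge0// divr_ge0 ?sqrtr_ge0// ltW.
  by rewrite /complexity; lra.
have [Pst [fs PE Pmin DP Dmax]] := optimal_values m0 n0 gam0 lam0 phic phis gp gs xmin amax.
pose Dst := dualR A phi g lam alphastar.
have DE : dual A phi g lam alphastar = Dst%:E by exact: dual_finite.
have Psi0 : Psi st0 = epsD st0.
  have e0 : ebar st0 = 0 by rewrite /ebar /= big1// scaler0.
  have s0 : \sum_(tau < n) enorm (ec_e st0 tau) ^+ 2 = 0.
    by apply: big1 => tau _; rewrite /= sqr_enorm dot0l.
  by rewrite /Psi e0 s0 sqr_enorm dot0l !mulr0 !adde0.
have eps_infinite : ~ finite_dual phi alpha0 -> epsD st0 = +oo%E.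
  by move=> nf; rewrite /epsD /= (dual_infinite A lam m0 n0 gp gs nf) DE.
have eps_finite : finite_dual phi alpha0 -> epsD st0 = (Dst - dualR A phi g lam alpha0)%:E.
  by move=> fa; rewrite /epsD DE (dual_finite A lam gp gs).
pose lyap := lyapunov A phi g lam theta delta rho Dst.
have PsiE s : finite_dual phi (ec_alpha s) -> Psi s = (lyap s)%:E.
  move=> fa; rewrite /Psi /epsD DE (dual_finite A lam gp gs)// -EFinB -!EFinD.
  rewrite /lyap /lyapunov sqr_enorm; congr (_ + _ * _)%:E.
  by apply: eq_bigr => tau _; rewrite sqr_enorm.
have lyap0 : finite_dual phi alpha0 -> lyap st0 = Dst - dualR A phi g lam alpha0.
  by move=> fa; apply: EFin_inj; rewrite -PsiE// Psi0 eps_finite.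
have decay k : (\int[Pr]_w Psi (st k w) <= ((1 - eta) ^+ k)%:E * Psi st0)%E.
  (* An infeasible [alpha0] makes the right-hand side [+oo]. *)
  have [fa|nfa] := pselect (finite_dual phi alpha0); last first.
    by rewrite Psi0 eps_infinite// gt0_muley ?leey// lte_fin exprn_gt0.
  rewrite PsiE// -EFinM.
  have := integral_lyapunov_decay x0 m0 n0 gam0 lam0 phic phis gp gs theta0 theta1 samp Qc Qm
    rho0 delta1 etat etad Dmax Pmin DP fa coef k.
  apply: le_trans; rewrite le_eqVlt; apply/orP; left; apply/eqP; apply: eq_integral => w _.
  apply: PsiE.
  by have [] := @process_consistent R m n d t A phi g lam gam theta dS S Q dT T idx seed x0 alpha0
    m0 n0 gam0 lam0 phic phis theta0 theta1 k w fa.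
have gap_le k : (0 < k)%N -> (\int[Pr]_w gap k w
    <= ((1 - eta) ^+ k / (1 - (1 - eta) ^+ k))%:E * epsD st0)%E.
  case: k => // k _.
  have qk0 : 0 < (1 - eta) ^+ k.+1 by rewrite exprn_gt0.
  have qk1 : 0 < 1 - (1 - eta) ^+ k.+1 by rewrite subr_gt0 exprn_ilt1// ltW.
  have [fa|nfa] := pselect (finite_dual phi alpha0); last first.
    by rewrite eps_infinite// gt0_muley ?leey// lte_fin divr_gt0.
  rewrite eps_finite// -EFinM -lyap0//.
  have wt0 i : 0 < wt i by rewrite invr_gt0 exprn_gt0.
  have W0 : 0 < W k.+1.
    rewrite /W big_nat_recr//= ltr_wpDl// sumr_ge0// => i _; exact: ltW.
  pose F k w := \sum_(1 <= i < k.+1) wt i * (primalR A phi g lam (ec_u (st i.-1 w)) - Pst).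
  have F0 j w : 0 <= F j w by apply: sumr_ge0 => i _; rewrite mulr_ge0 ?subr_ge0// ltW.
  have mF j : measurable_fun [set: T] (F j).
    apply: measurable_sum => i; apply: measurable_funM => //; apply: measurable_funB => //.
    have [_ mu _] := @measurable_iterate R m n d t A phi g lam gam theta dS S nu Q delta dT T Pr idx seed
      x0 alpha0 gam0 phis gp gs samp Qc i.-1.
    exact: (measurable_primalR A lam phis gp gs mu).
  apply: (@le_trans _ _ (\int[Pr]_w ((W k.+1)^-1 * F k.+1 w)%:E)%E).
    apply: le_integral_nonneg => w; first by rewrite /gap PE sube_ge0// -PE xmin.
    have xu i : (0 < i)%N ->
        ec_x (st i w) = grad (fine \o conjugate g) (ec_u (st i.-1 w)) by case: i.
    have J := @primal_average_le R m n d t A phi g lam lam0 phic gp gs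
      (fun i => ec_x (st i w)) (fun i => ec_u (st i.-1 w)) wt k wt0 xu.
    rewrite /gap PE leeBlDr//; apply: le_trans J _; rewrite -EFinD lee_fin -/(W k.+1) /F.
    have -> : \sum_(1 <= i < k.+2) wt i * (primalR A phi g lam (ec_u (st i.-1 w)) - Pst) =
        \sum_(1 <= i < k.+2) wt i * primalR A phi g lam (ec_u (st i.-1 w)) - W k.+1 * Pst.
      rewrite /W mulr_suml -sumrN -big_split; apply: eq_bigr => i _ /=; ring.
    by rewrite mulrBr mulKf ?gt_eqF// subrK.
  rewrite integral_EFinZ// ?invr_ge0 ?(ltW W0)//.
  have := integral_weighted_gap_le x0 m0 n0 gam0 lam0 phic phis gp gs theta0 theta1 samp Qc Qm
    rho0 delta1 etat etad Dmax Pmin DP fa coef k.+1.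
  move=> /(lee_wpmul2l (x := ((W k.+1)^-1)%:E)).
  rewrite lee_fin invr_ge0 (ltW W0) => /(_ isT) /le_trans; apply.
  rewrite -EFinM lee_fin -/(lyap st0).
  have l0 : 0 <= lyap st0 by rewrite lyap0// subr_ge0; exact: Dmax.
  rewrite mulrA; apply: ler_wpM2r => //.
  (* The weights sum to [((1 - eta) ^- k.+1 - 1) / eta]. Dividing [theta^-1 * lyap st0] by this
     leaves the announced ratio times [eta / theta], which is at most 1. *)
  rewrite /W sum_geometric// opprB addrCA subrr addr0.
  have -> : ((1 - eta) ^- k.+1 - 1) / eta =
      (1 - (1 - eta) ^+ k.+1) / ((1 - eta) ^+ k.+1 * eta).
    by move: qk0; move: (_ ^+ k.+1) => r r0; field; rewrite !gt_eqF.
  move: qk0 qk1; move: (_ ^+ k.+1) => r r0 r1.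
  have -> : ((1 - r) / (r * eta))^-1 * theta^-1 = r / (1 - r) * (eta / theta).
    by field; rewrite !gt_eqF.
  by rewrite ler_piMr ?divr_ge0 ?(ltW r0) ?(ltW r1)// ler_pdivrMr// mul1r.
have rate (D0 eps : R) k : 0 < eps <= (2 + 2 * `|D0|)^-1 ->
    210 * (complexity * ln eps^-1) <= k%:R ->
    (1 - eta) ^+ k <= eps ^+ 2 /\ eps * (1 + `|D0|) <= 1 / 2.
  move=> /andP[e0 e1] kc; have D1 : 0 <= `|D0| by [].
  have D2 : 0 < 2 + 2 * `|D0| by rewrite ltr_pwDl// mulr_ge0.
  have h : eps * (2 + 2 * `|D0|) <= 1 by rewrite -ler_pdivlMr// mul1r.
  split; last lra.
  apply: (rate_le _ inv_eta) kc; rewrite ?eta0 ?e0//= ?(ltW eta1)//.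
  have : 0 <= eps * `|D0| by rewrite mulr_ge0// ltW.
  lra.
split=> //.
- move=> D0 eps k E e01 kc; apply: le_trans (decay k) _.
  have [h1 h2] := rate _ _ _ e01 kc; have /andP[e0 _] := e01.
  rewrite Psi0 E -EFinM lee_fin.
  have qk0 : 0 <= (1 - eta) ^+ k by rewrite exprn_ge0// ltW.
  apply: (@le_trans _ _ ((1 - eta) ^+ k * `|D0|)); first by rewrite ler_wpM2l// ler_norm.
  apply: (@le_trans _ _ (eps ^+ 2 * `|D0|)); first by rewrite ler_wpM2r.
  by rewrite expr2 -mulrA ler_piMr ?(ltW e0)//; lra.
- move=> D0 eps k E e01 eD kc.
  have [h1 h2] := rate _ _ _ e01 kc; have /andP[e0 _] := e01.
  have D00 : 0 < D0 by exact: lt_le_trans eD.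
  rewrite gtr0_norm// in h2.
  have p0 : 0 <= eps * D0 by rewrite mulr_ge0// ltW.
  have e1 : eps < 1 by lra.
  have e2 : eps ^+ 2 < 1 by rewrite exprn_ilt1// ltW.
  (* For [k = 0] the rate would read [1 <= eps ^ 2], against [eps < 1]. *)
  have k0 : (0 < k)%N.
    rewrite lt0n; apply/eqP => kE; have := le_lt_trans h1 e2.
    by rewrite kE expr0 ltxx.
  apply: le_trans (gap_le k k0) _; rewrite E -EFinM lee_fin.
  have qk1 : 0 < 1 - (1 - eta) ^+ k by rewrite subr_gt0; exact: le_lt_trans h1 e2.
  (* The left side becomes at most [eps ^ 2 * D0], hence at most [eps / 2 - eps ^ 2], and the right
     side is at least [eps - eps ^ 3]. *)
  rewrite mulrAC ler_pdivrMr//.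
  have h3 := ler_wpM2r (ltW D00) h1.
  have h4 := ler_wpM2l (ltW e0) h1.
  have h5 := ler_wpM2l (ltW e0) h2.
  have h6 : eps * (eps * eps) <= eps * (eps * 1) by rewrite !ler_wpM2l// ltW.
  lra.
Qed.
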